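(* Let $G$ be a simply connected 2-step nilpotent Lie group with Lie algebra $\mathfrak{g}$, let $\Gamma < G$ be a cocompact discrete subgroup, and let $M = \Gamma\backslash G$ be the associated 2-step nilmanifold. Let $g$ be a left-invariant Riemannian metric on $M$ and let $\sigma$ be a left-invariant magnetic field on $M$ that vanishes on the derived algebra, i.e. $\sigma(X,D)=0$ for all $X\in\mathfrak{g}$ and $D\in[\mathfrak{g},\mathfrak{g}]$, and that represents a rational cohomology class. Then the magnetic flow of $(M,g,\sigma)$, restricted to the unit cotangent bundle $\{(x,\lambda)\in T^*M : |\lambda| = 1\}$, has zero topological entropy.
   Context: A magnetic field on a closed manifold $M$ is a closed 2-form $\sigma$ on $M$. A metric or differential form on $M=\Gamma\backslash G$ is called left-invariant if its pullback to $G$ is left-invariant; a left-invariant 2-form $\sigma$ is identified with the corresponding alternating bilinear form on $\mathfrak{g}=T_eG$. The 2-form $\sigma$ represents a rational cohomology class if its de Rham class in $H^2(M;\mathbb{R})$ lies in the image of $H^2(M;\mathbb{Q})$. Magnetic flow: let $\omega_{\mathrm{can}}$ be the canonical symplectic form on $T^*M$, $\pi:T^*M\to M$ the projection, and $H:T^*M\to\mathbb{R}$, $H(x,\lambda)=\frac12 |\lambda|^2$, where $|\cdot|$ is the norm induced by $g$ on $T^*M$. The magnetic flow of $(M,g,\sigma)$ is the Hamiltonian flow of $H$ on the symplectic manifold $(T^*M,\omega_{\mathrm{can}}+\pi^*\sigma)$. It preserves $H$, hence preserves the unit cotangent bundle $H^{-1}(1/2)$. The topological entropy of a flow on a compact metric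 space is the topological entropy of its time-1 map. *)

(* Defs.v *)
From HB Require Import structures.
From mathcomp Require Import all_boot all_order all_algebra.
From mathcomp Require Import all_classical all_reals all_analysis.

Set Implicit Arguments.
Unset Strict Implicit.
Unset Printing Implicit Defensive.

Import Order.TTheory GRing.Theory Num.Theory.
Import numFieldNormedType.Exports.

Local Open Scope classical_set_scope.
Local Open Scope ring_scope.

(** * Smooth maps between finite-dimensional normed spaces *)

(* On an open set of a finite-dimensional space this is the usual notion: all
   iterated directional derivatives of order at most k exist and are
   continuous. *)
Fixpoint Ck (R : realType) (V W : normedModType R) (k : nat) (A : set V)
    (f : V -> W) : Prop :=
  {in A, continuous f} /\
  (if k is k'.+1 then
     forall v : V, (forall x, A x -> derivable f x v) /\ Ck k' A ('D_v f)
   else True).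

Definition smooth_on (R : realType) (V W : normedModType R) (A : set V)
    (f : V -> W) : Prop :=
  open A /\ forall k, Ck k A f.

Definition smooth_near (R : realType) (V W : normedModType R) (f : V -> W)
    (x : V) : Prop :=
  exists2 A : set V, A x & smooth_on A f.

(** * Manifolds *)

Record chart (R : realType) (n : nat) (T : topologicalType) := Chart {
  cdom : set T;
  cmap :> T -> 'rV[R]_n;
  cinv : 'rV[R]_n -> T;
  cdom_open : open cdom;
  cimg_open : open (cmap @` cdom);
  cmap_continuous : {in cdom, continuous cmap};
  cinv_continuous : {in cmap @` cdom, continuous cinv};
  cmapK : {in cdom, cancel cmap cinv} }.

(* The atlas is indexed by points: [chart_at x] is a chart around [x], and the
   smooth structure is the one generated by all these charts.  The chart
   [chart_at x] is also used to identify T_x T with row vectors. *)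
HB.mixin Record isManifold (R : realType) (n : nat) T of Topological T := {
  chart_at : T -> chart R n T;
  chart_at_dom : forall x, cdom (chart_at x) x;
  chart_at_compat : forall x y,
    smooth_on (chart_at x @` (cdom (chart_at x) `&` cdom (chart_at y)))
              (chart_at y \o cinv (chart_at x));
  manifold_hausdorff : hausdorff_space T;
  manifold_second_countable : @second_countable T }.

#[short(type="manifoldType")]
HB.structure Definition Manifold (R : realType) (n : nat) :=
  { T of isManifold R n T & Topological T }.

Definition cimg (R : realType) (n : nat) (M : manifoldType R n) (y : M) :
  set 'rV[R]_n := chart_at y @` cdom (chart_at y).

Definition smooth_at (R : realType) (m n : nat) (M : manifoldType R m)
    (N : manifoldType R n) (F : M -> N) (x : M) : Prop :=
  {for x, continuous F} /\
  smooth_near (chart_at (F x) \o F \o cinv (chart_at x)) (chart_at x x).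

(** Tangent vectors at [x] are the row vectors of their coordinates in
    [chart_at x], and differentials act by right multiplication. *)

Definition tmap (R : realType) (m n : nat) (M : manifoldType R m)
    (N : manifoldType R n) (F : M -> N) (x : M) : 'M[R]_(m, n) :=
  'J (chart_at (F x) \o F \o cinv (chart_at x)) (chart_at x x).

(* Change of coordinates on T_x M from the chart at [y] to the chart at [z]. *)
Definition tchange (R : realType) (n : nat) (M : manifoldType R n)
    (x y z : M) : 'M[R]_n :=
  'J (chart_at z \o cinv (chart_at y)) (chart_at y x).

(** * Covariant 2-tensors

    A field of bilinear forms [b] on M is given by its Gram matrices [b x] in
    the coordinates [chart_at x]. *)

Definition bil (R : realType) (n : nat) (b : 'M[R]_n) (u v : 'rV[R]_n) : R :=
  (u *m b *m v^T) 0 0.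

(* Gram matrix in the chart at [y], at the point of coordinates [q]. *)
Definition tensor_in_chart (R : realType) (n : nat) (M : manifoldType R n)
    (b : M -> 'M[R]_n) (y : M) (q : 'rV[R]_n) : 'M[R]_n :=
  let x := cinv (chart_at y) q in
  tchange x y x *m b x *m (tchange x y x)^T.

Definition smooth_tensor (R : realType) (n : nat) (M : manifoldType R n)
    (b : M -> 'M[R]_n) : Prop :=
  forall y : M, smooth_on (cimg y) (tensor_in_chart b y).

Definition pullback (R : realType) (m n : nat) (M : manifoldType R m)
    (N : manifoldType R n) (F : M -> N) (b : N -> 'M[R]_n) : M -> 'M[R]_m :=
  fun x => tmap F x *m b (F x) *m (tmap F x)^T.

Definition riemannian_metric (R : realType) (n : nat) (M : manifoldType R n)
    (g : M -> 'M[R]_n) : Prop :=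
  [/\ smooth_tensor g,
      forall x u v, bil (g x) u v = bil (g x) v u &
      forall x u, u != 0 -> 0 < bil (g x) u u].

Definition two_form (R : realType) (n : nat) (M : manifoldType R n)
    (s : M -> 'M[R]_n) : Prop :=
  smooth_tensor s /\ forall x u, bil (s x) u u = 0.

(* d s = 0, evaluated on constant vector fields in each chart. *)
Definition closed_form (R : realType) (n : nat) (M : manifoldType R n)
    (s : M -> 'M[R]_n) : Prop :=
  forall (y : M) (q : 'rV[R]_n), cimg y q -> forall u v w : 'rV[R]_n,
    'D_u (fun q' => bil (tensor_in_chart s y q') v w) q
    + 'D_v (fun q' => bil (tensor_in_chart s y q') w u) q
    + 'D_w (fun q' => bil (tensor_in_chart s y q') u v) q = 0.

Definition magnetic_field (R : realType) (n : nat) (M : manifoldType R n)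
    (s : M -> 'M[R]_n) : Prop :=
  two_form s /\ closed_form s.

(** * Rational classes

    By the de Rham theorem, H^2(M; R) is computed by smooth singular cochains,
    a closed form being sent to its integration cochain.  A class is rational
    when this cochain is cohomologous to a rational cocycle. *)

Definition std_simplex (R : realType) (k : nat) : set 'rV[R]_k :=
  [set t | (forall j, 0 <= t 0 j) /\ \sum_j t 0 j <= 1].

Definition bary (R : realType) (k : nat) (t : 'rV[R]_k) (j : 'I_k.+1) : R :=
  if unlift ord0 j is Some j' then t 0 j' else 1 - \sum_i t 0 i.

(* The i-th face map inserts a zero in i-th position among the barycentric
   coordinates; the 0-th barycentric coordinate is then dropped. *)
Definition face (R : realType) (k : nat) (i : 'I_k.+2) (t : 'rV[R]_k) :
    'rV[R]_k.+1 :=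
  \row_(j < k.+1)
    (if unlift i (lift ord0 j) is Some j' then bary t j' else 0).

(* A singular simplex is a total function on R^k of which only the restriction
   to the standard simplex matters (see [cochain]); smoothness means smoothness
   on a neighbourhood of the simplex. *)
Definition smooth_simplex (R : realType) (n k : nat) (M : manifoldType R n)
    (f : 'rV[R]_k -> M) : Prop :=
  forall t, std_simplex t ->
    {for t, continuous f} /\ smooth_near (chart_at (f t) \o f) t.

Definition cochain (R : realType) (n k : nat) (M : manifoldType R n)
    (A : Type) (c : ('rV[R]_k -> M) -> A) : Prop :=
  forall f f', smooth_simplex f -> smooth_simplex f' ->
    (forall t, std_simplex t -> f t = f' t) -> c f = c f'.

Definition coboundary (R : realType) (n k : nat) (M : manifoldType R n)
    (A : pzRingType) (c : ('rV[R]_k -> M) -> A) (f : 'rV[R]_k.+1 -> M) : A :=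
  \sum_(i < k.+2) (-1) ^+ i * c (f \o face i).

Definition simplex_integral (R : realType) (n : nat) (M : manifoldType R n)
    (s : M -> 'M[R]_n) (f : 'rV[R]_2 -> M) : R :=
  \int[lebesgue_measure]_(x in `[0, 1])
    \int[lebesgue_measure]_(y in `[0, 1 - x])
      (let t := \row_(j < 2) (if j == 0 then x else y) in
       let J := 'J (chart_at (f t) \o f) t in
       bil (s (f t)) (row 0 J) (row 1 J)).

Definition rational_class (R : realType) (n : nat) (M : manifoldType R n)
    (s : M -> 'M[R]_n) : Prop :=
  exists (c : ('rV[R]_2 -> M) -> rat) (b : ('rV[R]_1 -> M) -> R),
    [/\ cochain c, cochain b,
        forall f : 'rV[R]_3 -> M, smooth_simplex f -> coboundary c f = 0 &
        forall f : 'rV[R]_2 -> M, smooth_simplex f ->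
          simplex_integral s f = ratr (c f) + coboundary b f].

(** * Lie groups *)

HB.mixin Record Manifold_Group_isLieGroup (R : realType) (n : nat) G
    of Manifold R n G & Group G := {
  lie_mul_continuous : continuous (fun ab : G * G => (ab.1 * ab.2)%g);
  lie_mul_smooth : forall a b : G,
    smooth_near
      (fun q : 'rV[R]_n * 'rV[R]_n =>
         chart_at (a * b)%g
           (cinv (chart_at a) q.1 * cinv (chart_at b) q.2)%g)
      (chart_at a a, chart_at b b);
  lie_inv_smooth : forall a : G, smooth_at (fun x : G => x^-1)%g a }.

#[short(type="lieGroupType")]
HB.structure Definition LieGroup (R : realType) (n : nat) :=
  { G of Manifold_Group_isLieGroup R n G & Manifold R n G & Group G }.

Definition path_connected (R : realType) (T : topologicalType) : Prop :=
  forall x y : T, exists c : R -> T,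
    [/\ {within `[0, 1], continuous c}, c 0 = x & c 1 = y].

Definition simply_connected (R : realType) (T : topologicalType) : Prop :=
  path_connected R T /\
  forall c : R -> T, {within `[0, 1], continuous c} -> c 0 = c 1 ->
    exists h : R * R -> T,
      [/\ {within `[0, 1] `*` `[0, 1], continuous h},
          forall t, t \in `[0, 1] -> h (0, t) = c t /\ h (1, t) = c 0 &
          forall r, r \in `[0, 1] -> h (r, 0) = c 0 /\ h (r, 1) = c 0].

(* Nilpotent of class at most two: all commutators are central. *)
Definition two_step_nilpotent (G : groupType) : Prop :=
  forall a b c : G, commute [~ a, b]%g c.

(** The Lie algebra of G is T_1 G, i.e., row vectors, with the bracket of
    left-invariant vector fields. *)

Definition left_field (R : realType) (n : nat) (G : lieGroupType R n)
    (u : 'rV[R]_n) (a : G) : 'rV[R]_n :=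
  u *m tmap (fun x : G => (a * x)%g) (1%g : G).

Definition field_in_chart (R : realType) (n : nat) (M : manifoldType R n)
    (X : M -> 'rV[R]_n) (y : M) (q : 'rV[R]_n) : 'rV[R]_n :=
  let x := cinv (chart_at y) q in X x *m tchange x x y.

Definition field_bracket (R : realType) (n : nat) (M : manifoldType R n)
    (X Y : M -> 'rV[R]_n) (x : M) : 'rV[R]_n :=
  'D_(X x) (field_in_chart Y x) (chart_at x x)
  - 'D_(Y x) (field_in_chart X x) (chart_at x x).

Definition lie_bracket (R : realType) (n : nat) (G : lieGroupType R n)
    (u v : 'rV[R]_n) : 'rV[R]_n :=
  field_bracket (left_field (G := G) u) (left_field v) (1%g : G).

Definition derived_algebra (R : realType) (n : nat) (G : lieGroupType R n) :
    set 'rV[R]_n :=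
  [set D | exists k (u v : 'I_k -> 'rV[R]_n),
     D = \sum_(i < k) lie_bracket G (u i) (v i)].

Definition left_invariant (R : realType) (n : nat) (G : lieGroupType R n)
    (b : G -> 'M[R]_n) : Prop :=
  forall a x : G, pullback (fun z : G => (a * z)%g) b x = b x.

Definition discrete_subgroup (R : realType) (n : nat) (G : lieGroupType R n)
    (Gam : set G) : Prop :=
  [/\ Gam 1%g,
      forall a b, Gam a -> Gam b -> Gam (a * b)%g,
      forall a, Gam a -> Gam a^-1%g &
      forall a, Gam a -> exists2 U : set G, open U & U `&` Gam = [set a]].

Definition local_diffeo (R : realType) (n : nat) (M N : manifoldType R n)
    (F : M -> N) : Prop :=
  forall x, exists (U : set M) (F' : N -> M),
    [/\ open U, U x, open (F @` U), {in U, cancel F F'} &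
        (forall z, U z -> smooth_at F z) /\
        (forall z, (F @` U) z -> smooth_at F' z)].

(* These conditions characterize the manifold Gam\G up to a unique
   diffeomorphism compatible with the projections from G. *)
Definition left_quotient (R : realType) (n : nat) (G : lieGroupType R n)
    (Gam : set G) (M : manifoldType R n) (p : G -> M) : Prop :=
  [/\ local_diffeo p,
      forall x : M, exists a, p a = x &
      forall a b, p a = p b <-> exists2 c, Gam c & b = (c * a)%g].

(** * The cotangent bundle *)

(* The covector [covec z] at [base z] maps u to [u *m covec z], in the
   coordinates of [chart_at (base z)]. *)
Record cotangent (R : realType) (n : nat) (M : manifoldType R n) := Cotangent {
  base : M;
  covec : 'cV[R]_n }.

Definition to_canonical (R : realType) (n : nat) (M : manifoldType R n)
    (y : M) (z : cotangent M) : 'rV[R]_n * 'cV[R]_n :=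
  (chart_at y (base z), tchange (base z) y (base z) *m covec z).

Definition of_canonical (R : realType) (n : nat) (M : manifoldType R n)
    (y : M) (qp : 'rV[R]_n * 'cV[R]_n) : cotangent M :=
  let x := cinv (chart_at y) qp.1 in Cotangent x (tchange x x y *m qp.2).

Section CotangentTopology.
Variables (R : realType) (n : nat) (M : manifoldType R n).

HB.instance Definition _ := gen_eqMixin (cotangent M).
HB.instance Definition _ := gen_choiceMixin (cotangent M).

(* The topology for which canonical coordinates are homeomorphisms. *)
Definition cotangent_open : set (set (cotangent M)) :=
  [set W | forall y : M,
     open [set qp : 'rV[R]_n * 'cV[R]_n |
             cimg y qp.1 /\ W (of_canonical y qp)]].

Let cimg_fst_open (y : M) :
  open [set qp : 'rV[R]_n * 'cV[R]_n | cimg y qp.1].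
Proof.
apply: (@open_comp _ _ (@fst 'rV[R]_n 'cV[R]_n)); last exact: cimg_open.
by move=> x _; exact: cvg_fst.
Qed.

Let cotangent_openT : cotangent_open setT.
Proof.
move=> y; rewrite (_ : mkset _ = [set qp | cimg y qp.1]) //.
by apply/seteqP; split => qp //= [].
Qed.

Let cotangent_openI (A B : set (cotangent M)) :
  cotangent_open A -> cotangent_open B -> cotangent_open (A `&` B).
Proof.
move=> oA oB y; have := openI (oA y) (oB y); congr open.
by apply/seteqP; split => qp /=; [case=> -[? ?] [_ ?] | case=> ? [? ?]].
Qed.

Let cotangent_open_bigU (I : Type) (f : I -> set (cotangent M)) :
  (forall i, cotangent_open (f i)) -> cotangent_open (\bigcup_i f i).
Proof.
move=> of_ y; have := bigcup_open (fun i (_ : setT i) => of_ i y).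
congr open; apply/seteqP; split => qp /=; first by move=> [i _ [? ?]]; split => //; exists i.
by move=> [? [i _ ?]]; exists i.
Qed.

HB.instance Definition _ := isOpenTopological.Build (cotangent M)
  cotangent_openT cotangent_openI cotangent_open_bigU.

End CotangentTopology.

(** * The magnetic flow *)

Definition conorm (R : realType) (n : nat) (M : manifoldType R n)
    (g : M -> 'M[R]_n) (z : cotangent M) : R :=
  Num.sqrt (((covec z)^T *m invmx (g (base z)) *m covec z) 0 0).

Definition hamiltonian (R : realType) (n : nat) (M : manifoldType R n)
    (g : M -> 'M[R]_n) (z : cotangent M) : R :=
  2^-1 * conorm g z ^+ 2.

(* omega_can + pi^* s in the canonical coordinates (q, p) given by the chart at
   [y], with omega_can = sum_i dq_i /\ dp_i. *)
Definition magnetic_symplectic (R : realType) (n : nat) (M : manifoldType R n)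
    (s : M -> 'M[R]_n) (y : M) (qp V W : 'rV[R]_n * 'cV[R]_n) : R :=
  (V.1 *m W.2 - W.1 *m V.2) 0 0 + bil (tensor_in_chart s y qp.1) V.1 W.1.

(* In canonical coordinates, the velocity V of the curve satisfies
   (omega_can + pi^* s)(V, W) = dH(W) for every W. *)
Definition magnetic_trajectory (R : realType) (n : nat) (M : manifoldType R n)
    (g s : M -> 'M[R]_n) (c : R -> cotangent M) : Prop :=
  continuous c /\
  forall (t : R) (y : M), cdom (chart_at y) (base (c t)) ->
    derivable (to_canonical y \o c) t 1 /\
    forall W : 'rV[R]_n * 'cV[R]_n,
      magnetic_symplectic s y (to_canonical y (c t))
        ('D_1 (to_canonical y \o c) t) W
      = 'D_W (hamiltonian g \o of_canonical y) (to_canonical y (c t)).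

Definition magnetic_flow (R : realType) (n : nat) (M : manifoldType R n)
    (g s : M -> 'M[R]_n) (phi : R -> cotangent M -> cotangent M) : Prop :=
  forall z, phi 0 z = z /\ magnetic_trajectory g s (fun t => phi t z).

Definition unit_cotangent (R : realType) (n : nat) (M : manifoldType R n)
    (g : M -> 'M[R]_n) : set (cotangent M) :=
  [set z | conorm g z = 1].

(** * Topological entropy (Adler, Konheim and McAndrew)

    [topological_entropy R K f] is the entropy of the restriction of [f] to the
    compact set [K], assumed to be stable under [f]. *)

Section Entropy.
Variables (R : realType) (T : topologicalType) (K : set T) (f : T -> T).

Definition open_cover (U : set (set T)) : Prop :=
  (forall A, U A -> open A) /\ K `<=` \bigcup_(A in U) A.

(* U v f^-1 U v ... v f^-(k-1) U *)
Definition iterated_join (U : set (set T)) (k : nat) : set (set T) :=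
  [set A | exists2 s : nat -> set T, (forall i, (i < k)%N -> U (s i)) &
     A = [set x | forall i, (i < k)%N -> s i (iter i f x)]].

Definition min_subcover (U : set (set T)) : R :=
  inf [set m%:R | m in [set m | exists2 s : 'I_m -> set T,
                          (forall i, U (s i)) & K `<=` \bigcup_i s i]].

Definition topological_entropy : \bar R :=
  ereal_sup [set limn_esup
    (fun k => (ln (min_subcover (iterated_join U k)) / k%:R)%:E)
    | U in open_cover].

End Entropy.

(* Main.v *)
From HB Require Import structures.
Require Import Defs.
From mathcomp Require Import all_boot all_order all_algebra all_fingroup.
From mathcomp Require Import all_classical all_reals all_analysis.
From mathcomp Require Import ring lra.

Set Implicit Arguments.
Unset Strict Implicit.
Unset Printing Implicit Defensive.

Import Order.TTheory GRing.Theory Num.Theory.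
Import numFieldNormedType.Exports.

Local Open Scope classical_set_scope.
Local Open Scope ring_scope.

(** The momentum of a cotangent vector is its coordinate vector in the frame
    of left-invariant vector fields, which descends to the quotient. A
    left-invariant metric and magnetic form are constant in this frame, and by
    [trajectory_eqs] the magnetic equations become v = I m for the velocity v
    of the base curve, with I the inverse of the metric, together with the
    Euler equation <m', e> = <m, [v, e]> + sigma (v, e) for the momentum m.

    Two-step nilpotency and the vanishing of sigma on the derived algebra make
    the right hand side zero when e is a commutator: the restriction of the
    momentum to the derived algebra is conserved ([mom_bracket_cst]). Hence
    the difference d of two momenta satisfies a linear equation which is skew
    for the energy, with a forcing term bounded by the initial difference; the
    energy identity shows that the square root of the energy of d grows at
    most linearly ([momentum_growth]).

    The base curves are lifted to curves a and b in the group. With w and v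
    their left velocities, h = a^-1 b has left velocity w - Ad(h^-1) v
    ([lvel_quotient]). The matrix N(h) = Ad(h^-1) - 1 is additive in h because
    commutators are central ([nconjM]), and its derivative along h is the
    bracket with the left velocity of h, in which the part N(h) v does not
    contribute since it is tangent to the centre. So N(h) is controlled by the
    integral of w - v, then the left velocity of h by N(h) and w - v, and
    finally h itself. Each integration costs one power of the time:
    trajectories on the unit cotangent bundle that start at distance eta are
    at distance at most C (1 + T)^3 eta up to time T, as long as this quantity
    is small ([shadowing]). The case eta = 0 gives uniqueness of trajectories,
    so that the iterates of the time-one map are the maps of the flow at
    integer times.

    Given an open cover U of the unit cotangent bundle with Lebesgue number
    eps ([lebesgue_number]), cut the bundle into cells of diameter of order
    eps / (1 + k)^3. Compactness provides a number of cells polynomial in k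
    ([polynomial_partition]); by shadowing each cell stays, at each of the
    times 0, ..., k - 1, inside one element of U, so it lies in an element of
    the k-th join of U. The logarithm of a polynomial in k is negligible with
    respect to k ([polynomial_cvg0]), hence the entropy vanishes. *)

(** * Differential calculus in finite dimension *)

Section Diff.
Context {R : realType}.
Implicit Types U V W : normedModType R.

Lemma diff_intro V W (f : V -> W) (x : V) (L : {linear V -> W}) :
  continuous L ->
  (forall e, 0 < e -> \forall h \near (0:V), `|f (h + x) - f x - L h| <= e * `|h|) ->
  is_diff x f L.
Proof.
move=> cL H.
have E : f \o shift x = cst (f x) + L +o_ (0:V) id.
  apply/eqaddoP => e e0.
  have := H e e0; apply: filterS => h /=.
  by rewrite opprD addrA.
apply: DiffDef; last exact: diff_unique.
by apply/diff_locallyP; rewrite (diff_unique cL E).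
Qed.

Lemma diff_elim V W (f : V -> W) (x : V) : differentiable f x ->
  forall e, 0 < e -> \forall h \near (0:V), `|f (h + x) - f x - 'd f x h| <= e * `|h|.
Proof.
move=> /diff_locallyP[_ E] e e0.
move/eqaddoP : E => /(_ e e0); apply: filterS => h /=.
by rewrite opprD addrA.
Qed.

Lemma near_eq_differentiable V W (f g : V -> W) (x : V) :
  (\forall y \near x, f y = g y) -> differentiable f x -> differentiable g x.
Proof.
move=> fg df.
have cL := diff_continuous df.
suff H : is_diff x g ('d f x) by case: H.
apply: diff_intro => // e e0.
have := diff_elim df e0; have := fg; rewrite (near_shift 0) => fg'.
apply: filterS2 (fg') => h /=.
by rewrite subr0 (nbhs_singleton fg) => ->.
Qed.

(** Turns directional derivatives into derivatives of curves, to which the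
    one-variable chain rule and mean value theorem apply. *)
Lemma is_derive_curve V W (f : V -> W) (x v : V) (d : W) :
  is_derive x v f d <-> is_derive (0 : R) 1 (fun h : R => f (h *: v + x)) d.
Proof.
suff E : 'D_v f x = 'D_1 (fun h : R => f (h *: v + x)) 0.
  split=> -[h1 h2]; split.
  - exact: (derivable1P f x v).1.
  - by rewrite -E.
  - exact: (derivable1P f x v).2.
  - by rewrite E.
rewrite /derive; set g1 := fun h => _; set g2 := fun h => _.
suff -> : g1 = g2 by [].
by rewrite funeqE /g1 /g2 => h /=; rewrite addr0 scale0r add0r [_%:A]mulr1.
Qed.

Lemma is_derive1_diff V (c : R -> V) (t : R) (v : V) :
  is_derive t 1 c v -> is_diff t c (fun h => h *: v).
Proof.
move=> [dc <-]; split; first exact/derivable1_diffP.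
by rewrite deriv1E // derive1E.
Qed.

Lemma diff_is_derive V W (f : V -> W) (x v : V) :
  differentiable f x -> is_derive x v f ('D_v f x).
Proof. by move=> df; apply/derivableP/diff_derivable. Qed.

Lemma is_derive_chain U V W (f : V -> W) (c : U -> V) (x u : U) (v : V) :
  is_derive x u c v -> differentiable f (c x) ->
  is_derive x u (f \o c) ('d f (c x) v).
Proof.
move=> /is_derive_curve /is_derive1_diff dc df; apply/is_derive_curve.
have E : c (0 *: u + x) = c x by rewrite scale0r add0r.
rewrite -E in df *.
have df' := differentiableP df.
have dfc : is_diff (0:R) (f \o (fun h : R => c (h *: u + x))) ('d f (c (0 *: u + x)) \o (fun h => h *: v)).
  exact: (@is_diff_comp R R V W (fun h : R => c (h *: u + x)) _ f _ 0 dc df').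
case: dfc => d1 d2; split; first exact/derivable1_diffP.
by rewrite deriveE// d2 /= scale1r.
Qed.

Lemma is_derive_dirZ V W (f : V -> W) (x v : V) (k : R) (d : W) :
  is_derive x v f d -> is_derive x (k *: v) f (k *: d).
Proof.
move=> /is_derive_curve H; apply/is_derive_curve.
set g := fun h : R => f (h *: v + x) in H.
have E : (fun h : R => f (h *: (k *: v) + x)) = g \o (fun h : R => k *: (h : R^o)).
  by apply/funext => h /=; rewrite /g scalerA mulrC.
rewrite E.
have H' : is_derive (0:R) 1 (fun h : R => k *: (h : R^o)) (k *: (1 : R^o)).
  exact: is_deriveZ.
have dg : differentiable g (k *: (0 : R^o)).
  by rewrite scaler0; apply/derivable1_diffP; case: H.
have := is_derive_chain H' dg; congr is_derive.
move: dg; rewrite scaler0 => dg.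
have [H1 H2] := H.
by rewrite diff1E // derive1E H2 /= [k *: 1]mulr1.
Qed.

Lemma mvt_dir V (f : V -> R) (x v : V) :
  (forall s : R, 0 <= s <= 1 -> derivable f (s *: v + x) v) ->
  exists2 s : R, 0 <= s <= 1 & f (v + x) - f x = 'D_v f (s *: v + x).
Proof.
move=> H.
have H' (s : R) : 0 <= s <= 1 ->
    is_derive s 1 (fun h : R => f (h *: v + x)) ('D_v f (s *: v + x)).
  move=> /H dH; have [] := (is_derive_curve f (s *: v + x) v _).1 (derivableP dH).
  set g := fun h : R => f (h *: v + (s *: v + x)).
  set g' := (fun h : R => f (h *: v + x)).
  have -> : g = g' \o shift s.
    by apply/funext => h; rewrite /g /g' /= scalerDl addrA.
  move=> h1 h2; apply: DeriveDef; first move: h1; last rewrite -h2.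
    rewrite /derivable /=; set g1 := fun h => _; set g2 := fun h => _.
    suff -> : g1 = g2 by [].
    by apply/funext => h; rewrite /g1 /g2 /= ?add0r ?addr0.
  rewrite /derive /=; set g1 := fun h => _; set g2 := fun h => _.
  suff -> : g1 = g2 by [].
  by apply/funext => h; rewrite /g1 /g2 /= ?add0r ?addr0.
have [||c c01 E] := @MVT_segment R (fun h : R => f (h *: v + x))
  (fun s => 'D_v f (s *: v + x)) 0 1 ler01.
- by move=> s; rewrite in_itv /= => /andP[a b]; apply: H'; rewrite !ltW.
- apply: derivable_within_continuous => s; rewrite in_itv /= => s01.
  by case: (H' s s01).
exists c; first by move: c01; rewrite in_itv.
by move: E; rewrite scale1r scale0r add0r subr0 mulr1.
Qed.

Lemma diff_mxP V m n (f : V -> 'M[R]_(m, n)) (x : V) :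
  (forall i j, differentiable (fun y => f y i j) x) -> differentiable f x.
Proof.
move=> H.
have -> : f = \sum_i \sum_j (fun y => f y i j *: (delta_mx i j : 'M[R]_(m, n))).
  apply/funext => y; rewrite fct_sumE [LHS]matrix_sum_delta.
  by apply: eq_bigr => i _; rewrite fct_sumE.
apply: differentiable_sum => i; apply: differentiable_sum => j.
exact: differentiableZl.
Qed.

(** What the passage from partial derivatives to differentials needs of a
    finite-dimensional space; the group law is a function of a pair of row
    vectors, the charts are functions of one. *)
Definition fin_coords V := exists (I : finType) (e : I -> V) (c : I -> V -> R),
  [/\ forall i, linear (c i : V -> R^o), forall i v, `|c i v| <= `|v| &
      forall v, v = \sum_i c i v *: e i].

Lemma fin_coords_rV n : fin_coords 'rV[R]_n.
Proof.
exists 'I_n, (fun i => delta_mx 0 i), (fun i (v : 'rV[R]_n) => v 0 i); split.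
- by move=> i k u v; rewrite !mxE.
- by move=> i v; rewrite [leRHS]/Num.norm/= mx_normrE; exact: (le_bigmax _ (fun k => `|v k.1 k.2|) (ord0, i)).
- by move=> v; rewrite [LHS]row_sum_delta.
Qed.

Lemma fin_coords_pair V W : fin_coords V -> fin_coords W -> fin_coords (V * W)%type.
Proof.
move=> [I [e [c [cL cN cE]]]] [I' [e' [c' [cL' cN' cE']]]].
exists (I + I')%type, (fun i => match i with inl i => (e i, 0) | inr i => (0, e' i) end),
  (fun i v => match i with inl i => c i v.1 | inr i => c' i v.2 end); split.
- by move=> [i|i] k u v /=; [rewrite cL | rewrite cL'].
- move=> [i|i] v; rewrite prod_normE/= le_max.
    by rewrite cN.
  by rewrite cN' orbT.
- move=> [v w]; rewrite big_sumType /=.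
  have -> : (\sum_i c i v *: ((e i, 0) : V * W)) = (v, 0).
    rewrite {2}(cE v); elim/big_rec2: _ => //= i y1 y2 _ ->.
    by congr pair => /=; rewrite ?scaler0 ?addr0.
  have -> : (\sum_i c' i w *: ((0, e' i) : V * W)) = (0, w).
    rewrite {2}(cE' w); elim/big_rec2: _ => //= i y1 y2 _ ->.
    by congr pair => /=; rewrite ?scaler0 ?addr0.
  by congr pair => /=; rewrite ?addr0 ?add0r.
Qed.

(** The mean value theorem on the segment from [x] to [c *: e + x]. *)
Lemma mvt_dir_ineq V (f : V -> R) (x e : V) (c D eps : R) :
  (forall s : R, `|s| <= `|c| -> derivable f (s *: e + x) e /\ `|'D_e f (s *: e + x) - D| <= eps) ->
  `|f (c *: e + x) - f x - c * D| <= eps * `|c|.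
Proof.
move=> H.
have sc (s : R) : 0 <= s <= 1 -> `|s * c| <= `|c|.
  by move=> /andP[s0 s1]; rewrite normrM ger0_norm // ler_piMl.
have Hd (s : R) : 0 <= s <= 1 -> is_derive (s *: (c *: e) + x) (c *: e) f (c * 'D_e f ((s * c) *: e + x)).
  move=> /sc/H[h1 h2]; rewrite scalerA; apply: is_derive_dirZ.
  exact: derivableP.
have [s s01 ->] := mvt_dir (fun s s01 => @ex_derive _ _ _ _ _ _ _ (Hd s s01)).
have [_ ->] := Hd s s01.
have [_] := H _ (sc s s01).
by rewrite -mulrBr normrM (mulrC eps) => h; exact: ler_wpM2l.
Qed.

(** Walk from [x] to [h + x] by changing one coordinate at a time: each step
    costs an error [eps' * `|h|] by the mean value theorem, since the partial
    derivatives are almost constant near [x]. *)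
Lemma C1_diff V (f : V -> R) (x : V) : fin_coords V ->
  (forall v, \forall y \near x, derivable f y v) ->
  (forall v, {for x, continuous ('D_v f)}) -> differentiable f x.
Proof.
move=> [I [e [c [cL cN cE]]]] df cf.
pose l (v : V) : R^o := \sum_i c i v * 'D_(e i) f x.
have lL : linear l.
  move=> k u v; rewrite /l scaler_sumr -big_split /=; apply: eq_bigr => i _.
  by rewrite cL mulrDl -mulrA.
pose L : {linear V -> R^o} := HB.pack l (GRing.isLinear.Build _ _ _ _ _ lL).
pose CD := 1 + \sum_i `|'D_(e i) f x|.
have CD0 : 0 < CD by rewrite ltr_pwDl // sumr_ge0.
have lN v : `|l v| <= CD * `|v|.
  rewrite (le_trans (ler_norm_sum _ _ _)) // mulrDl mul1r mulr_suml ler_wpDl //.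
  by apply: ler_sum => i _; rewrite normrM mulrC ler_wpM2l.
have Lc : continuous L.
  apply/(@bounded_linear_continuous _ _ _ L)/linear_boundedP.
  exists CD; split; first exact: gtr0_real.
  move=> B CB v; rewrite (le_trans (lN v)) // ler_wpM2r //; exact: ltW.
suff H : is_diff x f L by case: H.
apply: diff_intro => // eps eps0.
pose eps' := eps / (1 + (#|I|)%:R).
have eps'0 : 0 < eps' by rewrite divr_gt0 // ltr_pwDl.
have : \forall y \near x, forall i, derivable f y (e i) /\ `|'D_(e i) f y - 'D_(e i) f x| <= eps'.
  apply: filter_forall => i.
  have := cf (e i); move/cvgrPdist_le => /(_ _ eps'0); apply: filterS2 (df (e i)) => y d1 h.
  by split => //; rewrite distrC.
move=> /nbhs_ballP[d d0 Hd].
pose C := 1 + \sum_i `|e i|.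
have C0 : 0 < C by rewrite ltr_pwDl // sumr_ge0.
have : \forall h \near (0 : V), `|h| < d / C.
  by apply: nbhs0_lt; rewrite divr_gt0.
apply: filterS => h; rewrite ltr_pdivlMr // => hd.
(* Induction on the list of coordinates already changed. *)
have key (s : seq I) : uniq s ->
    `|f (\sum_(i <- s) c i h *: e i + x) - f x - \sum_(i <- s) c i h * 'D_(e i) f x|
    <= (size s)%:R * (eps' * `|h|).
  elim: s => [|i s IH] /=; first by rewrite !big_nil add0r subrr subr0 normr0 mul0r.
  move=> /andP[si us]; rewrite !big_cons.
  set S := \sum_(j <- s) _ in IH *; set T := \sum_(j <- s) _ in IH *.
  have E : f (c i h *: e i + S + x) - f x - (c i h * 'D_(e i) f x + T) =
     (f (c i h *: e i + (S + x)) - f (S + x) - c i h * 'D_(e i) f x) + (f (S + x) - f x - T).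
    by rewrite -(addrA (c i h *: e i) S x); ring.
  rewrite E (le_trans (ler_normD _ _)) // mulrSr addrC mulrDl mul1r lerD //; first exact: IH.
  rewrite (le_trans (y := eps' * `|c i h|)) //; last by rewrite ler_wpM2l // ltW.
  apply: mvt_dir_ineq => r rc; apply: Hd.
  rewrite -ball_normE /= (_ : x - _ = - (r *: e i + S)); last first.
    by rewrite [r *: e i + _]addrA opprD addrCA subrr addr0.
  rewrite normrN; apply: le_lt_trans hd.
  have : `|r *: e i + S| <= `|h| * (`|e i| + \sum_(j <- s) `|e j|).
    rewrite (le_trans (ler_normD _ _)) // mulrDr lerD //.
      by rewrite normrZ ler_wpM2r // (le_trans rc).
    rewrite (le_trans (ler_norm_sum _ _ _)) // mulr_sumr; apply: ler_sum => j _.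
    by rewrite normrZ ler_wpM2r.
  move/le_trans; rewrite addrC; apply; rewrite ler_wpM2l // /C ler_wpDl //.
  have -> : \sum_(j <- s) `|e j| + `|e i| = \sum_(j in i :: s) `|e j|.
    by rewrite -big_uniq /= ?si // big_cons addrC.
  by rewrite [leRHS](bigID (mem (i :: s))) /= lerDl sumr_ge0.
have := key (index_enum I) (index_enum_uniq I).
have -> : size (index_enum I) = #|I|.
  by rewrite -sum1_size -sum1_card; apply: eq_bigl.
rewrite -cE /= => /le_trans; apply; rewrite mulrA ler_wpM2r //.
rewrite /eps' mulrA ler_pdivrMr ?ltr_pwDl // mulrC ler_pM2l //.
by rewrite lerDr.
Qed.

(** The second difference of [f] on a parallelogram of side [s], after two
    applications of the mean value theorem, is [s ^+ 2] times a value of the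
    second derivative near [x]. *)
Lemma schwarz_half V (f : V -> R) (x u v : V) (eps : R) :
  (\forall y \near x, derivable f y u) ->
  (\forall y \near x, derivable ('D_u f) y v) ->
  {for x, continuous ('D_v ('D_u f))} -> 0 < eps ->
  exists2 d, 0 < d & forall s : R, 0 < s < d ->
   `|f (s *: v + s *: u + x) - f (s *: u + x) - f (s *: v + x) + f x
     - s ^+ 2 * 'D_v ('D_u f) x| <= eps * s ^+ 2.
Proof.
move=> du dv c eps0.
move/cvgrPdist_le : c => /(_ _ eps0) => c.
have /nbhs_ballP[r r0 Hr] : \forall y \near x, [/\ derivable f y u,
    derivable ('D_u f) y v & `|'D_v ('D_u f) x - 'D_v ('D_u f) y| <= eps].
  by apply: filterS3 du dv c => y.
exists (r / (1 + `|u| + `|v|)); first by rewrite divr_gt0 // -addrA ltr_pwDl // addr_ge0.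
move=> s /andP[s0]; rewrite ltr_pdivlMr; last by rewrite -addrA ltr_pwDl // addr_ge0.
move=> sr.
(* The parallelogram is contained in the ball. *)
have B (a b : R) : 0 <= a <= 1 -> 0 <= b <= 1 -> ball x r (a *: (s *: v) + (b *: (s *: u) + x)).
  move=> /andP[a0 a1] /andP[b0 b1].
  rewrite -ball_normE /= [_ + (_ + x)]addrA opprD addrCA subrr addr0 normrN.
  apply: le_lt_trans sr; rewrite (le_trans (ler_normD _ _)) // !normrZ.
  rewrite !(ger0_norm a0) !(ger0_norm b0) (gtr0_norm s0).
  rewrite !mulrDr mulr1 -addrA (addrC (s * `|u|)) ler_wpDl //; first exact: ltW.
  have s0' := ltW s0; by apply: lerD; rewrite ler_piMl // mulr_ge0.
pose g y := f (s *: v + y) - f y.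
have i1 : 0 <= (1 : R) <= 1 by rewrite ler01 lexx.
have i0 : 0 <= (0 : R) <= 1 by rewrite ler01 lexx.
have shiftd (w z e : V) : derivable f (w + z) e ->
    is_derive z e (fun y => f (w + y)) ('D_e f (w + z)).
  move=> /derivableP h; have := is_derive_curve f (w + z) e ('D_e f (w + z)).
  move=> [/(_ h) h' _]; apply/is_derive_curve; move: h'; congr is_derive.
  by apply/funext => t /=; rewrite addrCA.
have dg (b : R) : 0 <= b <= 1 ->
   is_derive (b *: (s *: u) + x) (s *: u) g
     (s * ('D_u f (s *: v + (b *: (s *: u) + x)) - 'D_u f (b *: (s *: u) + x))).
  move=> b01.
  rewrite mulrBr; apply: is_deriveB.
    apply: is_derive_dirZ; apply: shiftd.
    by have [] := Hr _ (B 1 b i1 b01); rewrite scale1r.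
  apply: is_derive_dirZ; apply: derivableP.
  by have [] := Hr _ (B 0 b i0 b01); rewrite scale0r add0r.
have [b b01 Eb] := mvt_dir (fun b b01 => @ex_derive _ _ _ _ _ _ _ (dg b b01)).
set z := b *: (s *: u) + x in Eb *.
have dh (a : R) : 0 <= a <= 1 ->
   is_derive (a *: (s *: v) + z) (s *: v) ('D_u f) (s * 'D_v ('D_u f) (a *: (s *: v) + z)).
  move=> a01; apply: is_derive_dirZ; apply: derivableP.
  by have [] := Hr _ (B a b a01 b01).
have [a a01 Ea] := mvt_dir (fun a a01 => @ex_derive _ _ _ _ _ _ _ (dh a a01)).
have [_ _] := Hr _ (B a b a01 b01).
have -> : f (s *: v + s *: u + x) - f (s *: u + x) - f (s *: v + x) + f x = g (s *: u + x) - g x.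
  by rewrite /g addrA; ring.
rewrite Eb; have [_ ->] := dg b b01; rewrite -/z Ea.
have [_ ->] := dh a a01 => h.
rewrite mulrA -expr2 -mulrBr normrM mulrC.
have s20 : 0 <= s ^+ 2 by exact: sqr_ge0.
by rewrite [X in _ * X](ger0_norm s20); apply: (ler_wpM2r s20); rewrite distrC.
Qed.

Lemma diff_quotient_close (A X Y s e : R) : 0 < s ->
  `|A - s * X| <= e / 2 * s -> `|A - s * Y| <= e / 2 * s -> `|X - Y| <= e.
Proof.
move=> s0; rewrite !ler_norml => /andP[h1 h2] /andP[h3 h4].
by apply/andP; split; rewrite -(ler_pM2r s0); lra.
Qed.

(** The second difference is symmetric in [u] and [v], so [schwarz_half]
    bounds its distance to both mixed derivatives. *)
Lemma schwarz V (f : V -> R) (x u v : V) :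
  (\forall y \near x, derivable f y u) -> (\forall y \near x, derivable f y v) ->
  (\forall y \near x, derivable ('D_u f) y v) ->
  (\forall y \near x, derivable ('D_v f) y u) ->
  {for x, continuous ('D_v ('D_u f))} -> {for x, continuous ('D_u ('D_v f))} ->
  'D_v ('D_u f) x = 'D_u ('D_v f) x.
Proof.
move=> du dv duv dvu cuv cvu.
apply/eqP; rewrite -subr_eq0 -normr_le0; apply/ler_addgt0Pr => e e0; rewrite add0r.
have e20 : 0 < e / 2 by rewrite divr_gt0.
have [d d0 H] := schwarz_half du duv cuv e20.
have [d' d'0 H'] := schwarz_half dv dvu cvu e20.
pose s := Num.min d d' / 2.
have m0 : 0 < Num.min d d' by rewrite lt_min d0.
have s0 : 0 < s by rewrite divr_gt0.
have sm : s < Num.min d d' by rewrite ltr_pdivrMr // ltr_pMr // ltr1n.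
have := H s; rewrite s0 (lt_le_trans sm) ?ge_min ?lexx // => /(_ isT) h.
have := H' s; rewrite s0 (lt_le_trans sm) ?ge_min ?lexx ?orbT // => /(_ isT).
rewrite [s *: u + s *: v]addrC => h'.
have s20 : 0 < s ^+ 2 by rewrite exprn_gt0.
have E : f (s *: v + s *: u + x) - f (s *: v + x) - f (s *: u + x) + f x =
  f (s *: v + s *: u + x) - f (s *: u + x) - f (s *: v + x) + f x by ring.
rewrite E in h'; exact: (diff_quotient_close s20 h h').
Qed.

Lemma is_derive_mxP V m n (M : V -> 'M[R]_(m, n)) (x v : V) (dM : 'M[R]_(m, n)) :
  is_derive x v M dM <-> forall i j, is_derive x v (fun y => M y i j) (dM i j).
Proof.
split=> [[dv <-] i j|H].
  have /derivable_mxP d' := dv; split; first exact: d'.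
  by rewrite derive_mx // mxE.
have d' : derivable M x v by apply/derivable_mxP => i j; case: (H i j).
by split => //; rewrite derive_mx //; apply/matrixP => i j; rewrite mxE; case: (H i j).
Qed.

Lemma is_derive_mulmx V m n k (A : V -> 'M[R]_(m, n)) (B : V -> 'M[R]_(n, k))
    (x v : V) dA dB :
  is_derive x v A dA -> is_derive x v B dB ->
  is_derive x v (fun y => A y *m B y) (dA *m B x + A x *m dB).
Proof.
move=> /is_derive_mxP hA /is_derive_mxP hB; apply/is_derive_mxP => i j.
have -> : (fun y => (A y *m B y) i j) = \sum_k0 ((fun y => A y i k0) * (fun y => B y k0 j)).
  by apply/funext => y; rewrite mxE fct_sumE.
rewrite !mxE -big_split /=.
have -> : \sum_k0 (dA i k0 * B x k0 j + A x i k0 * dB k0 j) =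
   \sum_k0 (A x i k0 *: (dB k0 j : R^o) + B x k0 j *: (dA i k0 : R^o)).
  by apply: eq_bigr => k0 _; rewrite addrC [dA _ _ * _]mulrC.
apply: is_derive_sum => k0; exact: (is_deriveM (hA i k0) (hB k0 j)).
Qed.

Lemma Ck_open_coord V n (A : set V) (f : V -> 'rV[R]_n) (x : V) :
  fin_coords V -> open A -> Ck 1 A f -> A x -> differentiable f x.
Proof.
move=> fc oA [_ /= H] Ax.
have Anear y : A y -> \forall z \near y, A z by move=> Ay; exact: open_nbhs_nbhs.
have comp v y i j : A y -> is_derive y v (fun z => f z i j) ('D_v f y i j).
  by move=> /((H v).1) /derivableP /is_derive_mxP.
apply: diff_mxP => i j; apply: C1_diff => // v.
  by apply: filterS (Anear x Ax) => y Ay; case: (comp v y i j Ay).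
have [c _] := (H v).2; have {c} c := c x; rewrite inE in c; have {c} c := c Ax.
have E : \forall y \near x, 'D_v f y i j = 'D_v (fun z => f z i j) y.
  by apply: filterS (Anear x Ax) => y Ay; case: (comp v y i j Ay).
rewrite /prop_for /continuous_at -(nbhs_singleton E).
apply: (cvg_trans (G := (fun y => 'D_v f y i j) @ x)).
  by apply: near_eq_cvg; apply: filterS E => y ->.
apply: (@continuous_comp _ _ _ ('D_v f) (fun M : 'rV[R]_n => M i j)) => //.
exact: coord_continuous.
Qed.

Lemma smooth_differentiable V n (A : set V) (f : V -> 'rV[R]_n) (x : V) :
  fin_coords V -> smooth_on A f -> A x -> differentiable f x.
Proof. by move=> fc [oA /(_ 1%N)]; exact: Ck_open_coord. Qed.

Lemma smooth_derive V W (A : set V) (f : V -> W) v :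
  smooth_on A f -> smooth_on A ('D_v f).
Proof. by move=> [oA H]; split => // k; have [_ /(_ v)[]] := H k.+1. Qed.

Lemma smooth_continuous V W (A : set V) (f : V -> W) x :
  smooth_on A f -> A x -> {for x, continuous f}.
Proof. by move=> [oA /(_ 0%N)[+ _]] Ax => /(_ x); rewrite inE; apply. Qed.

(** Second-order regularity at a point, in the form needed for brackets of
    vector fields. *)
Definition C2 V W (f : V -> W) (x : V) : Prop :=
  [/\ \forall y \near x, differentiable f y,
      forall v, differentiable ('D_v f) x &
      forall u v, 'D_v ('D_u f) x = 'D_u ('D_v f) x].

Lemma smooth_C2 V n (f : V -> 'rV[R]_n) (x : V) :
  fin_coords V -> smooth_near f x -> C2 f x.
Proof.
move=> fc [A Ax sA]; have [oA _] := sA.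
have Anear : \forall z \near x, A z by exact: open_nbhs_nbhs.
have dA g z : smooth_on A g -> A z -> differentiable (g : V -> 'rV[R]_n) z.
  exact: smooth_differentiable.
split=> [|v|u v].
- by apply: filterS Anear => y; exact: dA.
- by apply: dA => //; exact: smooth_derive.
have D1 w y : A y -> is_derive y w f ('D_w f y).
  by move=> Ay; apply/derivableP/diff_derivable; exact: dA.
have D2 w w' y : A y -> is_derive y w' ('D_w f) ('D_w' ('D_w f) y).
  by move=> Ay; apply/derivableP/diff_derivable; apply: dA => //; exact: smooth_derive.
apply/matrixP => i j.
pose g z := f z i j.
have Dg w y : A y -> is_derive y w g ('D_w f y i j).
  by move=> /(D1 w) /is_derive_mxP/(_ i j).
have Eg w : \forall y \near x, 'D_w f y i j = 'D_w g y.
  by apply: filterS Anear => y /(Dg w)[].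
have Dg2 w w' y : A y -> is_derive y w' ('D_w g) ('D_w' ('D_w f) y i j).
  move=> Ay; have /is_derive_mxP/(_ i j) := D2 w w' y Ay; apply: near_eq_is_derive.
  have : \forall z \near y, A z by exact: open_nbhs_nbhs.
  by apply: filterS => z /(Dg w)[].
have Eg2 w w' : \forall y \near x, 'D_w' ('D_w f) y i j = 'D_w' ('D_w g) y.
  by apply: filterS Anear => y /(Dg2 w w')[].
have e1 := nbhs_singleton (Eg2 u v); have e2 := nbhs_singleton (Eg2 v u).
have C w w' : {for x, continuous ('D_w' ('D_w g))}.
  rewrite /prop_for /continuous_at -(nbhs_singleton (Eg2 w w')).
  apply: (cvg_trans (G := (fun y => 'D_w' ('D_w f) y i j) @ x)).
    by apply: near_eq_cvg; apply: filterS (Eg2 w w') => y ->.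
  apply: (@continuous_comp _ _ _ ('D_w' ('D_w f)) (fun M : 'rV[R]_n => M i j)).
    by apply: (@smooth_continuous _ _ A) => //; do 2!apply: smooth_derive.
  exact: coord_continuous.
refine (etrans e1 (etrans _ (esym e2))).
apply: (@schwarz _ g x u v _ _ _ _ (C u v) (C v u)).
- by apply: filterS Anear => y /(Dg u)[].
- by apply: filterS Anear => y /(Dg v)[].
- by apply: filterS Anear => y /(Dg2 u v)[].
- by apply: filterS Anear => y /(Dg2 v u)[].
Qed.

(** The derivative of the Jacobian is the Hessian; it is described through [u
    *m dJ] because its matrix depends on the direction [v]. *)
Lemma jacobian_is_derive m n (f : 'rV[R]_m -> 'rV[R]_n) (x v : 'rV[R]_m) :
  C2 f x ->
  exists2 dJ, is_derive x v (fun y => 'J f y) dJ &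
  forall u, u *m dJ = 'D_v ('D_u f) x.
Proof.
move=> [d1 d2 _].
have E (i : 'I_m) : \forall y \near x, 'D_(delta_mx 0 i) f y = row i ('J f y).
  by apply: filterS d1 => y dy; rewrite deriveEjacobian // rowE.
exists (\matrix_(i, j) 'D_v ('D_(delta_mx 0 i) f) x 0 j).
  apply/is_derive_mxP => i j; rewrite mxE.
  have /is_derive_mxP/(_ 0 j) := diff_is_derive v (d2 (delta_mx 0 i)).
  by apply: near_eq_is_derive; apply: filterS (E i) => y ->; rewrite mxE.
move=> u; have := diff_is_derive v (d2 u).
suff : is_derive x v ('D_u f) (u *m \matrix_(i, j) 'D_v ('D_(delta_mx 0 i) f) x 0 j).
  by move=> [_ ->].
have H : is_derive x v (fun y => u *m 'J f y) (0 *m 'J f x + u *m \matrix_(i, j) 'D_v ('D_(delta_mx 0 i) f) x 0 j).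
  apply: is_derive_mulmx; apply/is_derive_mxP => i j; rewrite !mxE.
  have /is_derive_mxP/(_ 0 j) := diff_is_derive v (d2 (delta_mx 0 i)).
  by apply: near_eq_is_derive; apply: filterS (E i) => y ->; rewrite mxE.
move: H; rewrite mul0mx add0r; apply: near_eq_is_derive.
by apply: filterS d1 => y dy; rewrite deriveEjacobian.
Qed.

(** Differentiating [Y' \o f = X' *m 'J f] along [X] produces the derivative
    of [X'], pushed forward by [f], and a second derivative of [f] at [X'] and
    [X]. The latter is symmetric and disappears from the commutator. *)
Lemma bracket_related m n (f : 'rV[R]_m -> 'rV[R]_n) (x : 'rV[R]_m)
    (X1 X2 : 'rV[R]_m -> 'rV[R]_m) (Y1 Y2 : 'rV[R]_n -> 'rV[R]_n) :
  C2 f x ->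
  (\forall y \near x, Y1 (f y) = X1 y *m 'J f y) ->
  (\forall y \near x, Y2 (f y) = X2 y *m 'J f y) ->
  differentiable X1 x -> differentiable X2 x ->
  differentiable Y1 (f x) -> differentiable Y2 (f x) ->
  'D_(Y1 (f x)) Y2 (f x) - 'D_(Y2 (f x)) Y1 (f x)
  = ('D_(X1 x) X2 x - 'D_(X2 x) X1 x) *m 'J f x.
Proof.
move=> c2 r1 r2 dX1 dX2 dY1 dY2; have [d1 d2 sym] := c2.
have df := nbhs_singleton d1.
have key (X X' : 'rV[R]_m -> 'rV[R]_m) (Y Y' : 'rV[R]_n -> 'rV[R]_n) :
    (\forall y \near x, Y (f y) = X y *m 'J f y) ->
    (\forall y \near x, Y' (f y) = X' y *m 'J f y) ->
    differentiable X' x -> differentiable Y' (f x) ->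
    'D_(Y (f x)) Y' (f x) = 'D_(X x) X' x *m 'J f x + 'D_(X x) ('D_(X' x) f) x.
  move=> r r' dX' dY'.
  (* Both ways of differentiating the relation satisfied by [Y']. *)
  have h1 : is_derive x (X x) (Y' \o f) ('D_(Y (f x)) Y' (f x)).
    rewrite (nbhs_singleton r) -deriveEjacobian // [X in is_derive _ _ _ X]deriveE //.
    by apply: is_derive_chain => //; exact: diff_is_derive.
  have [dJ hJ EJ] := jacobian_is_derive (X x) c2.
  have h2 : is_derive x (X x) (Y' \o f) ('D_(X x) X' x *m 'J f x + X' x *m dJ).
    apply: (@near_eq_is_derive _ _ _ (fun y => X' y *m 'J f y)).
      by apply: filterS r' => y /= ->.
    by apply: is_derive_mulmx => //; exact: diff_is_derive.
  by have [_ <-] := h1; have [_ ->] := h2; rewrite EJ.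
rewrite (key X1 X2 Y1 Y2) // (key X2 X1 Y2 Y1) // sym mulmxBl.
by rewrite opprD addrACA subrr addr0.
Qed.

End Diff.

(** * Tangent maps and velocities of curves *)

Section Jacobians.
Context {R : realType}.

(** The value of the Jacobian carries information only at points of
    differentiability, so both are transported together by the chain rule. *)
Definition has_jac m n (f : 'rV[R]_m -> 'rV[R]_n) (q : 'rV[R]_m) (A : 'M[R]_(m, n)) :=
  differentiable f q /\ 'J f q = A.

Lemma mulmx_ext m n (A B : 'M[R]_(m, n)) :
  (forall v : 'rV[R]_m, v *m A = v *m B) -> A = B.
Proof. by move=> h; apply/row_matrixP => i; rewrite !rowE. Qed.

Lemma has_jac_comp m n k (f : 'rV[R]_m -> 'rV[R]_n) (g : 'rV[R]_n -> 'rV[R]_k) q A B :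
  has_jac f q A -> has_jac g (f q) B -> has_jac (g \o f) q (A *m B).
Proof.
move=> [df <-] [dg <-].
have h := is_diff_comp (differentiableP df) (differentiableP dg).
case: h => h1 h2; split; first exact: h1.
apply: mulmx_ext => v; apply: (etrans (esym (deriveEjacobian v h1))).
rewrite (deriveE v h1) h2 /= mulmxA -(deriveEjacobian v df).
by rewrite -(deriveEjacobian _ dg) (deriveE v df) (deriveE _ dg).
Qed.

Lemma has_jac_unique m n (f : 'rV[R]_m -> 'rV[R]_n) q A B :
  has_jac f q A -> has_jac f q B -> A = B.
Proof. by move=> [_ <-] [_ <-]. Qed.

Lemma has_jac_near m n (f g : 'rV[R]_m -> 'rV[R]_n) q A :
  (\forall y \near q, f y = g y) -> has_jac f q A -> has_jac g q A.
Proof.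
move=> fg [df <-]; have dg := near_eq_differentiable fg df.
split; first exact: dg.
have e v : 'D_v f q = 'D_v g q by exact: near_eq_derive.
apply: mulmx_ext => v; apply: (etrans (esym (deriveEjacobian v dg))).
by apply: (etrans (esym (e v))); exact: deriveEjacobian.
Qed.

Lemma has_jac_id n (q : 'rV[R]_n) : has_jac id q 1%:M.
Proof.
have d : differentiable (id : 'rV[R]_n -> 'rV[R]_n) q by case: (is_diff_id q).
split; first exact: d.
by apply: mulmx_ext => v; rewrite -(deriveEjacobian v d) derive_id mulmx1.
Qed.

Lemma has_jac_derive m n (f : 'rV[R]_m -> 'rV[R]_n) q A (V : normedModType R)
    (c : V -> 'rV[R]_m) x u v :
  is_derive x u c v -> c x = q -> has_jac f q A -> is_derive x u (f \o c) (v *m A).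
Proof.
move=> dc cq [df <-]; rewrite -deriveEjacobian // deriveE // -cq.
by apply: is_derive_chain => //; rewrite cq.
Qed.

End Jacobians.

Section Manifolds.
Context {R : realType}.
Implicit Types m n k : nat.

Lemma cmapK_at n (M : manifoldType R n) (y x : M) : cdom (chart_at y) x ->
  cinv (chart_at y) (chart_at y x) = x.
Proof. by move=> h; apply: cmapK; rewrite inE. Qed.

Lemma cinvK_at n (M : manifoldType R n) (y : M) q : cimg y q ->
  chart_at y (cinv (chart_at y) q) = q /\ cdom (chart_at y) (cinv (chart_at y) q).
Proof. by move=> [x dx <-]; rewrite cmapK_at. Qed.

Lemma chart_cvg n (M : manifoldType R n) (y x : M) : cdom (chart_at y) x ->
  {for x, continuous (chart_at y)}.
Proof. by move=> h; apply: cmap_continuous; rewrite inE. Qed.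

Lemma cimg_chart n (M : manifoldType R n) (y x : M) : cdom (chart_at y) x ->
  cimg y (chart_at y x).
Proof. by move=> h; exists x. Qed.

Lemma cinv_cvg n (M : manifoldType R n) (y : M) q : cimg y q ->
  {for q, continuous (cinv (chart_at y))}.
Proof. by move=> h; apply: cinv_continuous; rewrite inE. Qed.

Lemma cimg_nbhs n (M : manifoldType R n) (y : M) q : cimg y q ->
  \forall q' \near q, cimg y q'.
Proof. by move=> h; apply: open_nbhs_nbhs; split => //; exact: cimg_open. Qed.

Lemma cdom_nbhs n (M : manifoldType R n) (y x : M) : cdom (chart_at y) x ->
  \forall x' \near x, cdom (chart_at y) x'.
Proof. by move=> h; apply: open_nbhs_nbhs; split => //; exact: cdom_open. Qed.

Lemma cinv_near n (M : manifoldType R n) (y x : M) (P : set M) :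
  cdom (chart_at y) x -> (\forall x' \near x, P x') ->
  \forall q \near chart_at y x, P (cinv (chart_at y) q).
Proof.
move=> dx; rewrite -{1}(cmapK_at dx) => h.
exact: (cinv_cvg (cimg_chart dx)).
Qed.

Lemma transition_smooth n (M : manifoldType R n) (y z x : M) :
  cdom (chart_at y) x -> cdom (chart_at z) x ->
  smooth_near (chart_at z \o cinv (chart_at y)) (chart_at y x).
Proof.
move=> dy dz; exists (chart_at y @` (cdom (chart_at y) `&` cdom (chart_at z))).
  by exists x.
exact: chart_at_compat.
Qed.

Lemma smooth_near_differentiable m n (f : 'rV[R]_m -> 'rV[R]_n) q :
  smooth_near f q -> differentiable f q.
Proof. by move=> [A Aq sA]; apply: (smooth_differentiable _ sA Aq); exact: fin_coords_rV. Qed.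

Lemma has_jac_transition n (M : manifoldType R n) (y z x : M) :
  cdom (chart_at y) x -> cdom (chart_at z) x ->
  has_jac (chart_at z \o cinv (chart_at y)) (chart_at y x) (tchange x y z).
Proof.
by move=> dy dz; split; first exact/smooth_near_differentiable/transition_smooth.
Qed.

Lemma tchange_comp n (M : manifoldType R n) (x y z w : M) :
  cdom (chart_at y) x -> cdom (chart_at z) x -> cdom (chart_at w) x ->
  tchange x y z *m tchange x z w = tchange x y w.
Proof.
move=> dy dz dw.
have h1 := has_jac_transition dy dz; have h2 := has_jac_transition dz dw.
have e : (chart_at z \o cinv (chart_at y)) (chart_at y x) = chart_at z x.
  by rewrite /= cmapK_at.
rewrite -e in h2.
apply: has_jac_unique (has_jac_transition dy dw).
apply: has_jac_near (has_jac_comp h1 h2).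
have := cinv_near dy (cdom_nbhs dz).
by apply: filterS => q h /=; rewrite cmapK_at.
Qed.

Lemma tchange_id n (M : manifoldType R n) (x y : M) :
  cdom (chart_at y) x -> tchange x y y = 1%:M.
Proof.
move=> dy; apply: has_jac_unique (has_jac_transition dy dy) _.
apply: has_jac_near (has_jac_id _).
by have := cimg_nbhs (cimg_chart dy); apply: filterS => q /cinvK_at[/= ->].
Qed.

(** The first-order content of [smooth_at]: closed under composition by the
    chain rule alone. *)
Definition mdiff m n (M : manifoldType R m) (N : manifoldType R n) (F : M -> N) (x : M) :=
  {for x, continuous F} /\
  differentiable (chart_at (F x) \o F \o cinv (chart_at x)) (chart_at x x).

Lemma smooth_at_mdiff m n (M : manifoldType R m) (N : manifoldType R n) (F : M -> N) (x : M) :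
  smooth_at F x -> mdiff F x.
Proof. by move=> [c s]; split => //; exact: smooth_near_differentiable. Qed.

Let domx n (M : manifoldType R n) (x : M) := @chart_at_dom R n M x.

Lemma mdiff_has_jac m n (M : manifoldType R m) (N : manifoldType R n) (F : M -> N) (x : M) :
  mdiff F x -> has_jac (chart_at (F x) \o F \o cinv (chart_at x)) (chart_at x x) (tmap F x).
Proof. by case. Qed.

(** Tangent maps are defined with the charts attached to the points; other
    charts bring in the changes of coordinates. *)
Lemma has_jac_charts m n (M : manifoldType R m) (N : manifoldType R n) (F : M -> N)
    (x y : M) (z : N) :
  mdiff F x -> cdom (chart_at y) x -> cdom (chart_at z) (F x) ->
  has_jac (chart_at z \o F \o cinv (chart_at y)) (chart_at y x)
    (tchange x y x *m tmap F x *m tchange (F x) (F x) z).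
Proof.
move=> dF dy dz.
have h1 := has_jac_transition dy (domx x).
have h2 := mdiff_has_jac dF.
have h3 := has_jac_transition (domx (F x)) dz.
have e1 : (chart_at x \o cinv (chart_at y)) (chart_at y x) = chart_at x x by rewrite /= cmapK_at.
rewrite -e1 in h2; have h4 := has_jac_comp h1 h2.
have e2 : ((chart_at (F x) \o F \o cinv (chart_at x)) \o (chart_at x \o cinv (chart_at y))) (chart_at y x) = chart_at (F x) (F x).
  by rewrite /= !cmapK_at.
rewrite -e2 in h3; apply: has_jac_near (has_jac_comp h4 h3).
have c1 : \forall q \near chart_at y x, cdom (chart_at x) (cinv (chart_at y) q).
  exact: cinv_near dy (cdom_nbhs (domx x)).
have c2 : \forall q \near chart_at y x, cdom (chart_at (F x)) (F (cinv (chart_at y) q)).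
  apply: (cinv_near (P := fun x => cdom _ (F x)) dy); apply: dF.1.
  exact: cdom_nbhs.
by apply: filterS2 c1 c2 => q h h' /=; rewrite !cmapK_at.
Qed.

Lemma mdiff_near m n (M : manifoldType R m) (N : manifoldType R n) (F F' : M -> N) (x : M) :
  (\forall x' \near x, F x' = F' x') -> mdiff F x -> mdiff F' x /\ tmap F' x = tmap F x.
Proof.
move=> e dF; have ex := nbhs_singleton e.
have [dF' eF'] : has_jac (chart_at (F' x) \o F' \o cinv (chart_at x)) (chart_at x x) (tmap F x).
  apply: has_jac_near (mdiff_has_jac dF).
  by have := cinv_near (domx x) e; apply: filterS => q /= ->; rewrite ex.
split; last exact: eF'.
split; last exact: dF'.
rewrite /prop_for /continuous_at -ex; apply: cvg_trans dF.1.
by apply: near_eq_cvg; apply: filterS e => y ->.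
Qed.

Lemma mdiff_comp m n k (M : manifoldType R m) (N : manifoldType R n) (P : manifoldType R k)
    (F : M -> N) (H : N -> P) (x : M) :
  mdiff F x -> mdiff H (F x) ->
  mdiff (H \o F) x /\ tmap (H \o F) x = tmap F x *m tmap H (F x).
Proof.
move=> dF dH.
have h1 := mdiff_has_jac dF; have h2 := mdiff_has_jac dH.
have e1 : (chart_at (F x) \o F \o cinv (chart_at x)) (chart_at x x) = chart_at (F x) (F x).
  by rewrite /= cmapK_at.
rewrite -e1 in h2.
have [d e] : has_jac (chart_at ((H \o F) x) \o (H \o F) \o cinv (chart_at x)) (chart_at x x)
    (tmap F x *m tmap H (F x)).
  apply: has_jac_near (has_jac_comp h1 h2).
  have c2 : \forall q \near chart_at x x, cdom (chart_at (F x)) (F (cinv (chart_at x) q)).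
    apply: (cinv_near (P := fun x => cdom _ (F x)) (domx x)); apply: dF.1.
    exact: cdom_nbhs.
  by apply: filterS c2 => q h /=; rewrite cmapK_at.
split; last exact: e.
split; last exact: d.
apply: continuous_comp; [exact: dF.1 | exact: dH.1].
Qed.

Lemma mdiff_id m (M : manifoldType R m) (x : M) : mdiff (id : M -> M) x /\ tmap (id : M -> M) x = 1%:M.
Proof.
have [d e] : has_jac (chart_at x \o cinv (chart_at x)) (chart_at x x) (1%:M).
  have := has_jac_transition (domx x) (domx x); by rewrite tchange_id.
split; last exact: e.
by split; last exact: d.
Qed.

(** The velocity is expressed in the chart attached to the point [c t] itself,
    as tangent vectors are. *)
Definition vel n (M : manifoldType R n) (c : R -> M) (t : R) (v : 'rV[R]_n) :=
  {for t, continuous c} /\ is_derive t 1 (chart_at (c t) \o c) v.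

Lemma vel_chart n (M : manifoldType R n) (c : R -> M) (t : R) v (y : M) :
  vel c t v -> cdom (chart_at y) (c t) ->
  is_derive t 1 (chart_at y \o c) (v *m tchange (c t) (c t) y).
Proof.
move=> [cc dc] dy.
have h := has_jac_derive dc (erefl _) (has_jac_transition (domx (c t)) dy).
apply: near_eq_is_derive h.
have : \forall s \near t, cdom (chart_at (c t)) (c s) by exact: cc (cdom_nbhs (domx _)).
by apply: filterS => s h /=; rewrite cmapK_at.
Qed.

Lemma chart_vel n (M : manifoldType R n) (c : R -> M) (t : R) v (y : M) :
  {for t, continuous c} -> cdom (chart_at y) (c t) ->
  is_derive t 1 (chart_at y \o c) v -> vel c t (v *m tchange (c t) y (c t)).
Proof.
move=> cc dy dc; split => //.
have h := has_jac_derive dc (erefl _) (has_jac_transition dy (domx (c t))).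
apply: near_eq_is_derive h.
have : \forall s \near t, cdom (chart_at y) (c s) by exact: cc (cdom_nbhs dy).
by apply: filterS => s h /=; rewrite cmapK_at.
Qed.

Lemma vel_comp m n (M : manifoldType R m) (N : manifoldType R n) (F : M -> N)
    (c : R -> M) t v :
  vel c t v -> mdiff F (c t) -> vel (F \o c) t (v *m tmap F (c t)).
Proof.
move=> [cc dc] dF; split; first by apply: continuous_comp => //; exact: dF.1.
have h := has_jac_derive dc (erefl _) (mdiff_has_jac dF).
apply: near_eq_is_derive h.
have : \forall s \near t, cdom (chart_at (c t)) (c s) by exact: cc (cdom_nbhs (domx _)).
by apply: filterS => s h /=; rewrite cmapK_at.
Qed.

Lemma vel_unique n (M : manifoldType R n) (c : R -> M) t v w :
  vel c t v -> vel c t w -> v = w.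
Proof. by move=> [_ [_ <-]] [_ [_ <-]]. Qed.

Lemma vel_near n (M : manifoldType R n) (c c' : R -> M) t v :
  (\forall s \near t, c s = c' s) -> vel c t v -> vel c' t v.
Proof.
move=> e [cc dc]; have et := nbhs_singleton e; split.
  rewrite /prop_for /continuous_at -et; apply: cvg_trans cc.
  by apply: near_eq_cvg; apply: filterS e => y ->.
rewrite -et; apply: near_eq_is_derive dc.
by apply: filterS e => s /= ->.
Qed.

Lemma vel_cst n (M : manifoldType R n) (x : M) t : vel (fun _ => x) t 0.
Proof. by split; [exact: cst_continuous | exact: is_derive_cst]. Qed.

Lemma is_derive_line n (q v : 'rV[R]_n) (t : R) :
  is_derive t 1 (fun s : R => q + s *: v) v.
Proof.
rewrite -[X in is_derive _ _ _ X]add0r; apply: is_deriveD.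
have h : is_diff t (fun s : R => s *: v) (fun s : R => s *: v) by exact: is_diff_scalel.
case: h => h1 h2; split; first exact/derivable1_diffP.
by rewrite deriveE // h2 scale1r.
Qed.

Lemma line_continuous n (q v : 'rV[R]_n) : continuous (fun s : R => q + s *: v).
Proof.
move=> s; apply/differentiable_continuous/derivable1_diffP.
by case: (is_derive_line q v s).
Qed.

Lemma vel_line n (M : manifoldType R n) (y : M) (q v : 'rV[R]_n) (t : R) :
  cimg y (q + t *: v) ->
  let c := fun s : R => cinv (chart_at y) (q + s *: v) in
  vel c t (v *m tchange (c t) y (c t)).
Proof.
move=> h c; have [h1 h2] := cinvK_at h.
apply: chart_vel => //.
  apply: continuous_comp; first exact: line_continuous.
  exact: cinv_cvg.
apply: near_eq_is_derive (is_derive_line q v t).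
have : \forall s \near t, cimg y (q + s *: v) by exact: line_continuous (cimg_nbhs h).
by apply: filterS => s /cinvK_at[/= -> _].
Qed.

(** Tangent vectors are realized by curves, which allows identities between
    tangent maps to be checked on curves. *)
Lemma vel_exists n (M : manifoldType R n) (x : M) v :
  exists c : R -> M, c 0 = x /\ vel c 0 v.
Proof.
have h : cimg x (chart_at x x + 0 *: v) by rewrite scale0r addr0; exact/cimg_chart/domx.
exists (fun s : R => cinv (chart_at x) (chart_at x x + s *: v)).
have e : cinv (chart_at x) (chart_at x x + 0 *: v) = x by rewrite scale0r addr0 cmapK_at.
by split => //; have := vel_line h; rewrite /= !e tchange_id ?mulmx1.
Qed.

End Manifolds.

(** * Differentiability of matrix inversion *)

Section MatrixInverse.
Context {R : realType} {V : normedModType R}.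

Lemma differentiable_big_sum (I : Type) (r : seq I) (f : I -> V -> R) x :
  (forall i, differentiable (f i) x) -> differentiable (fun y => \sum_(i <- r) f i y) x.
Proof.
move=> df; elim: r => [|i r IH].
  rewrite (_ : (fun _ => _) = cst 0); first exact: differentiable_cst.
  by apply/funext => y; rewrite big_nil.
rewrite (_ : (fun _ => _) = f i + (fun y => \sum_(j <- r) f j y)); first exact: differentiableD.
by apply/funext => y; rewrite big_cons.
Qed.

Lemma differentiable_big_prod (I : Type) (r : seq I) (f : I -> V -> R) x :
  (forall i, differentiable (f i) x) -> differentiable (fun y => \prod_(i <- r) f i y) x.
Proof.
move=> df; elim: r => [|i r IH].
  rewrite (_ : (fun _ => _) = cst 1); first exact: differentiable_cst.
  by apply/funext => y; rewrite big_nil.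
rewrite (_ : (fun _ => _) = f i * (fun y => \prod_(j <- r) f j y)); first exact: differentiableM.
by apply/funext => y; rewrite big_cons.
Qed.

Lemma differentiable_det n (M : V -> 'M[R]_n) x :
  (forall i j, differentiable (fun y => M y i j) x) -> differentiable (fun y => \det (M y)) x.
Proof.
move=> dM; rewrite /determinant; apply: differentiable_big_sum => s.
rewrite (_ : (fun _ => _) = (cst ((-1) ^+ s)) * (fun y => \prod_i M y i (s i))) //.
apply: differentiableM; first exact: differentiable_cst.
by apply: differentiable_big_prod.
Qed.

End MatrixInverse.

Section MatrixInverse2.
Context {R : realType}.

Lemma unitmx_near n (P : 'M[R]_n) : P \in unitmx -> \forall X \near P, X \in unitmx.
Proof.
move=> uP; have d0 : \det P != 0 by rewrite -unitfE -unitmxE.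
have dd : differentiable (fun X : 'M[R]_n => \det X) P.
  by apply: differentiable_det => i j; exact: differentiable_coord.
have : \forall X \near P, \det X != 0.
  exact: cvgr_neq0 (differentiable_continuous dd) d0.
by apply: filterS => X; rewrite unitmxE unitfE.
Qed.

(** By Cramer's rule the entries of the inverse are rational functions of the
    entries. *)
Lemma differentiable_invmx n (P : 'M[R]_n) : P \in unitmx ->
  differentiable (invmx : 'M[R]_n -> 'M[R]_n) P.
Proof.
move=> uP; have d0 : \det P != 0 by rewrite -unitfE -unitmxE.
have coord m k (M : 'M[R]_(m,k)) i j : differentiable (fun X : 'M[R]_(m, k) => X i j) M.
  exact: differentiable_coord.
have dd : differentiable (fun X : 'M[R]_n => \det X) P by apply: differentiable_det => i j.
apply: (@near_eq_differentiable _ _ _ (fun X : 'M[R]_n => (\det X)^-1 *: \adj X)).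
  by have := unitmx_near uP; apply: filterS => X uX; rewrite /invmx uX.
apply: diff_mxP => i j.
have -> : (fun X : 'M[R]_n => ((\det X)^-1 *: \adj X) i j) =
  (fun X => (\det X)^-1) * (fun X => (\adj X) i j).
  by apply/funext => X; rewrite [LHS]mxE.
apply: differentiableM; first exact: differentiableV.
have -> : (fun X : 'M[R]_n => (\adj X) i j) =
  cst ((-1) ^+ (j + i)) * (fun X : 'M[R]_n => \det (row' j (col' i X))).
  by apply/funext => X; rewrite [LHS]mxE.
apply: differentiableM; first exact: differentiable_cst.
apply: differentiable_det => k l.
rewrite (_ : (fun _ => _) = (fun X : 'M[R]_n => X (lift j k) (lift i l))); first exact: coord.
by apply/funext => X; rewrite !mxE.
Qed.

(** Differentiate [P y *m invmx (P y) = 1]. *)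
Lemma is_derive_invmx n (P : R -> 'M[R]_n) (t : R) dP :
  is_derive t 1 P dP -> P t \in unitmx ->
  is_derive t 1 (fun y => invmx (P y)) (- (invmx (P t) *m dP *m invmx (P t))).
Proof.
move=> dPx uP; have dI := is_derive_chain dPx (differentiable_invmx uP).
set d := 'd _ _ _ in dI.
suff <- : d = - (invmx (P t) *m dP *m invmx (P t)) by [].
have h := is_derive_mulmx dPx dI.
have E : is_derive t 1 (fun y => P y *m (invmx \o P) y) 0.
  apply: (@near_eq_is_derive R R 'M[R]_n (cst (1%:M : 'M[R]_n))).
  have cP : {for t, continuous P}.
    by apply: differentiable_continuous; apply/derivable1_diffP; case: dPx.
  have : \forall s \near t, P s \in unitmx by exact: cP (unitmx_near uP).
  by apply: filterS => s us; rewrite /= mulmxV.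
have [_ e1] := h; have [_ e2] := E; move: e1; rewrite {}e2 => /esym/(congr1 (mulmx (invmx (P t)))).
rewrite mulmx0 mulmxDr !mulmxA mulVmx // mul1mx => /eqP.
by rewrite addrC addr_eq0 => /eqP.
Qed.

End MatrixInverse2.

(** * Left translations and the Lie bracket *)

Section Pairs.
Context {R : realType}.

Lemma is_derive_pair (U V W : normedModType R) (f : U -> V) (g : U -> W) x u v w :
  is_derive x u f v -> is_derive x u g w ->
  is_derive x u (fun y => (f y, g y)) (v, w).
Proof.
move=> /is_derive_curve /is_derive1_diff df /is_derive_curve /is_derive1_diff dg.
apply/is_derive_curve.
have [h1 h2] := is_diff_pair df dg; split; first exact/derivable1_diffP.
by rewrite deriveE // h2 /= !scale1r.
Qed.

Lemma derive_slice (U V W : normedModType R) (f : U * V -> W) x y (v : V) d :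
  is_derive (x, y) (0, v) f d <-> is_derive y v (fun z => f (x, z)) d.
Proof.
split=> /is_derive_curve h; apply/is_derive_curve; move: h; congr is_derive;
  apply/funext => t /=; congr f; congr pair => /=; by rewrite scaler0 add0r.
Qed.

Lemma derive_slicel (U V W : normedModType R) (f : U * V -> W) x y (u : U) d :
  is_derive (x, y) (u, 0) f d <-> is_derive x u (fun z => f (z, y)) d.
Proof.
split=> /is_derive_curve h; apply/is_derive_curve; move: h; congr is_derive;
  apply/funext => t /=; congr f; congr pair => /=; by rewrite scaler0 add0r.
Qed.

Lemma differentiable_slice (U V W : normedModType R) (f : U * V -> W) x y :
  differentiable f (x, y) -> differentiable (fun z => f (x, z)) y.
Proof.
by move=> df; apply: (@differentiable_comp _ _ _ _ (fun z => (x, z)) f).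
Qed.

Lemma differentiable_slicel (U V W : normedModType R) (f : U * V -> W) x y :
  differentiable f (x, y) -> differentiable (fun z => f (z, y)) x.
Proof.
by move=> df; apply: (@differentiable_comp _ _ _ _ (fun z => (z, y)) f).
Qed.

Lemma differentiable_rows (V : normedModType R) m k (P : V -> 'M[R]_(m, k)) x :
  (forall v : 'rV[R]_m, differentiable (fun y => v *m P y) x) -> differentiable P x.
Proof.
move=> h; apply: diff_mxP => i j.
have -> : (fun y => P y i j) = (fun M : 'rV[R]_k => M 0 j) \o (fun y => delta_mx 0 i *m P y).
  by apply/funext => y; rewrite /= -rowE mxE.
by apply: differentiable_comp; [exact: h|exact: differentiable_coord].
Qed.

Lemma derive_mulmxl (V : normedModType R) l m k (v : 'M[R]_(l, m)) (P : V -> 'M[R]_(m, k)) x u dP :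
  is_derive x u P dP -> is_derive x u (fun y => v *m P y) (v *m dP).
Proof.
move=> h; have := is_derive_mulmx (is_derive_cst v x u) h.
by rewrite mul0mx add0r.
Qed.

Lemma derive_mulmxr (V : normedModType R) l m k (P : V -> 'M[R]_(l, m)) (B : 'M[R]_(m, k)) x u dP :
  is_derive x u P dP -> is_derive x u (fun y => P y *m B) (dP *m B).
Proof.
move=> h; have := is_derive_mulmx h (is_derive_cst B x u).
by rewrite mulmx0 addr0.
Qed.

Lemma has_jac_is_derive m k (f : 'rV[R]_m -> 'rV[R]_k) q A v :
  has_jac f q A -> is_derive q v f (v *m A).
Proof. by move=> [df <-]; rewrite -(deriveEjacobian v df); exact: diff_is_derive. Qed.

End Pairs.

Section LieGroups.
Context {R : realType} {n : nat} (G : lieGroupType R n).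

(** The group law in charts; the regularity of translations and of invariant
    fields is deduced from that of this map and of its partial derivatives. *)
Definition mulc (a b : G) (q : 'rV[R]_n * 'rV[R]_n) : 'rV[R]_n :=
  chart_at (a * b)%g (cinv (chart_at a) q.1 * cinv (chart_at b) q.2)%g.

Let domx (x : G) := @chart_at_dom R n G x.

Lemma mulc_differentiable (a b : G) : differentiable (mulc a b) (chart_at a a, chart_at b b).
Proof.
have [A Ax sA] := lie_mul_smooth a b.
by apply: (smooth_differentiable _ sA Ax); apply: fin_coords_pair; exact: fin_coords_rV.
Qed.

Lemma mul_continuous_at (f g : R -> G) t : {for t, continuous f} -> {for t, continuous g} ->
  {for t, continuous (fun s => (f s * g s)%g)}.
Proof.
move=> cf cg; apply: (continuous_comp (f := fun s => (f s, g s)) (g := fun ab => (ab.1 * ab.2)%g)).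
  exact: cvg_pair.
exact: lie_mul_continuous.
Qed.

Lemma mulc_slice (a x : G) :
  chart_at (a * x)%g \o (fun k => a * k)%g \o cinv (chart_at x)
  = fun z => mulc a x (chart_at a a, z).
Proof. by apply/funext => q; rewrite /mulc /= cmapK_at. Qed.

Lemma mulc_slicel (a x : G) :
  chart_at (x * a)%g \o (fun k => k * a)%g \o cinv (chart_at x)
  = fun z => mulc x a (z, chart_at a a).
Proof. by apply/funext => q; rewrite /mulc /= cmapK_at. Qed.

Lemma mdiff_lmul (a x : G) : mdiff (fun k => a * k)%g x.
Proof.
split.
  apply: (continuous_comp (f := fun k : G => (a, k)) (g := fun ab => (ab.1 * ab.2)%g)).
    by apply: cvg_pair; [exact: cvg_cst|exact: cvg_id].
  exact: lie_mul_continuous.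
rewrite mulc_slice; exact: differentiable_slice (mulc_differentiable a x).
Qed.

Lemma mdiff_rmul (a x : G) : mdiff (fun k => k * a)%g x.
Proof.
split.
  apply: (continuous_comp (f := fun k : G => (k, a)) (g := fun ab => (ab.1 * ab.2)%g)).
    by apply: cvg_pair; [exact: cvg_id|exact: cvg_cst].
  exact: lie_mul_continuous.
rewrite mulc_slicel; exact: differentiable_slicel (mulc_differentiable x a).
Qed.

(** The differential of the group law at a pair is the sum of its restrictions
    to the two factors, which are the tangent maps of the translations. *)
Lemma vel_mul (a b : R -> G) t u w : vel a t u -> vel b t w ->
  vel (fun s => a s * b s)%g t
    (u *m tmap (fun k => k * b t)%g (a t) + w *m tmap (fun k => a t * k)%g (b t)).
Proof.
move=> [ca da] [cb db].
have dm := mulc_differentiable (a t) (b t).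
pose q s := (chart_at (a t) (a s), chart_at (b t) (b s)).
have dq : is_derive t 1 q (u, w) by exact: is_derive_pair.
have D := is_derive_chain dq dm.
split; first exact: mul_continuous_at.
have eL : w *m tmap (fun k => a t * k)%g (b t) = 'd (mulc (a t) (b t)) (q t) (0, w).
  rewrite -deriveEjacobian; last exact: (mdiff_lmul _ _).2.
  rewrite -(deriveE _ dm).
  have [_ <-] := (derive_slice _ _ _ _ _).1 (diff_is_derive (0, w) dm).
  by rewrite mulc_slice.
have eR : u *m tmap (fun k => k * b t)%g (a t) = 'd (mulc (a t) (b t)) (q t) (u, 0).
  rewrite -deriveEjacobian; last exact: (mdiff_rmul _ _).2.
  rewrite -(deriveE _ dm).
  have [_ <-] := (derive_slicel _ _ _ _ _).1 (diff_is_derive (u, 0) dm).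
  by rewrite mulc_slicel.
rewrite eL eR -linearD /=.
have -> : (u, 0) + (0, w) = (u, w) :> 'rV[R]_n * 'rV[R]_n.
  by congr pair => /=; rewrite ?addr0 ?add0r.
apply: near_eq_is_derive D.
have h1 : \forall s \near t, cdom (chart_at (a t)) (a s) by exact: ca (cdom_nbhs (domx _)).
have h2 : \forall s \near t, cdom (chart_at (b t)) (b s) by exact: cb (cdom_nbhs (domx _)).
by apply: filterS2 h1 h2 => s k1 k2; rewrite /mulc /= !cmapK_at.
Qed.

Definition ltrans (a : G) : 'M[R]_n := tmap (fun k => a * k)%g (1%g : G).
Definition rtrans (a : G) : 'M[R]_n := tmap (fun k => k * a)%g (1%g : G).

Lemma tmap_lmul_comp (a b x : G) :
  tmap (fun k => a * k)%g x *m tmap (fun k => b * k)%g (a * x)%g = tmap (fun k => (b * a) * k)%g x.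
Proof.
have [_ <-] := mdiff_comp (mdiff_lmul a x) (mdiff_lmul b (a * x)%g).
by congr (tmap _ _); apply/funext => k /=; rewrite mulgA.
Qed.

Lemma tmap_lmul1 (x : G) : tmap (fun k => 1 * k)%g x = 1%:M.
Proof.
rewrite -(mdiff_id x).2; congr (tmap _ _); apply/funext => k; exact: mul1g.
Qed.

Lemma tmap_lmulV (a x : G) :
  tmap (fun k => a * k)%g x *m tmap (fun k => a^-1 * k)%g (a * x)%g = 1%:M.
Proof. by rewrite tmap_lmul_comp mulVg tmap_lmul1. Qed.

Lemma ltrans1 : ltrans 1%g = 1%:M.
Proof. exact: tmap_lmul1. Qed.

Lemma ltrans_unit (a : G) : ltrans a \in unitmx.
Proof. have /mulmx1_unit[h _] := tmap_lmulV a 1%g; exact: h. Qed.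

Lemma vel_lmul (a : G) (k : R -> G) t u : k t = 1%g -> vel k t u ->
  vel (fun s => a * k s)%g t (u *m ltrans a).
Proof. by move=> kt vk; have := vel_comp vk (mdiff_lmul a (k t)); rewrite kt. Qed.

(** The velocity transported to the Lie algebra by left translation: the
    logarithmic derivative of the curve. *)
Definition lvel (a : R -> G) t (v : 'rV[R]_n) := vel (fun s => (a t)^-1 * a s)%g t v.

Lemma lvel_vel a t v : lvel a t v -> vel a t (v *m ltrans (a t)).
Proof.
move=> h; have := vel_lmul (a t) (mulVg _) h.
have -> : (fun s => a t * ((a t)^-1 * a s))%g = a by apply/funext => s; rewrite mulVKg.
by [].
Qed.

(** The rows are the left-invariant vector fields in the chart at [y]. *)
Definition lframe (y : G) (q : 'rV[R]_n) : 'M[R]_n :=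
  let x := cinv (chart_at y) q in ltrans x *m tchange x x y.

Lemma lframeE (y : G) q :
  lframe y q = ltrans (cinv (chart_at y) q) *m
               tchange (cinv (chart_at y) q) (cinv (chart_at y) q) y.
Proof. by []. Qed.

(** The group law near [a] and the identity, with values read in the chart at
    [a]; the chart at the product is the same only propositionally. *)
Definition mulc1 (a : G) (q : 'rV[R]_n * 'rV[R]_n) : 'rV[R]_n :=
  chart_at a (cinv (chart_at a) q.1 * cinv (chart_at (1%g : G)) q.2)%g.

Lemma mulc1_smooth (a : G) : smooth_near (mulc1 a) (chart_at a a, chart_at (1%g : G) 1%g).
Proof. by have := lie_mul_smooth a (1%g : G); rewrite mulg1. Qed.

Lemma lframe_jac (y : G) q : cimg y q ->
  has_jac (chart_at y \o (fun k => cinv (chart_at y) q * k)%g \o cinv (chart_at (1%g : G)))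
    (chart_at (1%g : G) 1%g) (lframe y q).
Proof.
move=> hq; have [e d] := cinvK_at hq; set x := cinv _ q in e d *.
have dx : cdom (chart_at y) (x * 1)%g by rewrite mulg1.
have := has_jac_charts (mdiff_lmul x 1%g) (domx 1%g) dx.
by rewrite tchange_id ?mul1mx ?mulg1.
Qed.

Lemma lframe_derive (y : G) q v : cimg y q ->
  is_derive (q, chart_at (1%g : G) 1%g) (0, v) (mulc1 y) (v *m lframe y q).
Proof. by move=> hq; apply/derive_slice; exact: has_jac_is_derive (lframe_jac hq). Qed.

(** The left frame is a partial derivative of the group law, hence smooth. *)
Lemma lframe_diff (y : G) : differentiable (lframe y) (chart_at y y).
Proof.
apply: differentiable_rows => v.
have [A Ax sA] := mulc1_smooth y.
have fc : fin_coords ('rV[R]_n * 'rV[R]_n)%type by apply: fin_coords_pair; exact: fin_coords_rV.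
have := differentiable_slicel (smooth_differentiable fc (smooth_derive (0, v) sA) Ax).
apply: near_eq_differentiable.
by have := cimg_nbhs (cimg_chart (domx y)); apply: filterS => q /(lframe_derive v)[].
Qed.

Lemma lframe1 (y : G) : lframe y (chart_at y y) = ltrans y.
Proof. by rewrite /lframe cmapK_at // tchange_id ?mulmx1. Qed.

Lemma left_field_chart u (y : G) q :
  field_in_chart (left_field (G := G) u) y q = u *m lframe y q.
Proof. by rewrite /field_in_chart /left_field /lframe mulmxA. Qed.

Lemma lie_bracketE u v :
  lie_bracket G u v =
  'D_u (fun q => v *m lframe (1%g : G) q) (chart_at (1%g : G) 1%g)
  - 'D_v (fun q => u *m lframe (1%g : G) q) (chart_at (1%g : G) 1%g).
Proof.
rewrite /lie_bracket /field_bracket.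
have e w : field_in_chart (left_field (G := G) w) (1%g : G) = (fun q => w *m lframe (1%g : G) q).
  by apply/funext => q; exact: left_field_chart.
have e1 w : left_field (G := G) w 1%g = w.
  by rewrite /left_field -/(ltrans _) ltrans1 mulmx1.
by rewrite !e !e1.
Qed.

Lemma bracketC u v : lie_bracket G u v = - lie_bracket G v u.
Proof. by rewrite !lie_bracketE opprB. Qed.

Lemma bracketvv u : lie_bracket G u u = 0.
Proof. by rewrite lie_bracketE subrr. Qed.

(** The adjoint representation, up to sign, as matrices acting on rows. *)
Definition adr (u : 'rV[R]_n) : 'M[R]_n := \matrix_(i < n) lie_bracket G (delta_mx 0 i) u.

Lemma derive_lframe (u v : 'rV[R]_n) :
  'D_u (fun q => v *m lframe (1%g : G) q) (chart_at (1%g : G) 1%g)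
  = v *m ('d (lframe (1%g : G)) (chart_at (1%g : G) 1%g) u : 'M[R]_n).
Proof.
rewrite -(deriveE u (lframe_diff 1%g)).
by have [_ ->] := derive_mulmxl v (diff_is_derive u (lframe_diff 1%g)).
Qed.

Lemma bracket_linear u : linear (lie_bracket G u).
Proof.
move=> k v w; rewrite !lie_bracketE !derive_lframe linearP /=.
by rewrite mulmxDr mulmxDl -scalemxAl -scalemxAr scalerBr addrACA opprD.
Qed.

HB.instance Definition _ u := GRing.isLinear.Build _ _ _ _ (lie_bracket G u) (bracket_linear u).

Lemma bracketE u v : lie_bracket G u v = u *m adr v.
Proof.
rewrite {1}(row_sum_delta u) bracketC linear_sum /= -sumrN mulmx_sum_row.
by apply: eq_bigr => i _; rewrite linearZ /= -scalerN -bracketC rowK.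
Qed.

End LieGroups.

(** * Conjugation in two-step nilpotent groups *)

Section Conjugation.
Context {R : realType} {n : nat} (G : lieGroupType R n).
Let domx (x : G) := @chart_at_dom R n G x.
Let o : G := 1%g.
Let ko := chart_at o o.

Lemma vel_mul1 (a b : R -> G) t u w : a t = 1%g -> b t = 1%g ->
  vel a t u -> vel b t w -> vel (fun s => a s * b s)%g t (u + w).
Proof.
move=> a1 b1 va vb; have := vel_mul va vb; rewrite a1 b1.
rewrite tmap_lmul1 mulmx1.
have -> : (fun k : G => k * 1)%g = id by apply/funext => k; exact: mulg1.
by rewrite (mdiff_id (1%g : G)).2 mulmx1.
Qed.

Lemma vel_inv1 (a : R -> G) t u : a t = 1%g -> vel a t u ->
  vel (fun s => (a s)^-1)%g t (- u).
Proof.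
move=> a1 va; have dI : mdiff (fun x : G => x^-1)%g (a t) by apply/smooth_at_mdiff/lie_inv_smooth.
have vi := vel_comp va dI; set w := _ *m _ in vi.
have w1 : ((fun x : G => x^-1)%g \o a) t = 1%g by rewrite /= a1 invg1.
have h := vel_mul1 a1 w1 va vi.
(* The product of a curve and its inverse is constant, so velocities add up to
   zero. *)
have E : (fun s => a s * ((fun x : G => x^-1)%g \o a) s)%g = fun=> 1%g.
  by apply/funext => s /=; rewrite mulgV.
rewrite E in h.
have /eqP := vel_unique h (vel_cst _ _).
by rewrite addrC addr_eq0 => /eqP <-.
Qed.

Lemma mdiff_conj (h x : G) : mdiff (fun x => x ^ h)%g x.
Proof. exact: (mdiff_comp (mdiff_rmul h x) (mdiff_lmul h^-1%g (x * h)%g)).1. Qed.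

(** The adjoint action Ad(h^-1) on row vectors; as [x ^ h] is a right action,
    it is multiplicative in [h]. *)
Definition conjt (h : G) : 'M[R]_n := tmap (fun x => x ^ h)%g (1%g : G).

Lemma vel_conj h (k : R -> G) t u : k t = 1%g -> vel k t u ->
  vel (fun s => k s ^ h)%g t (u *m conjt h).
Proof. by move=> kt vk; have := vel_comp vk (mdiff_conj h (k t)); rewrite kt. Qed.

Lemma conjtM (h k : G) : conjt (h * k)%g = conjt h *m conjt k.
Proof.
have d2 := mdiff_conj k (1%g ^ h)%g.
have [_ E] := mdiff_comp (mdiff_conj h 1%g) d2.
rewrite /conjt -[in X in _ *m X](conj1g h) -E; congr (tmap _ _).
by apply/funext => x /=; rewrite conjgM.
Qed.

Lemma conjt1 : conjt 1%g = 1%:M.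
Proof.
rewrite -(mdiff_id (1%g : G)).2; congr (tmap _ _); apply/funext => k; exact: conjg1.
Qed.

Lemma rtransE (k : G) : rtrans k = conjt k *m ltrans k.
Proof.
have d2 := mdiff_lmul k (1%g ^ k)%g.
have [_ E] := mdiff_comp (mdiff_conj k 1%g) d2.
rewrite /conjt /ltrans /rtrans -[in X in _ *m X](conj1g k) -E; congr (tmap _ _).
by apply/funext => x /=; rewrite conjgC.
Qed.

(** The rows are the right-invariant vector fields in the chart at the
    identity. Their quotient by the left-invariant ones is the adjoint action
    ([rframeE]). *)
Definition rframe (q : 'rV[R]_n) : 'M[R]_n :=
  let x := cinv (chart_at o) q in rtrans x *m tchange x x o.

Lemma rframeE q : rframe q = conjt (cinv (chart_at o) q) *m lframe o q.
Proof. by rewrite /rframe /lframe rtransE mulmxA. Qed.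

Lemma rframe_derive q v : cimg o q ->
  is_derive (ko, q) (v, 0) (mulc1 o) (v *m rframe q).
Proof.
move=> hq; apply/derive_slicel.
have [e d] := cinvK_at hq.
have dx : cdom (chart_at o) (1 * cinv (chart_at o) q)%g by rewrite mul1g.
have h := has_jac_charts (mdiff_rmul (cinv (chart_at o) q) (1%g : G)) (domx 1%g) dx.
rewrite tchange_id ?mul1mx ?mul1g // in h.
have := has_jac_is_derive v h.
by rewrite -/(rtrans _).
Qed.

Lemma rframe_diff : differentiable rframe ko.
Proof.
apply: differentiable_rows => v.
have [A Ax sA] := mulc1_smooth o.
have fc : fin_coords ('rV[R]_n * 'rV[R]_n)%type by apply: fin_coords_pair; exact: fin_coords_rV.
have := differentiable_slice (smooth_differentiable fc (smooth_derive (v, 0) sA) Ax).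
apply: near_eq_differentiable.
by have := cimg_nbhs (cimg_chart (domx o)); apply: filterS => q /(rframe_derive v)[].
Qed.

Lemma mulc1_C2 : C2 (mulc1 o) (ko, ko).
Proof.
apply: smooth_C2; last exact: mulc1_smooth.
by apply: fin_coords_pair; exact: fin_coords_rV.
Qed.

(** Both sides are mixed second derivatives of the group law at the identity,
    taken in the two possible orders. *)
Lemma derive_rframe (u v : 'rV[R]_n) :
  'D_u (fun q => v *m rframe q) ko = 'D_v (fun q => u *m lframe o q) ko.
Proof.
have [_ d2 sym] := mulc1_C2.
have E1 : is_derive ko u (fun q => v *m rframe q) ('D_(0, u) ('D_(v, 0) (mulc1 o)) (ko, ko)).
  have := (derive_slice _ _ _ _ _).1 (diff_is_derive (0, u) (d2 (v, 0))).
  apply: near_eq_is_derive.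
  by have := cimg_nbhs (cimg_chart (domx o)); apply: filterS => q /(rframe_derive v)[].
have E2 : is_derive ko v (fun q => u *m lframe o q) ('D_(v, 0) ('D_(0, u) (mulc1 o)) (ko, ko)).
  have := (derive_slicel _ _ _ _ _).1 (diff_is_derive (v, 0) (d2 (0, u))).
  apply: near_eq_is_derive.
  by have := cimg_nbhs (cimg_chart (domx o)); apply: filterS => q /(lframe_derive u)[].
case: E1 => _ e1; case: E2 => _ e2.
exact: (etrans e1 (etrans (sym _ _) (esym e2))).
Qed.

Lemma lframe_o : lframe o ko = 1%:M.
Proof. by rewrite lframe1 ltrans1. Qed.

(** The derivative of Ad(h^-1) at the identity is the bracket. Indeed Ad(h^-1)
    is the quotient of the right frame by the left frame, and [derive_rframe]
    expresses the derivative of the former by that of the latter. *)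
Lemma conjt_derive (k : R -> G) t w : k t = 1%g -> vel k t w ->
  exists2 dA, is_derive t 1 (fun s => conjt (k s)) dA &
    forall v, v *m dA = lie_bracket G v w.
Proof.
move=> kt vk; pose q := chart_at o \o k.
have qt : q t = ko by rewrite /q /= kt.
have dq : is_derive t 1 q w by have := vk.2; rewrite kt.
have dP : is_derive t 1 (lframe o \o q) ('d (lframe o) ko w).
  by rewrite -qt; apply: is_derive_chain => //; rewrite qt; exact: lframe_diff.
have dQ : is_derive t 1 (rframe \o q) ('d rframe ko w).
  by rewrite -qt; apply: is_derive_chain => //; rewrite qt; exact: rframe_diff.
have Pt : (lframe o \o q) t = 1%:M by rewrite /= -lframe_o -qt.
have Qt : (rframe \o q) t = 1%:M by rewrite /= qt rframeE cmapK_at // conjt1 lframe_o mul1mx.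
have uP : (lframe o \o q) t \in unitmx by rewrite Pt unitmx1.
have dI := is_derive_invmx dP uP.
have D := is_derive_mulmx dQ dI.
pose a : 'M[R]_n := 'd rframe ko w; pose b : 'M[R]_n := 'd (lframe o) ko w.
have Dv (X Y : 'M[R]_n) : X = 1%:M -> Y = 1%:M ->
    a *m invmx X + Y *m - (invmx X *m b *m invmx X) = a - b.
  by move=> -> ->; rewrite invmx1 !mulmx1 !mul1mx.
have {}D := is_derive_eq D (Dv _ _ Pt Qt).
exists (a - b).
  apply: near_eq_is_derive D.
  have c1 : \forall s \near t, cdom (chart_at o) (k s).
    by apply: vk.1; rewrite kt; exact: cdom_nbhs.
  have cP : {for t, continuous (lframe o \o q)}.
    by apply: differentiable_continuous; apply/derivable1_diffP; case: dP.
  have c2 : \forall s \near t, (lframe o \o q) s \in unitmx by exact: cP (unitmx_near uP).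
  apply: filterS2 c1 c2 => s ks us.
  have e := rframeE (q s); rewrite (cmapK_at ks) in e.
  exact: (etrans (congr1 (mulmxr _) e) (mulmxK us _)).
move=> v; rewrite mulmxBr.
have ea : v *m a = 'D_w (fun q => v *m rframe q) ko.
  have [_ e] := derive_mulmxl v (diff_is_derive w rframe_diff).
  by rewrite (deriveE w rframe_diff) in e; exact: esym e.
have eb := derive_lframe G w v.
exact: (etrans (congr2 (fun x y => x - y) (etrans ea (derive_rframe w v)) (esym eb))
  (esym (lie_bracketE G v w))).
Qed.

End Conjugation.

Section TwoStep.
Context {R : realType} {n : nat} (G : lieGroupType R n).
Hypothesis G2 : two_step_nilpotent G.

(** In a two-step nilpotent group Ad(h^-1) - 1 maps the Lie algebra to the
    tangent space of the centre and is additive in [h]: it is the logarithm of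
    the adjoint action. *)
Definition nconj (h : G) : 'M[R]_n := conjt h - 1%:M.

(** Makes the identities satisfied by [nconj] consequences of the centrality
    of commutators. *)
Lemma vel_comm h (k : R -> G) t u : k t = 1%g -> vel k t u ->
  vel (fun s => [~ k s, h])%g t (u *m nconj h).
Proof.
move=> kt vk; have v1 := vel_inv1 kt vk; have v2 := vel_conj h kt vk.
have := vel_mul1 _ _ v1 v2; rewrite kt invg1 conj1g => /(_ erefl erefl).
by rewrite addrC mulmxBr mulmx1.
Qed.

(** Conjugation by [k] fixes every commutator, hence fixes the velocities of
    curves of commutators. *)
Lemma nconj_conjt (h k : G) : nconj h *m conjt k = nconj h.
Proof.
apply: mulmx_ext => u; have [c [c0 vc]] := vel_exists (1%g : G) u.
have v1 := vel_comm h c0 vc.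
have h1 : [~ c 0, h]%g = 1%g by rewrite c0 comm1g.
have v2 := vel_conj k h1 v1.
have E : (fun s => [~ c s, h] ^ k)%g = (fun s => [~ c s, h])%g.
  apply/funext => s; apply/conjg_fixP/commgP; exact: G2.
by rewrite E in v2; rewrite mulmxA; exact: vel_unique v2 v1.
Qed.

(** Ad is multiplicative, and by [nconj_conjt] the product of the two
    logarithms vanishes. *)
Lemma nconjM (h k : G) : nconj (h * k)%g = nconj h + nconj k.
Proof.
have := nconj_conjt h k; rewrite /nconj conjtM mulmxBl mul1mx => /eqP.
rewrite subr_eq => /eqP ->.
by rewrite -addrA -addrA; congr (_ + _); rewrite addrC addrA.
Qed.

Lemma nconj_derive (k : R -> G) t w : k t = 1%g -> vel k t w ->
  is_derive t 1 (fun s => nconj (k s)) (adr G w).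
Proof.
move=> kt vk; have [dA hA EA] := conjt_derive kt vk.
have -> : adr G w = dA - 0.
  by rewrite subr0; apply: mulmx_ext => v; rewrite EA bracketE.
exact: (is_deriveB hA (is_derive_cst (1%:M : 'M[R]_n) _ _)).
Qed.

(** Conjugation by a commutator is trivial, so [nconj] vanishes along a curve
    of commutators and so does its derivative. *)
Lemma bracket_nconj v u (h : G) : lie_bracket G v (u *m nconj h) = 0.
Proof.
have [c [c0 vc]] := vel_exists (1%g : G) u.
have h1 : [~ c 0, h]%g = 1%g by rewrite c0 comm1g.
have [_ D] := nconj_derive h1 (vel_comm h c0 vc).
rewrite bracketE -D.
have -> : (fun s => nconj [~ c s, h]%g) = cst 0.
  apply/funext => s; rewrite /nconj /=; apply/eqP; rewrite subr_eq0; apply/eqP.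
  rewrite -(conjt1 G) /conjt; apply/esym; congr (tmap _ _); apply/funext => x.
  rewrite conjg1; apply/esym/conjg_fixP/commgP/commute_sym; exact: G2.
by rewrite derive_cst mulmx0.
Qed.

(** A bracket is the derivative of a curve of rows [u *m nconj h], on which
    all brackets vanish. *)
Lemma bracket_bracket v u w : lie_bracket G v (lie_bracket G u w) = 0.
Proof.
have [c [c0 vc]] := vel_exists (1%g : G) w.
have D := nconj_derive c0 vc.
have D1 := derive_mulmxl u D.
have e1 : u *m adr G w = lie_bracket G u w by rewrite bracketE.
rewrite e1 in D1.
have key (x : 'rV[R]_n) : lie_bracket G x v = x *m adr G v by rewrite bracketE.
have D2 : is_derive (0 : R) 1 (fun s => (u *m nconj (c s)) *m adr G v) (lie_bracket G u w *m adr G v).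
  exact: derive_mulmxr D1.
rewrite bracketC key; case: D2 => _ <-.
have -> : (fun s => (u *m nconj (c s)) *m adr G v) = cst 0.
  by apply/funext => s /=; rewrite -key bracketC bracket_nconj oppr0.
by rewrite derive_cst oppr0.
Qed.

End TwoStep.

(** * Left-invariant frames on the group and on its quotient *)

Section Slices.
Context {R : realType}.

Lemma C2_slice m k l (f : 'rV[R]_m * 'rV[R]_k -> 'rV[R]_l) x y :
  C2 f (x, y) -> C2 (fun z => f (x, z)) y.
Proof.
move=> [d1 d2 sym].
have cs : {for y, continuous (fun z : 'rV[R]_k => (x, z))}.
  exact: differentiable_continuous.
have d1' : \forall z \near y, differentiable f (x, z) by exact: cs d1.
have E v : \forall z \near y, 'D_v (fun z => f (x, z)) z = 'D_(0, v) f (x, z).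
  apply: filterS d1' => z dz.
  by have [] := (derive_slice _ _ _ _ _).1 (diff_is_derive (0, v) dz).
have E' v : \forall z \near y, 'D_(0, v) f (x, z) = 'D_v (fun z => f (x, z)) z.
  by apply: filterS (E v) => z ->.
split.
- by apply: filterS d1' => z /differentiable_slice.
- move=> v; apply: near_eq_differentiable (E' v) _.
  exact: differentiable_slice (d2 (0, v)).
- move=> u v.
  have K u' v' : 'D_v' ('D_u' (fun z => f (x, z))) y = 'D_(0, v') ('D_(0, u') f) (x, y).
    apply: (etrans (near_eq_derive _ (E u'))).
    by have [] := (derive_slice _ _ _ _ _).1 (diff_is_derive (0, v') (d2 (0, u'))).
  exact: (etrans (K u v) (etrans (sym _ _) (esym (K v u)))).
Qed.

End Slices.

(** Inserts a change of coordinates and its inverse inside a product. *)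
Lemma mulmx_insert (F : fieldType) m n (A B : 'M[F]_m) (C : 'M[F]_(m, n)) (T U : 'M[F]_m) :
  T *m U = 1%:M -> A *m B *m C = A *m T *m (U *m B *m C).
Proof. by move=> TU; rewrite !mulmxA -(mulmxA A T U) TU mulmx1. Qed.

Lemma differentiable_mulmx (R : realType) (V : normedModType R) l m n
    (A : V -> 'M[R]_(l, m)) (P : V -> 'M[R]_(m, n)) x :
  differentiable A x -> differentiable P x -> differentiable (fun y => A y *m P y) x.
Proof.
move=> DA D; apply: diff_mxP => i j.
have -> : (fun y => (A y *m P y) i j) = fun y => \sum_k A y i k * P y k j.
  by apply/funext => y; rewrite mxE.
apply: differentiable_big_sum => k.
apply: (@differentiableM _ _ (fun y => A y i k) (fun y => P y k j)).
  apply: (@differentiable_comp _ _ _ _ A (fun M : 'M[R]_(l, m) => M i k)) => //.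
  exact: differentiable_coord.
apply: (@differentiable_comp _ _ _ _ P (fun M : 'M[R]_(m, n) => M k j)) => //.
exact: differentiable_coord.
Qed.

Lemma differentiable_mulmxl (R : realType) (V : normedModType R) l m n
    (w : 'M[R]_(l, m)) (P : V -> 'M[R]_(m, n)) x :
  differentiable P x -> differentiable (fun y => w *m P y) x.
Proof. by move=> D; apply: differentiable_mulmx => //; exact: differentiable_cst. Qed.

Section LeftFrames.
Context {R : realType} {n : nat} (G : lieGroupType R n).
Let domx (x : G) := @chart_at_dom R n G x.
Let o : G := 1%g.
Let ko := chart_at o o.

(** The left translation by [a] relates each left-invariant field to itself,
    so the bracket at [a] is the translate of the bracket at the identity. *)
Lemma lframe_bracket (a : G) (u v : 'rV[R]_n) :
  let q := chart_at a a in
  'D_(u *m lframe a q) (fun q => v *m lframe a q) q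
  - 'D_(v *m lframe a q) (fun q => u *m lframe a q) q
  = lie_bracket G u v *m ltrans a.
Proof.
(* The left translation by [a], in the charts at the identity and at [a]. *)
move=> q0; pose f l := mulc1 a (q0, l).
have c2 : C2 f ko.
  apply: C2_slice; apply: smooth_C2; last exact: mulc1_smooth.
  by apply: fin_coords_pair; exact: fin_coords_rV.
have fE : f = chart_at a \o (fun k => a * k)%g \o cinv (chart_at o).
  by apply/funext => l; rewrite /f /mulc1 /q0 /= cmapK_at.
have fo : f ko = q0 by rewrite fE /= cmapK_at // mulg1.
have rel : \forall l \near ko, lframe a (f l) = lframe o l *m 'J f l.
  have c1 := cimg_nbhs (cimg_chart (domx o)).
  have c2' : \forall l \near ko, cdom (chart_at a) (a * cinv (chart_at o) l)%g.
    apply: (cinv_near (P := fun k => cdom (chart_at a) (a * k)%g) (domx o)).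
    by apply: (mdiff_lmul a o).1; rewrite mulg1; exact: cdom_nbhs.
  apply: filterS2 c1 c2' => l hl; set k := cinv _ l => dk.
  have [el dl] := cinvK_at hl.
  have h := has_jac_charts (mdiff_lmul a k) dl dk.
  rewrite el -fE in h; have [_ e] := h.
  have fl : f l = chart_at a (a * k)%g by rewrite fE.
  have eq1 : lframe a (f l) = ltrans (a * k)%g *m tchange (a * k)%g (a * k)%g a.
    by have := lframeE a (f l); rewrite {2 3 4}fl cmapK_at.
  have eq2 : ltrans (a * k)%g = ltrans k *m tmap (fun k => a * k)%g k.
    by have e2 := tmap_lmul_comp k a (1%g : G); rewrite (mulg1 k) in e2; exact: esym e2.
  rewrite eq1 eq2.
  have eq3 := lframeE o l; rewrite -/k in eq3.
  refine (etrans _ (congr2 mulmx (esym eq3) (esym e))).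
  apply: mulmx_insert.
  exact: (etrans (tchange_comp (domx k) dl (domx k)) (tchange_id (domx k))).
have rl (w : 'rV[R]_n) : \forall l \near ko, w *m lframe a (f l) = (w *m lframe o l) *m 'J f l.
  apply: filterS rel => l e; exact: (etrans (congr1 (mulmx w) e) (mulmxA _ _ _)).
have dl (x : G) (w : 'rV[R]_n) := differentiable_mulmxl w (lframe_diff x).
have := @bracket_related R n n f ko (fun l => u *m lframe o l) (fun l => v *m lframe o l)
  (fun q => u *m lframe a q) (fun q => v *m lframe a q) c2 (rl u) (rl v) (dl o u) (dl o v).
rewrite fo => /(_ (dl a u) (dl a v)) ->.
have -> : 'J f ko = ltrans a.
  have e := nbhs_singleton rel; rewrite fo lframe1 lframe_o mul1mx in e.
  exact: esym e.
by rewrite lframe_o !mulmx1 lie_bracketE.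
Qed.

End LeftFrames.

Lemma near_comp (T U : topologicalType) (f : T -> U) (x : T) (P : set U) :
  {for x, continuous f} -> nbhs (f x) P -> \forall y \near x, P (f y).
Proof. by move=> cf; exact: cf. Qed.

Section QuotientFrames.
Context {R : realType} {n : nat} (G : lieGroupType R n) (Gam : set G)
  (M : manifoldType R n) (p : G -> M).
Hypothesis quot : left_quotient Gam p.
Let domG (x : G) := @chart_at_dom R n G x.
Let domM (x : M) := @chart_at_dom R n M x.
Let o : G := 1%g.

Lemma quot_smooth (a : G) : smooth_at p a.
Proof. by have [/(_ a)[U [F' [_ Ua _ _ [h _]]]] _ _] := quot; exact: h. Qed.

Lemma quot_mdiff (a : G) : mdiff p a.
Proof. exact/smooth_at_mdiff/quot_smooth. Qed.

(** The projection is a covering: it has local sections, through which objects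
    on the quotient are compared with objects on the group. *)
Lemma quot_inverse (a : G) : exists (U : set G) (s : M -> G),
  [/\ open U, U a, open (p @` U), {in U, cancel p s} & forall z, U z -> mdiff s (p z)].
Proof.
have [/(_ a)[U [s [oU Ua oV K [_ h]]]] _ _] := quot.
exists U, s; split => // z Uz; apply/smooth_at_mdiff/h; by exists z.
Qed.

(** An arbitrary section of the projection; the constructions that use it
    depend only on the orbit ([quot_lmul]). *)
Definition lift (x : M) : G := sval (cid (let: And3 _ h _ := quot in h x)).

Lemma liftK x : p (lift x) = x.
Proof. by rewrite /lift; case: cid. Qed.

(** The left-invariant fields descend to the quotient; here are their values
    at [x], in the chart at [x]. *)
Definition frame (x : M) : 'M[R]_n := tmap (fun k => p (lift x * k)%g) o.

Lemma quot_lmul (a b k : G) : p a = p b -> p (a * k)%g = p (b * k)%g.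
Proof.
have [_ _ h] := quot; move=> /h[c Gc ->]; apply/h; exists c => //; by rewrite mulgA.
Qed.

Lemma frame_lift (a : G) : frame (p a) = tmap (fun k => p (a * k)%g) o.
Proof.
by congr (tmap _ _); apply/funext => k; apply: quot_lmul; rewrite liftK.
Qed.

Lemma frame_ltrans (a : G) : frame (p a) = ltrans a *m tmap p a.
Proof.
have h := (mdiff_comp (mdiff_lmul a o) (quot_mdiff (a * o)%g)).2.
by rewrite (mulg1 a) in h; rewrite frame_lift; exact: h.
Qed.

Lemma tmap_quot_inverse (a : G) (U : set G) (s : M -> G) :
  open U -> U a -> {in U, cancel p s} -> mdiff s (p a) -> tmap p a *m tmap s (p a) = 1%:M.
Proof.
move=> oU Ua K ds; have sa : s (p a) = a by apply: K; rewrite inE.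
have [_ <-] := mdiff_comp (quot_mdiff a) ds.
rewrite -(mdiff_id a).2; apply: (mdiff_near _ (mdiff_id a).1).2.
have : \forall x \near a, U x by exact: open_nbhs_nbhs.
by apply: filterS => x Ux /=; rewrite K // inE.
Qed.

Lemma tmap_quot_unit (a : G) : tmap p a \in unitmx.
Proof.
have [U [s [oU Ua _ K /(_ a Ua) ds]]] := quot_inverse a.
by have /mulmx1_unit[h _] := tmap_quot_inverse oU Ua K ds; exact: h.
Qed.

Lemma frame_unit x : frame x \in unitmx.
Proof.
rewrite -(liftK x) frame_ltrans unitmx_mul; apply/andP; split.
  exact: ltrans_unit.
exact: tmap_quot_unit.
Qed.

(** The frame fields of the quotient in the chart at [y]. *)
Definition qframe (y : M) (q : 'rV[R]_n) : 'M[R]_n :=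
  frame (cinv (chart_at y) q) *m tchange (cinv (chart_at y) q) (cinv (chart_at y) q) y.

Lemma qframe_at (x y : M) : cdom (chart_at y) x ->
  qframe y (chart_at y x) = frame x *m tchange x x y.
Proof. by move=> d; rewrite /qframe cmapK_at. Qed.

Lemma qframe_self (x : M) : qframe x (chart_at x x) = frame x.
Proof. by rewrite (qframe_at (domM x)) (tchange_id (domM x)) mulmx1. Qed.

Let fchart (a : G) := chart_at (p a) \o p \o cinv (chart_at a).

Lemma qframe_related (a : G) : \forall q \near chart_at a a,
  qframe (p a) (fchart a q) = lframe a q *m 'J (fchart a) q.
Proof.
have c1 := cimg_nbhs (cimg_chart (domG a)).
have c2 : \forall l \near chart_at a a, cdom (chart_at (p a)) (p (cinv (chart_at a) l)).
  apply: (cinv_near (P := fun k => cdom (chart_at (p a)) (p k)) (domG a)).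
  by apply: (quot_mdiff a).1; exact: cdom_nbhs (domM _).
apply: filterS2 c1 c2 => l hl; set k := cinv _ l => dk.
have [el dl] := cinvK_at hl.
have h := has_jac_charts (quot_mdiff k) dl dk; rewrite el in h; have [_ e] := h.
refine (etrans _ (congr2 mulmx (esym (lframeE a l)) (esym e))).
have e1 : qframe (p a) (fchart a l) = frame (p k) *m tchange (p k) (p k) (p a).
  exact: qframe_at dk.
apply: (etrans e1); rewrite frame_ltrans; apply: mulmx_insert.
exact: (etrans (tchange_comp (domG k) dl (domG k)) (tchange_id (domG k))).
Qed.

Lemma fchart_C2 (a : G) : C2 (fchart a) (chart_at a a).
Proof. by apply: smooth_C2; [exact: fin_coords_rV|exact: (quot_smooth a).2]. Qed.

(** Near [p a], a local section expresses the frame of the quotient as the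
    left frame of the group multiplied by the Jacobian of the projection. *)
Lemma qframe_diff (y : M) : differentiable (qframe y) (chart_at y y).
Proof.
rewrite -(liftK y); set a := lift y.
have [U [s [oU Ua oV K ds]]] := quot_inverse a.
have sa : s (p a) = a by apply: K; rewrite inE.
pose psi := chart_at (s (p a)) \o s \o cinv (chart_at (p a)).
have dpsi : differentiable psi (chart_at (p a) (p a)) := (ds a Ua).2.
have psi0 : psi (chart_at (p a) (p a)) = chart_at a a.
  by rewrite /psi /= (cmapK_at (domM _)) sa.
have dL : differentiable (lframe a) (psi (chart_at (p a) (p a))).
  by rewrite psi0; exact: lframe_diff.
have dJ : differentiable (fun q => 'J (fchart a) q) (psi (chart_at (p a) (p a))).
  rewrite psi0; apply: differentiable_rows => v.
  have [d1 d2 _] := fchart_C2 a.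
  apply: near_eq_differentiable (d2 v); apply: filterS d1 => q dq.
  exact: deriveEjacobian.
have D : differentiable (fun q => lframe a (psi q) *m 'J (fchart a) (psi q)) (chart_at (p a) (p a)).
  apply: differentiable_mulmx.
    exact: (differentiable_comp dpsi dL).
  exact: (differentiable_comp dpsi dJ).
apply: near_eq_differentiable D.
have c1 : \forall q \near chart_at (p a) (p a), cimg (p a) q.
  exact: cimg_nbhs (cimg_chart (domM _)).
have c2 : \forall q \near chart_at (p a) (p a), qframe (p a) (fchart a (psi q)) =
    lframe a (psi q) *m 'J (fchart a) (psi q).
  have cp : {for chart_at (p a) (p a), continuous psi} := differentiable_continuous dpsi.
  pose P l := qframe (p a) (fchart a l) = lframe a l *m 'J (fchart a) l.
  have h : nbhs (psi (chart_at (p a) (p a))) P by rewrite psi0; exact: qframe_related.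
  exact: (near_comp cp h).
have c3 : \forall q \near chart_at (p a) (p a), (p @` U) (cinv (chart_at (p a)) q).
  apply: (cinv_near (domM _)); apply: open_nbhs_nbhs; split => //; by exists a.
have c4 : \forall q \near chart_at (p a) (p a), cdom (chart_at a) (s (cinv (chart_at (p a)) q)).
  apply: (cinv_near (P := fun x => cdom (chart_at a) (s x)) (domM _)).
  by apply: (ds a Ua).1; rewrite sa; exact: cdom_nbhs (domG _).
apply: filterS2 (filterI c1 c2) (filterI c3 c4) => q [hq e] [[k Uk ek] ds'].
apply: (etrans (esym e)); congr (qframe _ _).
set x := cinv (chart_at (p a)) q in ek ds'.
have e1 : psi q = chart_at a (s x) by rewrite /psi /= sa.
have kU : k \in U by rewrite inE.
have e2 : p (s x) = x by rewrite -ek (K k kU).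
have e3 : fchart a (chart_at a (s x)) = chart_at (p a) (p (s x)).
  exact: (congr1 (fun z => chart_at (p a) (p z)) (cmapK_at ds')).
rewrite e1; apply: (etrans e3); rewrite e2; exact: (cinvK_at hq).1.
Qed.

(** The projection relates the two frames, so the structure functions of the
    frame of the quotient are the structure constants of the Lie algebra. *)
Lemma qframe_bracket (y : M) (u v : 'rV[R]_n) :
  let q := chart_at y y in
  'D_(u *m frame y) (fun q => v *m qframe y q) q
  - 'D_(v *m frame y) (fun q => u *m qframe y q) q
  = lie_bracket G u v *m frame y.
Proof.
rewrite -(liftK y); set a := lift y => q0.
have f0 : fchart a (chart_at a a) = q0 by rewrite /fchart /= (cmapK_at (domG a)).
have rel (w : 'rV[R]_n) : \forall q \near chart_at a a,
    w *m qframe (p a) (fchart a q) = (w *m lframe a q) *m 'J (fchart a) q.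
  apply: filterS (qframe_related a) => l e.
  exact: (etrans (congr1 (mulmx w) e) (mulmxA _ _ _)).
have dl (w : 'rV[R]_n) := differentiable_mulmxl w (lframe_diff a).
have dq (w : 'rV[R]_n) : differentiable (fun q => w *m qframe (p a) q) (fchart a (chart_at a a)).
  by rewrite f0; exact: differentiable_mulmxl (qframe_diff _).
have B := @bracket_related R n n (fchart a) (chart_at a a) (fun l => u *m lframe a l)
  (fun l => v *m lframe a l) (fun q => u *m qframe (p a) q) (fun q => v *m qframe (p a) q)
  (fchart_C2 a) (rel u) (rel v) (dl u) (dl v) (dq u) (dq v).
rewrite f0 qframe_self in B; apply: (etrans B); rewrite lframe_bracket.
by rewrite frame_ltrans mulmxA.
Qed.

End QuotientFrames.

(** * Momenta and the equations of motion *)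

Section DeriveMisc.
Context {R : realType}.

Lemma is_derive_cvg (V W : normedModType R) (f : V -> W) x v d :
  is_derive x v f d <->
  (fun h => h^-1 *: ((f \o shift x) (h *: v) - f x)) @ 0^' --> d.
Proof.
split=> [[h <-]|h]; first exact: h.
split; [exact: cvgP h|exact: cvg_lim h].
Qed.

Lemma is_derive_fst (U V W : normedModType R) (f : U -> V * W) x u d :
  is_derive x u f d -> is_derive x u (fun y => (f y).1) d.1.
Proof.
move=> /is_derive_cvg h; apply/is_derive_cvg.
exact: (cvg_comp _ _ h (@cvg_fst _ _ (nbhs d.1) (nbhs d.2) _)).
Qed.

Lemma is_derive_snd (U V W : normedModType R) (f : U -> V * W) x u d :
  is_derive x u f d -> is_derive x u (fun y => (f y).2) d.2.
Proof.
move=> /is_derive_cvg h; apply/is_derive_cvg.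
exact: (cvg_comp _ _ h (@cvg_snd _ _ (nbhs d.1) (nbhs d.2) _)).
Qed.

Lemma is_derive_trmx (V : normedModType R) m n (f : V -> 'M[R]_(m, n)) x v d :
  is_derive x v f d -> is_derive x v (fun y => (f y)^T) d^T.
Proof.
move=> /is_derive_mxP h; apply/is_derive_mxP => i j; rewrite mxE.
by have := h j i; congr is_derive; apply/funext => y; rewrite mxE.
Qed.

(** The factor [2^-1] is that of the kinetic energy; the derivative is then
    the pairing of the velocity of the point with the increment of the
    momentum. *)
Lemma is_derive_quad (V : normedModType R) n (Q : 'M[R]_n) (f : V -> 'cV[R]_n) x v d :
  Q^T = Q -> is_derive x v f d ->
  is_derive x v (fun y => 2^-1 * ((f y)^T *m Q *m f y) 0 0) (((f x)^T *m Q *m d) 0 0).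
Proof.
move=> sQ df.
have h := is_derive_mulmx (derive_mulmxr Q (is_derive_trmx df)) df.
have e : (d^T *m Q *m f x) 0 0 = ((f x)^T *m Q *m d) 0 0.
  have -> : d^T *m Q *m f x = ((f x)^T *m Q *m d)^T by rewrite !trmx_mul trmxK sQ mulmxA.
  by rewrite mxE.
move/is_derive_mxP : h => /(_ 0 0) h.
have := is_deriveZ 2^-1 h; congr is_derive.
by rewrite mxE e /GRing.scale /=; field.
Qed.

End DeriveMisc.

Section CotangentTopology.
Context {R : realType} {n : nat} (M : manifoldType R n).

Lemma cotangent_openE (W : set (cotangent M)) : open W = cotangent_open W.
Proof. by []. Qed.

(** Trajectories are continuous for a topology defined through canonical
    coordinates, which include the coordinates of the base point. *)
Lemma base_continuous : continuous (@base R n M).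
Proof.
apply/continuousP => A oA; rewrite cotangent_openE => y.
rewrite openE => -[q c] [/= hq Aq]; rewrite /interior.
have h1 : \forall q' \near q, cimg y q' /\ A (cinv (chart_at y) q').
  apply: filterI; first exact: cimg_nbhs.
  by apply: (near_comp (cinv_cvg hq)); exact: open_nbhs_nbhs.
exact: (@near_comp _ _ (@fst 'rV[R]_n 'cV[R]_n) (q, c) _ (@cvg_fst _ _ (nbhs q) (nbhs c) _) h1).
Qed.

End CotangentTopology.

Lemma mulmx_cancel_mid (F : fieldType) m n (A : 'M[F]_m) (C : 'M[F]_(m, n)) (T U : 'M[F]_m) :
  T *m U = 1%:M -> A *m T *m (U *m C) = A *m C.
Proof. by move=> TU; rewrite -mulmxA (mulmxA T) TU mul1mx. Qed.

Section MagneticData.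
Context {R : realType} {n : nat} (G : lieGroupType R n) (Gam : set G)
  (M : manifoldType R n) (p : G -> M).
Hypothesis quot : left_quotient Gam p.
Variables (g sigma : M -> 'M[R]_n).
Hypothesis g_metric : riemannian_metric g.
Hypothesis g_inv : left_invariant (pullback p g).
Hypothesis s_mag : magnetic_field sigma.
Hypothesis s_inv : left_invariant (pullback p sigma).
Let domM (x : M) := @chart_at_dom R n M x.
Let o : G := 1%g.
Local Notation frame := (frame quot).
Local Notation qframe := (qframe quot).

Definition metric0 : 'M[R]_n := pullback p g o.
Definition magnetic0 : 'M[R]_n := pullback p sigma o.

(** A left-invariant tensor has constant coefficients in the frame of
    left-invariant fields. *)
Lemma frame_invariant (b : M -> 'M[R]_n) x : left_invariant (pullback p b) ->
  frame x *m b x *m (frame x)^T = pullback p b o.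
Proof.
move=> inv; rewrite -(liftK quot x); set a := lift quot x.
rewrite frame_ltrans -(inv a o) /pullback /= (mulg1 a) -/(ltrans a).
by rewrite trmx_mul !mulmxA.
Qed.

Lemma frame_metric x : frame x *m g x *m (frame x)^T = metric0.
Proof. exact: frame_invariant. Qed.

Lemma frame_magnetic x : frame x *m sigma x *m (frame x)^T = magnetic0.
Proof. exact: frame_invariant. Qed.

Lemma bil_delta (b : 'M[R]_n) i j : bil b (delta_mx 0 i) (delta_mx 0 j) = b i j.
Proof. by rewrite /bil trmx_delta -rowE -colE !mxE. Qed.

Lemma bil_frame (b0 b E : 'M[R]_n) u v : E *m b *m E^T = b0 ->
  bil b (u *m E) (v *m E) = bil b0 u v.
Proof. by move=> <-; rewrite /bil trmx_mul !mulmxA. Qed.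

Lemma metric0_sym : metric0^T = metric0.
Proof.
have [_ gs _] := g_metric.
have gT x : (g x)^T = g x by apply/matrixP => i j; rewrite mxE -!bil_delta gs.
by rewrite -(frame_metric (p o)) !trmx_mul trmxK gT mulmxA.
Qed.

Lemma metric0_pos u : u != 0 -> 0 < bil metric0 u u.
Proof.
have [_ _ gp] := g_metric => u0.
rewrite -(bil_frame _ _ (frame_metric (p o))); apply: gp.
apply: contra_neq u0 => e; rewrite -[u](mulmxK (frame_unit quot (p o))) e.
exact: mul0mx.
Qed.

Lemma metric0_unit : metric0 \in unitmx.
Proof.
rewrite -row_free_unit -kermx_eq0; apply: contraT => /rowV0Pn[u /sub_kermxP e u0].
by have := metric0_pos u0; rewrite /bil e mul0mx mxE ltxx.
Qed.

Lemma magnetic0_alt u : bil magnetic0 u u = 0.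
Proof.
have [[_ sa] _] := s_mag.
by rewrite -(bil_frame _ _ (frame_magnetic (p o))) sa.
Qed.

(** The momentum: the coordinates of a covector in the frame dual to the
    left-invariant fields. *)
Definition mom (z : cotangent M) : 'cV[R]_n := frame (base z) *m covec z.

(** The Legendre transform: the coordinates, in the left-invariant frame, of
    the tangent vector dual to the momentum [m]. *)
Definition velocity (m : 'cV[R]_n) : 'rV[R]_n := m^T *m invmx metric0.

Lemma velocityK m : m = metric0 *m (velocity m)^T.
Proof.
rewrite /velocity trmx_mul trmxK trmx_inv metric0_sym mulmxA mulmxV ?mul1mx //.
exact: metric0_unit.
Qed.

(** Twice the kinetic energy, that is, the squared length of a covector as a
    function of its momentum. *)
Definition energy (m : 'cV[R]_n) : R := (m^T *m invmx metric0 *m m) 0 0.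

Lemma energyE m : energy m = bil metric0 (velocity m) (velocity m).
Proof. by rewrite /energy /bil -[in RHS]mulmxA -velocityK. Qed.

Lemma energy_ge0 m : 0 <= energy m.
Proof.
rewrite energyE; have [->|v0] := eqVneq (velocity m) 0; last exact: ltW (metric0_pos v0).
by rewrite /bil !mul0mx mxE.
Qed.

Lemma invmx_congruence (E b b0 : 'M[R]_n) : E *m b *m E^T = b0 ->
  b0 \in unitmx -> invmx b = E^T *m invmx b0 *m E.
Proof.
move=> e u0; have h : E *m (b *m E^T *m invmx b0) = 1%:M by rewrite !mulmxA e mulmxV.
have h' := mulmx1C h; rewrite -!mulmxA in h'.
have [ub _] := mulmx1_unit h'.
by rewrite -[LHS]mulmx1 -h' !mulmxA mulVmx // mul1mx.
Qed.

Lemma energy_mom z : ((covec z)^T *m invmx (g (base z)) *m covec z) 0 0 = energy (mom z).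
Proof.
rewrite /energy /mom; set E := frame _; have uE : E \in unitmx := frame_unit quot _.
have e := frame_metric (base z); rewrite -/E in e.
suff -> : invmx (g (base z)) = E^T *m invmx metric0 *m E by rewrite trmx_mul !mulmxA.
exact: invmx_congruence e metric0_unit.
Qed.

Lemma conorm_energy z : conorm g z = Num.sqrt (energy (mom z)).
Proof. by rewrite /conorm energy_mom. Qed.

Lemma hamiltonian_energy z : hamiltonian g z = 2^-1 * energy (mom z).
Proof. by rewrite /hamiltonian conorm_energy sqr_sqrtr // energy_ge0. Qed.

Lemma mom_of_canonical (y : M) qp : mom (of_canonical y qp) = qframe y qp.1 *m qp.2.
Proof. by rewrite /mom /of_canonical /= mulmxA. Qed.

Lemma invmx_metric0_sym : (invmx metric0)^T = invmx metric0.
Proof. by rewrite trmx_inv metric0_sym. Qed.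

(** In canonical coordinates the momentum is [qframe y q *m p], linear in [p]
    with coefficients depending on [q]; the two kinds of partial derivatives
    of the Hamiltonian follow from [is_derive_quad]. *)
Lemma hamiltonian_derive_p (y : M) q p0 w :
  is_derive (q, p0) (0, w) (hamiltonian g \o of_canonical y)
    ((velocity (qframe y q *m p0) *m (qframe y q *m w)) 0 0).
Proof.
apply/derive_slice.
have h := is_derive_quad invmx_metric0_sym (derive_mulmxl (qframe y q) (is_derive_id p0 w)).
move: h; congr is_derive; apply/funext => z /=.
by rewrite hamiltonian_energy mom_of_canonical.
Qed.

Lemma hamiltonian_derive_q (y : M) q p0 w dQ :
  is_derive q w (qframe y) dQ ->
  is_derive (q, p0) (w, 0) (hamiltonian g \o of_canonical y)
    ((velocity (qframe y q *m p0) *m (dQ *m p0)) 0 0).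
Proof.
move=> hQ; apply/derive_slicel.
have h := is_derive_quad invmx_metric0_sym (derive_mulmxr p0 hQ).
move: h; congr is_derive; apply/funext => z /=.
by rewrite hamiltonian_energy mom_of_canonical.
Qed.

Lemma row_ext (m : nat) (u v : 'rV[R]_m) :
  (forall w : 'cV[R]_m, (u *m w) 0 0 = (v *m w) 0 0) -> u = v.
Proof.
move=> h; apply/rowP => j; have := h (delta_mx j 0).
by rewrite -!colE !mxE.
Qed.

Lemma tensor_self (b : M -> 'M[R]_n) (y : M) : tensor_in_chart b y (chart_at y y) = b y.
Proof.
by rewrite /tensor_in_chart (cmapK_at (domM y)) (tchange_id (domM y)) trmx1 mulmx1 mul1mx.
Qed.

Section Trajectory.
Variable c : R -> cotangent M.
Hypothesis c_traj : magnetic_trajectory g sigma c.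

Lemma base_traj_continuous : continuous (fun s => base (c s)).
Proof.
by move=> s; apply: (@continuous_comp _ _ _ c (@base R n M)); [exact: c_traj.1|exact: base_continuous].
Qed.

(** Hamilton's equations in the left-invariant frame. Testing the symplectic
    form against vertical vectors gives the velocity of the base point.
    Testing it against horizontal vectors gives the derivative of the
    covector; the derivative of the frame along the curve must be added to
    obtain that of the momentum, and the two derivatives of the frame combine
    into a Lie bracket by [qframe_bracket]. *)
Lemma trajectory_eqs t :
  vel (fun s => base (c s)) t (velocity (mom (c t)) *m frame (base (c t))) /\
  exists2 dm, is_derive t 1 (fun s => mom (c s)) dm &
    forall e, (e *m dm) 0 0 =
      (lie_bracket G (velocity (mom (c t))) e *m mom (c t)) 0 0
      + bil magnetic0 (velocity (mom (c t))) e.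
Proof.
set v := velocity _; pose y := base (c t); pose q0 := chart_at y y.
have dy : cdom (chart_at y) (base (c t)) by exact: domM.
have [dc E] := c_traj.2 t y dy.
set V := 'D_1 _ t in E.
have hV : is_derive t 1 (to_canonical y \o c) V by exact: derivableP.
have tc : to_canonical y (c t) = (q0, covec (c t)).
  by rewrite /to_canonical -/y (tchange_id dy) mul1mx.
rewrite tc in E.
have hq := is_derive_fst hV; have hp := is_derive_snd hV.
have mt : qframe y q0 *m covec (c t) = mom (c t) by rewrite qframe_self.
(* The vertical test vectors [(0, w)]. *)
have e1 : V.1 = v *m frame y.
  apply: row_ext => w.
  have [_ d] := hamiltonian_derive_p y q0 (covec (c t)) w.
  have := E (0, w); rewrite d mt /magnetic_symplectic /= mul0mx subr0.
  rewrite /bil trmx0 mulmx0 [X in _ + X]mxE addr0 => ->.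
  by rewrite qframe_self !mulmxA.
have vq : vel (fun s => base (c s)) t (v *m frame y).
  split; first exact: base_traj_continuous.
  by rewrite -e1.
split; first exact: vq.
have dQ := qframe_diff quot y.
pose dQw (w : 'rV[R]_n) : 'M[R]_n := 'D_w (qframe y) q0.
have hQw w : is_derive q0 w (qframe y) (dQw w) by exact: diff_is_derive.
have hQt : is_derive t 1 (fun s => qframe y (chart_at y (base (c s)))) (dQw (v *m frame y)).
  have D := is_derive_chain hq dQ; rewrite e1 in D.
  by rewrite /dQw (deriveE _ dQ).
have hm := is_derive_mulmx hQt hp.
exists (dQw (v *m frame y) *m covec (c t) + frame y *m V.2).
  have eB : (to_canonical y (c t)).2 = covec (c t) by rewrite tc.
  have eA : qframe y (chart_at y (base (c t))) = frame y by rewrite qframe_self.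
  have hm' : is_derive t 1 (fun s => qframe y (chart_at y (base (c s))) *m (to_canonical y (c s)).2)
    (dQw (v *m frame y) *m covec (c t) + frame y *m V.2).
    rewrite -[in X in is_derive _ _ _ X]eB -[in X in _ + X *m _]eA; exact: hm.
  apply: near_eq_is_derive hm'.
  have : \forall s \near t, cdom (chart_at y) (base (c s)).
    have ct : {for t, continuous (fun s => base (c s))} := @base_traj_continuous t.
    exact: (near_comp (P := cdom (chart_at y)) ct (cdom_nbhs dy)).
  apply: filterS => s ds; rewrite (qframe_at quot ds) /to_canonical /mom /=.
  apply: mulmx_cancel_mid.
  exact: (etrans (tchange_comp (domM _) ds (domM _)) (tchange_id (domM _))).
(* The horizontal test vectors [(w, 0)]. *)
move=> e; pose w := e *m frame y.
have [_ d] := hamiltonian_derive_q (covec (c t)) (hQw w).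
have := E (w, 0); rewrite d mt /magnetic_symplectic /= mulmx0 sub0r tensor_self e1.
rewrite (bil_frame _ _ (frame_magnetic y)) => Eq.
have B := qframe_bracket quot y v e.
have D1 (u z : 'rV[R]_n) : 'D_u (fun q => z *m qframe y q) q0 = z *m dQw u.
  by have [_ ->] := derive_mulmxl z (hQw u).
rewrite /= -/q0 !D1 -/w in B.
rewrite mulmxDr [LHS]mxE.
have -> : (e *m (frame y *m V.2)) 0 0 = (w *m V.2) 0 0 by rewrite mulmxA.
have -> : (lie_bracket G v e *m mom (c t)) 0 0 =
   (e *m (dQw (v *m frame y) *m covec (c t))) 0 0 - (v *m (dQw w *m covec (c t))) 0 0.
  by rewrite /mom -/y mulmxA -B mulmxBl !mulmxA [LHS]mxE [X in _ + X]mxE.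
have key (a b s m : R) : - b + s = m -> a + b = a - m + s by move=> <-; ring.
by apply: key; move: Eq; rewrite [X in X + _]mxE.
Qed.

End Trajectory.

End MagneticData.

(** * Norm estimates *)

Section Norms.
Context {R : realType}.

Lemma mx_entry_le m n (A : 'M[R]_(m, n)) i j : `|A i j| <= `|A|.
Proof.
rewrite [leRHS]/Num.norm/= mx_normrE.
exact: (le_bigmax _ (fun k => `|A k.1 k.2|) (i, j)).
Qed.

Lemma mx_norm_le m n (A : 'M[R]_(m, n)) K : 0 <= K ->
  (forall i j, `|A i j| <= K) -> `|A| <= K.
Proof.
move=> K0 h; rewrite [leLHS]/Num.norm/= mx_normrE.
by apply: bigmax_le => // -[i j] _; exact: h.
Qed.

Lemma mx_norm_mul m n k (A : 'M[R]_(m, n)) (B : 'M[R]_(n, k)) :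
  `|A *m B| <= n%:R * `|A| * `|B|.
Proof.
apply: mx_norm_le => [|i j]; first by rewrite !mulr_ge0.
rewrite mxE (le_trans (ler_norm_sum _ _ _)) // -mulrA -[n in n%:R]card_ord.
rewrite -sum1_card natr_sum mulr_suml; apply: ler_sum => l _.
by rewrite mul1r normrM ler_pM ?mx_entry_le.
Qed.

Lemma mx_norm_tr_le m n (A : 'M[R]_(m, n)) : `|A^T| <= `|A|.
Proof. by apply: mx_norm_le => // i j; rewrite mxE; exact: mx_entry_le. Qed.

Lemma mvt_scalar (f df : R -> R) (a b K : R) : a <= b ->
  (forall t, a <= t <= b -> is_derive t 1 f (df t)) ->
  (forall t, a <= t <= b -> `|df t| <= K) -> `|f b - f a| <= K * (b - a).
Proof.
move=> ab D B.
have [||t] := @MVT_segment R f df a b ab.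
- by move=> t; rewrite in_itv /= => /andP[h1 h2]; apply: D; rewrite !ltW.
- apply: derivable_within_continuous => t; rewrite in_itv /= => h.
  by case: (D t h).
rewrite in_itv /= => h ->; rewrite normrM (ger0_norm (x := b - a)) ?subr_ge0 //.
by rewrite ler_wpM2r ?subr_ge0 // B.
Qed.

Lemma mvt_mx m n (f df : R -> 'M[R]_(m, n)) (a b K : R) : a <= b -> 0 <= K ->
  (forall t, a <= t <= b -> is_derive t 1 f (df t)) ->
  (forall t, a <= t <= b -> `|df t| <= K) -> `|f b - f a| <= K * (b - a).
Proof.
move=> ab K0 D B; apply: mx_norm_le => [|i j]; first by rewrite mulr_ge0 ?subr_ge0.
rewrite !mxE; apply: (mvt_scalar (f := fun t => f t i j) (df := fun t => df t i j)) => // t h.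
  by have /is_derive_mxP := D t h; exact.
exact: le_trans (mx_entry_le _ _ _) (B t h).
Qed.

Lemma bil_continuous n (b : 'M[R]_n) : continuous (fun u : 'rV[R]_n => bil b u u).
Proof.
move=> u.
have h : differentiable (fun u : 'rV[R]_n => u *m b *m u^T) u.
  apply: differentiable_mulmx; first apply: differentiable_mulmx => //.
  apply: diff_mxP => i j.
  rewrite (_ : (fun _ => _) = fun y : 'rV[R]_n => y j i); first exact: differentiable_coord.
  by apply/funext => y; rewrite mxE.
apply: (@continuous_comp _ _ _ (fun u : 'rV[R]_n => u *m b *m u^T) (fun M : 'M[R]_1 => M 0 0)).
  exact: differentiable_continuous.
exact: coord_continuous.
Qed.

Lemma bilZ n (b : 'M[R]_n) k u : bil b (k *: u) (k *: u) = k ^+ 2 * bil b u u.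
Proof.
by rewrite /bil linearZ /= -scalemxAr -!scalemxAl scalerA mxE -expr2.
Qed.

(** A positive definite form attains a positive minimum on the unit sphere,
    which is compact. *)
Lemma pos_def_bound n (b : 'M[R]_n) : (forall u, u != 0 -> 0 < bil b u u) ->
  exists2 K, 0 < K & forall u, `|u| ^+ 2 <= K * bil b u u.
Proof.
move=> pos; pose A : set 'rV[R]_n := [set u | `|u| = 1].
have bil0 : bil b 0 0 = 0 by rewrite /bil !mul0mx mxE.
have [/set0P A0|/negP A0] := boolP (A != set0); last first.
  exists 1 => // u; have [->|u0] := eqVneq u 0; first by rewrite normr0 bil0 expr0n mulr0.
  exfalso; apply: A0; apply/set0P; exists (`|u|^-1 *: u).
  by rewrite /A /= normrZ normfV normr_id mulVf // normr_eq0.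
have cA : compact A.
  apply: bounded_closed_compact.
    exists 1; split => // M M1 u /= ->; exact: ltW.
  apply: (@closed_comp _ _ (fun u : 'rV[R]_n => `|u|) [set 1]); last exact: closed_eq.
  by move=> u _; exact: norm_continuous.
have [c] := EVT_min_rV A0 cA (continuous_subspaceT (@bil_continuous n b)).
rewrite inE => /= c1 cmin.
have c0 : c != 0 by rewrite -normr_eq0 c1 oner_eq0.
have mpos := pos c c0.
exists (bil b c c)^-1; first by rewrite invr_gt0.
move=> u; rewrite mulrC ler_pdivlMr //.
have [->|u0] := eqVneq u 0; first by rewrite normr0 bil0 expr0n mul0r.
have un : `|u| != 0 by rewrite normr_eq0.
have : bil b c c <= bil b (`|u|^-1 *: u) (`|u|^-1 *: u).
  by apply: cmin; rewrite inE /A /= normrZ normfV normr_id mulVf.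
by rewrite bilZ exprVn mulrC ler_pdivlMr ?exprn_gt0 ?normr_gt0 // mulrC.
Qed.

(** An inequality that is linear in the energy [F] and in its square root
    bounds the square root. *)
Lemma sqrt_growth (F f0 A : R) : 0 <= f0 -> 0 <= F -> 0 <= A ->
  F <= f0 + A * Num.sqrt F -> Num.sqrt F <= Num.sqrt f0 + A.
Proof.
move=> f00 F0 A0 h; rewrite leNgt; apply/negP => lt.
have s0 := sqrtr_ge0 f0; have sF := sqrtr_ge0 F.
have e1 := sqr_sqrtr F0; have e2 := sqr_sqrtr f00.
move: h; rewrite -{1}e1 -{1}e2; apply/negP; rewrite -ltNge.
have sFpos : 0 < Num.sqrt F by apply: le_lt_trans lt; rewrite addr_ge0.
have sFf : Num.sqrt f0 <= Num.sqrt F by apply: ltW; apply: le_lt_trans lt; rewrite lerDl.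
have h2 : (Num.sqrt f0 + A) * Num.sqrt F < Num.sqrt F ^+ 2 by rewrite expr2 ltr_pM2r.
apply: le_lt_trans h2; rewrite mulrDl lerD2r expr2; exact: ler_wpM2l.
Qed.

End Norms.

(** * Conservation laws and growth of momenta *)

Section Estimates.
Context {R : realType} {n : nat} (G : lieGroupType R n) (Gam : set G)
  (M : manifoldType R n) (p : G -> M).
Hypothesis quot : left_quotient Gam p.
Variables (g sigma : M -> 'M[R]_n).
Hypothesis g_metric : riemannian_metric g.
Hypothesis g_inv : left_invariant (pullback p g).
Hypothesis s_mag : magnetic_field sigma.
Hypothesis s_inv : left_invariant (pullback p sigma).
Hypothesis G2 : two_step_nilpotent G.
Hypothesis s_derived : forall X D : 'rV[R]_n, derived_algebra G D ->
  bil (pullback p sigma (1%g : G)) X D = 0.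
Local Notation mom := (mom quot).
Local Notation velocity := (velocity p g).
Local Notation energy := (energy p g).
Local Notation magnetic0 := (magnetic0 p sigma).
Local Notation metric0 := (metric0 p g).
Local Notation traj c := (magnetic_trajectory g sigma c).

Lemma magnetic0_bracket x u w : bil magnetic0 x (lie_bracket G u w) = 0.
Proof.
apply: s_derived; exists 1%N, (fun=> u), (fun=> w).
by rewrite big_ord1.
Qed.

Lemma bilDl (b : 'M[R]_n) u v w : bil b (u + v) w = bil b u w + bil b v w.
Proof. by rewrite /bil !mulmxDl mxE. Qed.

Lemma pairing_le (u : 'rV[R]_n) (m : 'cV[R]_n) : `|(u *m m) 0 0| <= n%:R * `|u| * `|m|.
Proof. exact: le_trans (mx_entry_le _ _ _) (mx_norm_mul _ _). Qed.

(** In the Euler equation tested against a commutator, the bracket term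
    vanishes by two-step nilpotency and the magnetic term by hypothesis. *)
Lemma mom_bracket_cst c t u w : traj c ->
  (lie_bracket G u w *m mom (c t)) 0 0 = (lie_bracket G u w *m mom (c 0)) 0 0.
Proof.
move=> tc; apply: (is_derive_0_is_cst (f := fun t => (lie_bracket G u w *m mom (c t)) 0 0)) => s.
have [_ [dm hm E]] := trajectory_eqs quot g_metric g_inv s_inv tc s.
have /is_derive_mxP/(_ 0 0) := derive_mulmxl (lie_bracket G u w) hm.
by rewrite E bracket_bracket // mul0mx mxE magnetic0_bracket addr0.
Qed.

(** The Euler equation tested against the velocity itself. *)
Lemma energy_cst c t : traj c -> energy (mom (c t)) = energy (mom (c 0)).
Proof.
move=> tc.
have := @is_derive_0_is_cst R (fun t => 2^-1 * energy (mom (c t))) t 0 _.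
have h (s : R) : is_derive s 1 (fun t => 2^-1 * energy (mom (c t))) 0.
  have [_ [dm hm E]] := trajectory_eqs quot g_metric g_inv s_inv tc s.
  have := is_derive_quad (invmx_metric0_sym quot g_metric g_inv) hm.
  by rewrite (E (velocity (mom (c s)))) bracketvv mul0mx mxE (magnetic0_alt quot s_mag s_inv) addr0.
by move=> /(_ h); apply: mulfI; rewrite invr_eq0.
Qed.

Lemma adr_bound : exists2 B, 0 <= B & forall v, `|adr G v| <= B * `|v|.
Proof.
exists (\sum_(j < n) `|adr G (delta_mx 0 j)|); first exact: sumr_ge0.
move=> v.
have -> : adr G v = \sum_(j < n) v 0 j *: adr G (delta_mx 0 j).
  apply: mulmx_ext => x; rewrite -bracketE {1}(row_sum_delta v) linear_sum /= mulmx_sumr.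
  by apply: eq_bigr => j _; rewrite linearZ /= bracketE scalemxAr.
rewrite (le_trans (ler_norm_sum _ _ _)) // mulr_suml; apply: ler_sum => j _.
by rewrite normrZ mulrC ler_wpM2l // mx_entry_le.
Qed.

Lemma velocity_bound : exists2 K, 0 < K & forall m, `|velocity m| ^+ 2 <= K * energy m.
Proof.
have [K K0 h] := pos_def_bound (metric0_pos quot g_metric g_inv).
by exists K => // m; rewrite (energyE quot g_metric g_inv).
Qed.

Lemma mom_le_velocity m : `|m| <= n%:R * `|metric0| * `|velocity m|.
Proof.
rewrite {1}(velocityK quot g_metric g_inv m) (le_trans (mx_norm_mul _ _)) //.
by rewrite ler_wpM2l ?mulr_ge0 // mx_norm_tr_le.
Qed.

Lemma velocity_le_mom m : `|velocity m| <= n%:R * `|invmx metric0| * `|m|.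
Proof.
rewrite (le_trans (mx_norm_mul _ _)) // -!mulrA ler_wpM2l //.
by rewrite mulrC ler_wpM2l // mx_norm_tr_le.
Qed.

Lemma energy_le m : energy m <= n%:R ^+ 2 * `|invmx metric0| * `|m| ^+ 2.
Proof.
rewrite (le_trans (ler_norm _)) // (le_trans (pairing_le _ _)) //.
rewrite !expr2 -!mulrA ler_wpM2l // !mulrA ler_wpM2r //.
exact: velocity_le_mom.
Qed.

Lemma velocityB m m' : velocity (m - m') = velocity m - velocity m'.
Proof. by rewrite /velocity linearB /= mulmxBl. Qed.

(** Let [d] be the difference of the momenta, [x] its velocity, and [v] the
    velocity of the first trajectory. In the Euler equations of both
    trajectories tested against [x], the magnetic terms cancel by antisymmetry
    and only [(lie_bracket G v x *m d t) 0 0] is left, where [d t] may be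
    replaced by [d 0] because of [mom_bracket_cst]. Since [v] is bounded, the
    derivative of the energy of [d] is at most a constant times [`|d 0|] times
    the square root of this energy. *)
Lemma momentum_growth : exists2 C, 0 < C & forall c c', traj c -> traj c' ->
  energy (mom (c 0)) = 1 -> forall t, 0 <= t ->
  `|mom (c' t) - mom (c t)| <= C * (1 + t) * `|mom (c' 0) - mom (c 0)|.
Proof.
have [B B0 hB] := adr_bound; have [K K0 hK] := velocity_bound.
pose A0 := n%:R ^+ 2 * B * K.
have A00 : 0 <= A0 by rewrite !mulr_ge0 // ?exprn_ge0 // ltW.
pose E0 := n%:R ^+ 2 * `|invmx metric0|.
have E00 : 0 <= E0 by rewrite mulr_ge0 // exprn_ge0.
pose C1 := n%:R * `|metric0| * Num.sqrt K.
have C10 : 0 <= C1 by rewrite !mulr_ge0 // ?sqrtr_ge0.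
exists (1 + C1 * (Num.sqrt E0 + 2 * A0)).
  by rewrite ltr_pwDl // mulr_ge0 // addr_ge0 ?sqrtr_ge0 // mulr_ge0.
move=> c c' tc tc' e1 T T0.
pose d t := mom (c' t) - mom (c t); pose N := `|d 0|.
have vl1 m : `|velocity m| <= Num.sqrt K * Num.sqrt (energy m).
  have := ler_wsqrtr (hK m).
  by rewrite sqrtr_sqr normr_id (sqrtrM _ (ltW K0)).
have D (t : R) : exists2 h', is_derive t 1 (fun t => 2^-1 * energy (d t)) h' &
   `|h'| <= A0 * N * Num.sqrt (energy (d t)).
  have [_ [dm hm Em]] := trajectory_eqs quot g_metric g_inv s_inv tc t.
  have [_ [dm' hm' Em']] := trajectory_eqs quot g_metric g_inv s_inv tc' t.
  have h := is_derive_quad (invmx_metric0_sym quot g_metric g_inv) (is_deriveB hm' hm).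
  eexists; first exact: h.
  set v := velocity (mom (c t)) in Em; set w := velocity (mom (c' t)) in Em'.
  pose x := velocity (d t).
  (* The Euler equations subtract to an expression in [x] alone. *)
  have xE : w = x + v by rewrite /x velocityB subrK.
  have -> : (((mom (c' t) - mom (c t))^T *m invmx metric0) *m (dm' - dm)) 0 0 =
     (lie_bracket G v x *m d 0) 0 0.
    rewrite -/(d t) -/(velocity (d t)) -/x mulmxBr mxE [X in _ + X]mxE Em Em' xE bilDl.
    rewrite (magnetic0_alt quot s_mag s_inv) add0r opprD addrACA subrr addr0.
    have -> : lie_bracket G (x + v) x = lie_bracket G v x.
      by rewrite !bracketE mulmxDl -!bracketE bracketvv add0r.
    rewrite (mom_bracket_cst _ _ _ tc) (mom_bracket_cst _ _ _ tc') /d mulmxBr [RHS]mxE.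
    by congr (_ + _); rewrite [RHS]mxE.
  rewrite (le_trans (pairing_le _ _)) // -/N.
  have b1 : `|lie_bracket G v x| <= n%:R * B * `|v| * `|x|.
    rewrite bracketE (le_trans (mx_norm_mul _ _)) //.
    have -> : n%:R * B * `|v| * `|x| = n%:R * `|v| * (B * `|x|) by ring.
    by rewrite ler_wpM2l // mulr_ge0.
  have v1 : `|v| <= Num.sqrt K by rewrite (le_trans (vl1 _)) // (energy_cst _ tc) e1 sqrtr1 mulr1.
  have x1 : `|x| <= Num.sqrt K * Num.sqrt (energy (d t)) by exact: vl1.
  have b2 : `|v| * `|x| <= Num.sqrt K * (Num.sqrt K * Num.sqrt (energy (d t))).
    by apply: ler_pM.
  rewrite mulrA -expr2 (sqr_sqrtr (ltW K0)) in b2.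
  have -> : A0 * N * Num.sqrt (energy (d t)) =
     n%:R * (n%:R * B * (K * Num.sqrt (energy (d t)))) * N by rewrite /A0; ring.
  apply: ler_wpM2r; first exact: normr_ge0.
  apply: ler_wpM2l; first exact: ler0n.
  apply: (le_trans b1); have -> : n%:R * B * `|v| * `|x| = n%:R * B * (`|v| * `|x|) by ring.
  by apply: ler_wpM2l => //; rewrite mulr_ge0.
have cE : {within `[0, T], continuous (fun t => 2^-1 * energy (d t))}.
  by apply: derivable_within_continuous => t _; have [h' [dh _] _] := D t.
(* Evaluate at the time where the energy of the difference is maximal on the
   interval: the square root is then bounded by its value there. *)
have [tm] := EVT_max T0 cE; rewrite in_itv /= => /andP[tm0 tmT] hmax2.
have hmax t : t \in `[0, T] -> energy (d t) <= energy (d tm).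
  by move=> /hmax2; rewrite ler_pM2l // invr_gt0.
set F := energy (d tm) in hmax.
have F0 : 0 <= F by exact: (energy_ge0 quot g_metric g_inv).
have N0 : 0 <= N by exact: normr_ge0.
have key : F <= energy (d 0) + (2 * A0 * N * T) * Num.sqrt F.
  have D' (t : R) : exists h' : R, is_derive t 1 (fun t => 2^-1 * energy (d t)) h' /\
      `|h'| <= A0 * N * Num.sqrt (energy (d t)).
    by have [h' h1 h2] := D t; exists h'.
  have [dE hdE] := choice D'.
  have h : `|2^-1 * energy (d tm) - 2^-1 * energy (d 0)| <= A0 * N * Num.sqrt F * (tm - 0).
    apply: (mvt_scalar tm0 (fun t _ => (hdE t).1)) => t /andP[t0 t1].
    apply: (le_trans (hdE t).2); apply: ler_wpM2l; first exact: mulr_ge0.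
    apply: ler_wsqrtr.
    by apply: hmax; rewrite in_itv /= t0 (le_trans t1).
  rewrite subr0 in h; have {}h := le_trans (ler_norm _) h.
  have h2 : A0 * N * Num.sqrt F * tm <= A0 * N * Num.sqrt F * T.
    apply: ler_wpM2l; last exact: tmT.
    by apply: mulr_ge0; [exact: mulr_ge0|exact: sqrtr_ge0].
  have := le_trans h h2; rewrite -/F; move: (Num.sqrt F) (energy (d 0)) => s e0; lra.
have A1 : 0 <= 2 * A0 * N * T.
  have two0 : (0 : R) <= 2 by exact: ler0n.
  by apply: mulr_ge0 => //; apply: mulr_ge0 => //; exact: mulr_ge0.
have {}key := sqrt_growth (energy_ge0 quot g_metric g_inv _) F0 A1 key.
have e0 : Num.sqrt (energy (d 0)) <= Num.sqrt E0 * N.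
  have := ler_wsqrtr (energy_le (d 0)).
  by rewrite (sqrtrM _ E00) sqrtr_sqr (ger0_norm N0).
have eT : Num.sqrt (energy (d T)) <= Num.sqrt F.
  by apply: ler_wsqrtr; apply: hmax; rewrite in_itv /= T0 lexx.
have fin : `|d T| <= C1 * Num.sqrt F.
  rewrite (le_trans (mom_le_velocity _)) // -[leRHS]mulrA ler_wpM2l ?mulr_ge0 //.
  by rewrite (le_trans (vl1 _)) // ler_wpM2l // ?sqrtr_ge0.
apply: (le_trans fin); rewrite -/(d 0) -/N.
have : Num.sqrt F <= (Num.sqrt E0 + 2 * A0) * (1 + T) * N.
  apply: (le_trans key); apply: (@le_trans _ _ (Num.sqrt E0 * N + 2 * A0 * N * T)).
    by rewrite lerD2r.
  have sE := sqrtr_ge0 E0.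
  rewrite -subr_ge0 (_ : _ - _ = Num.sqrt E0 * T * N + 2 * A0 * N); last by ring.
  by apply: addr_ge0; apply: mulr_ge0 => //; apply: mulr_ge0 => //; exact: ler0n.
move=> /(ler_wpM2l C10) /le_trans; apply.
rewrite -subr_ge0 (_ : _ - _ = (1 + T) * N); last by ring.
by rewrite mulr_ge0 // addr_ge0.
Qed.

End Estimates.

(** * Lifting curves to the group *)

Section RealInduction.
Context {R : realType}.

Lemma nearR (r : R) (P : set R) : (\forall x \near r, P x) ->
  exists2 d, 0 < d & forall x, `|x - r| < d -> P x.
Proof.
move=> /nbhs_ballP[d d0 h]; exists d => // x hx; apply: h.
by rewrite -ball_normE /= distrC.
Qed.

Lemma nearR_in (r d : R) (P : set R) : 0 < d -> (forall x, `|x - r| < d -> P x) ->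
  \forall x \near r, P x.
Proof.
move=> d0 h; apply/nbhs_ballP; exists d => // x; rewrite -ball_normE /= distrC; exact: h.
Qed.

(** Continuous induction: the supremum of the times reached is reached, and
    can be exceeded unless it is [b]. *)
Lemma real_induction (P : R -> Prop) (a b : R) : a <= b -> P a ->
  (forall t, a <= t <= b -> exists2 d, 0 < d & forall t' t'', a <= t' -> t' <= t'' ->
    t'' <= b -> `|t' - t| < d -> `|t'' - t| < d -> P t' -> P t'') -> P b.
Proof.
move=> ab Pa step; pose S := [set t | a <= t <= b /\ P t].
have Sa : S a by split => //; rewrite lexx.
have hS : has_sup S by split; [exists a | exists b => t [/andP[]]].
have sb : sup S <= b by apply: ge_sup; [exists a | move=> t [/andP[]]].
have sa : a <= sup S by exact: sup_upper_bound.
have [|d d0 H] := step (sup S); first by rewrite sa.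
have [t [/andP[at_ tb] Pt] ts] := sup_adherent d0 hS.
have t_le : t <= sup S by apply: sup_upper_bound => //; split => //; rewrite at_.
pose t'' := Num.min b (sup S + d / 2).
have d2 : 0 < d / 2 by rewrite divr_gt0.
(* The property holds at a time before the supremum, hence at a time after it. *)
have st : sup S <= t'' by rewrite le_min sb lerDl ltW.
have t2 : t'' <= sup S + d / 2 by rewrite ge_min lexx orbT.
have tb2 : t'' <= b by rewrite ge_min lexx.
have dd : d / 2 < d by rewrite ltr_pdivrMr // ltr_pMr // ltr1n.
have P2 : P t''.
  apply: (H t t'') => //.
  - exact: le_trans st.
  - by rewrite ler0_norm ?subr_le0 // opprB; lra.
  - by rewrite ger0_norm ?subr_ge0 //; lra.
have : t'' <= sup S.
  by apply: sup_upper_bound => //; split => //; rewrite tb2 andbT (le_trans sa).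
move=> t''s; suff <- : t'' = b by [].
apply/eqP; rewrite eq_le tb2 /= leNgt; apply/negP => lt.
have : t'' = sup S + d / 2 by move: lt; rewrite /t'' minEle; case: ifP; rewrite ?ltxx.
by move=> e; move: t''s; rewrite e; lra.
Qed.

End RealInduction.

Lemma mulmx_cancel_r (F : fieldType) m n (v : 'M[F]_(m, n)) (A B C D : 'M[F]_n) :
  A = B *m C -> C *m D = 1%:M -> v *m A *m D = v *m B.
Proof. by move=> -> CD; rewrite -!mulmxA CD mulmx1. Qed.

Section PathLifting.
Context {R : realType} {n : nat} (G : lieGroupType R n) (Gam : set G)
  (M : manifoldType R n) (p : G -> M).
Hypothesis quot : left_quotient Gam p.

(** Continuity of the restriction to a closed interval, in a form stable under
    gluing at a point. *)
Definition cont_on (a : R -> G) (s0 s1 : R) := forall r, s0 <= r <= s1 ->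
  forall W, nbhs (a r) W ->
  exists2 d, 0 < d & forall r', s0 <= r' <= s1 -> `|r' - r| < d -> W (a r').

Lemma cont_on_interior a s0 s1 t : cont_on a s0 s1 -> s0 < t < s1 -> {for t, continuous a}.
Proof.
move=> ca /andP[h0 h1] W nW.
have [|d d0 H] := ca t _ W nW; first by rewrite !ltW.
apply: (@nearR_in _ _ (Num.min d (Num.min (t - s0) (s1 - t)))).
  by rewrite !lt_min d0 !subr_gt0 h0.
move=> x; rewrite !lt_min => /andP[xd]; rewrite !ltr_norml => /andP[/andP[x1 x2] /andP[x3 x4]].
by apply: H => //; apply/andP; split; lra.
Qed.

Lemma cont_on_glue a b s0 t' s1 : s0 <= t' -> t' <= s1 -> a t' = b t' ->
  cont_on a s0 t' -> (forall r, t' <= r <= s1 -> {for r, continuous b}) ->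
  cont_on (fun r => if r <= t' then a r else b r) s0 s1.
Proof.
move=> h0 h1 e ca cb r /andP[r0 r1] W.
have [rt|rt|->] := ltgtP r t'; last move=> nW.
- move=> nW.
  have [|d d0 H] := ca r _ W nW; first by rewrite r0 ltW.
  exists (Num.min d (t' - r)); first by rewrite lt_min d0 subr_gt0.
  move=> x /andP[x0 x1]; rewrite lt_min => /andP[xd]; rewrite ltr_norml => /andP[_ x2].
  have xt : x <= t' by lra.
  by rewrite xt; apply: H => //; rewrite x0.
- move=> nW.
  have cr : {for r, continuous b} by apply: cb; rewrite ltW.
  have [d d0 H] := nearR (cr _ nW).
  exists (Num.min d (r - t')); first by rewrite lt_min d0 subr_gt0.
  move=> x /andP[x0 x1]; rewrite lt_min => /andP[xd]; rewrite ltr_norml => /andP[x2 _].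
  have -> : (x <= t') = false by apply/negbTE; rewrite -ltNge; lra.
  exact: H.
have [|d d0 H] := ca t' _ W nW; first by rewrite h0 lexx.
have ct : {for t', continuous b} by apply: cb; rewrite lexx.
rewrite e in nW.
have [d' d'0 H'] := nearR (ct _ nW).
exists (Num.min d d'); first by rewrite lt_min d0.
move=> x /andP[x0 x1]; rewrite lt_min => /andP[xd xd'].
by case: ifP => xt; [apply: H => //; rewrite x0|exact: H'].
Qed.

(** Continuous induction on the time up to which a lift exists: near each
    time, a local section lifts the curve, and it is translated by an element
    of the subgroup to match the lift already constructed. *)
Lemma path_lifting (gm : R -> M) (s0 s1 : R) (a0 : G) : continuous gm -> s0 <= s1 ->
  p a0 = gm s0 ->
  exists a : R -> G, [/\ a s0 = a0, forall r, s0 <= r <= s1 -> p (a r) = gm r &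
    cont_on a s0 s1].
Proof.
move=> cg s01 pa0.
have [_ _ orb] := quot.
pose P t := exists a : R -> G, [/\ a s0 = a0, forall r, s0 <= r <= t -> p (a r) = gm r &
    cont_on a s0 t].
suff : P s1 by [].
apply: (@real_induction _ P s0 s1) => //.
  exists (fun=> a0); split => // [r|r _ W nW].
    by rewrite -eq_le => /eqP <-.
  by exists 1 => // x _ _; exact: nbhs_singleton nW.
move=> t _; pose b := lift quot (gm t).
have [U [s [oU Ub oV K ds]]] := quot_inverse quot b.
have nV : \forall x \near gm t, (p @` U) x.
  by apply: open_nbhs_nbhs; split => //; exists b => //; exact: liftK.
have [d d0 Hd] := nearR (cg t _ nV).
exists d => // t' t'' h0 h1 h2 ht' ht'' [a [as0 pa ca]].
have near_t r : t' <= r <= t'' -> `|r - t| < d.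
  by move: ht' ht''; rewrite !ltr_norml => /andP[? ?] /andP[? ?] /andP[? ?]; apply/andP; split; lra.
have sec r : t' <= r <= t'' -> p (s (gm r)) = gm r /\ {for gm r, continuous s}.
  move=> /near_t/Hd[k Uk <-]; rewrite K ?inE //; split => //.
  exact: (ds k Uk).1.
have [|e _] := sec t'; first by rewrite lexx.
have [c Gc ac] : exists2 c, Gam c & a t' = (c * s (gm t'))%g.
  by apply/orb; rewrite e pa // h0 lexx.
exists (fun r => if r <= t' then a r else (c * s (gm r))%g); split.
- by rewrite h0.
- move=> r /andP[r0 r1]; case: ifP => rt; first by apply: pa; rewrite r0.
  have rt' : t' <= r <= t'' by rewrite r1 andbT ltW // ltNge rt.
  rewrite -[RHS](sec r rt').1; apply/esym/orb; by exists c.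
- apply: cont_on_glue => // r /sec[_ cs].
  have h : {for r, continuous (s \o gm)} by apply: continuous_comp => //; exact: cg.
  exact: (@continuous_comp _ _ _ (s \o gm) (fun x => c * x)%g r h (mdiff_lmul c _).1).
Qed.

Lemma vel_lvel (a : R -> G) t v : vel a t (v *m ltrans (a t)) -> lvel a t v.
Proof.
move=> va; have h := vel_comp va (mdiff_lmul (a t)^-1%g (a t)).
have e := tmap_lmulV (a t) (1%g : G); rewrite (mulg1 (a t)) in e.
by rewrite -mulmxA [ltrans _ *m _]e mulmx1 in h.
Qed.

(** The frame of the quotient is the image of the left frame, so a curve and
    its lift have the same coordinates of velocity. *)
Lemma lift_lvel (a : R -> G) (gm : R -> M) t v :
  {for t, continuous a} -> (\forall r \near t, p (a r) = gm r) ->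
  vel gm t (v *m frame quot (gm t)) -> lvel a t v.
Proof.
move=> ca pa vg; apply: vel_lvel.
have pt := nbhs_singleton pa; rewrite -pt in vg.
have [U [s [oU Ub oV K ds]]] := quot_inverse quot (a t).
have h := vel_comp vg; rewrite -pt in h; have {}h := h _ _ s (ds _ Ub).
have e1 := tmap_quot_inverse quot oU Ub K (ds _ Ub).
rewrite (mulmx_cancel_r v (frame_ltrans quot (a t)) e1) in h.
apply: (vel_near _ h).
have nU : \forall r \near t, U (a r) by apply: ca; exact: open_nbhs_nbhs.
by apply: filterS2 pa nU => r er Ur; rewrite /= -er K // inE.
Qed.

End PathLifting.

(** * Left velocities of quotients of curves *)

Section LeftCurves.
Context {R : realType} {n : nat} (G : lieGroupType R n).
Let domx (x : G) := @chart_at_dom R n G x.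
Let o : G := 1%g.
Let ko := chart_at o o.

(** Write [(a s)^-1 * b s] as [h] times a product of two curves through the
    identity, namely the conjugate by [h] of the inverse of [(a t)^-1 * a s],
    and [(b t)^-1 * b s]. *)
Lemma lvel_quotient (a b : R -> G) t v w : lvel a t v -> lvel b t w ->
  lvel (fun s => (a s)^-1 * b s)%g t (w - v *m conjt ((a t)^-1 * b t)%g).
Proof.
move=> va vb; set h := ((a t)^-1 * b t)%g.
have v1 := vel_conj h (mulVg (a t)) va.
have o1 : (((a t)^-1 * a t) ^ h)%g = 1%g by rewrite mulVg conj1g.
have v2 := vel_inv1 o1 v1.
have o2 : ((((a t)^-1 * a t) ^ h)^-1)%g = 1%g by rewrite o1 invg1.
have v3 := vel_mul1 o2 (mulVg (b t)) v2 vb.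
rewrite addrC in v3; rewrite /lvel -/h.
suff -> : (fun s => h^-1 * ((a s)^-1 * b s))%g =
          (fun s => (((a t)^-1 * a s) ^ h)^-1 * ((b t)^-1 * b s))%g by exact: v3.
apply/funext => s; rewrite /h conjgE !invgM !invgK !mulgA.
by rewrite !(mulgVK, mulgK).
Qed.

Lemma lvel_lmul (c : G) (a : R -> G) t v : lvel a t v -> lvel (fun s => c * a s)%g t v.
Proof.
rewrite /lvel; suff -> : (fun s => (a t)^-1 * a s)%g = (fun s => (c * a t)^-1 * (c * a s))%g by [].
by apply/funext => s; rewrite invgM -mulgA mulKg.
Qed.

(** Additivity of [nconj] reduces the derivative at any time to the derivative
    at the identity. *)
Lemma nconj_lvel (h : R -> G) t u : two_step_nilpotent G -> lvel h t u ->
  is_derive t 1 (fun s => nconj (h s)) (adr G u).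
Proof.
move=> G2 vh.
have D := nconj_derive (mulVg (h t)) vh.
have D' := is_deriveD (is_derive_cst (nconj (h t)) t 1) D.
rewrite add0r in D'.
suff -> : (fun s => nconj (h s)) = cst (nconj (h t)) + (fun s => nconj ((h t)^-1 * h s)%g) by exact: D'.
by apply/funext => s; rewrite -{1}[h s](mulVKg (h t)) nconjM.
Qed.

Lemma lvel_chart (h : R -> G) t u : lvel h t u -> cdom (chart_at o) (h t) ->
  is_derive t 1 (chart_at o \o h) (u *m lframe o (chart_at o (h t))).
Proof.
move=> vh d; have D := vel_chart (lvel_vel vh) d.
have e := lframeE o (chart_at o (h t)); rewrite (cmapK_at d) in e.
rewrite -mulmxA in D.
exact: (is_derive_eq D (congr1 (mulmx u) (esym e))).
Qed.

(** Closed balls instead of the open ones of the definition: the estimates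
    below are non-strict inequalities. *)
Lemma ball_nbhs (V : normedModType R) (x : V) (P : set V) : (\forall y \near x, P y) ->
  exists2 r, 0 < r & forall y, `|y - x| <= r -> P y.
Proof.
move=> /nbhs_ballP[d d0 h]; exists (d / 2); first by rewrite divr_gt0.
move=> y hy; apply: h; rewrite -ball_normE /= distrC; apply: le_lt_trans hy _.
by rewrite ltr_pdivrMr // ltr_pMr // ltr1n.
Qed.

Lemma dist_continuous (V : normedModType R) (c : V) : continuous (fun q : V => `|q - c|).
Proof. by move=> q; apply: cvg_norm; apply: cvgB; [exact: cvg_id|exact: cvg_cst]. Qed.

Lemma lframe_bounds : exists r C, [/\ 0 < r, 0 < C &
  forall q, `|q - ko| <= r -> [/\ cimg o q, `|lframe o q| <= C, lframe o q \in unitmx &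
    `|invmx (lframe o q)| <= C]].
Proof.
have d1 := cimg_nbhs (cimg_chart (domx o)).
have c2 : {for ko, continuous (lframe o)} by exact/differentiable_continuous/lframe_diff.
have u0 : lframe o ko \in unitmx by rewrite lframe_o unitmx1.
have d3 : \forall q \near ko, lframe o q \in unitmx by exact: near_comp c2 (unitmx_near u0).
have c4 : {for ko, continuous (fun q => invmx (lframe o q))}.
  by apply: continuous_comp => //; exact/differentiable_continuous/differentiable_invmx.
have bnd (f : 'rV[R]_n -> 'M[R]_n) : {for ko, continuous f} ->
    exists2 b, 0 <= b & \forall q \near ko, `|f q| <= b.
  move=> /cvgrPdist_le/(_ 1 ltr01) h; exists (`|f ko| + 1); first by rewrite addr_ge0.
  apply: filterS h => q h.
  have -> : f q = f ko - (f ko - f q) by rewrite opprB addrC subrK.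
  by rewrite (le_trans (ler_normB _ _)) // lerD2l.
have [x x0 d2] := bnd _ c2; have [y y0 d4] := bnd _ c4.
have [r r0 H] : exists2 r, 0 < r & forall q, `|q - ko| <= r ->
   (cimg o q /\ `|lframe o q| <= x) /\
   (lframe o q \in unitmx /\ `|invmx (lframe o q)| <= y).
  by apply: ball_nbhs; apply: filterI; apply: filterI.
exists r, (1 + x + y); split; first exact: r0.
  by lra.
move=> q /H[[h1 h2] [h3 h4]]; split; [exact: h1| |exact: h3|].
  by apply: (le_trans h2); lra.
by apply: (le_trans h4); lra.
Qed.

(** While the curve stays in the ball where the left frame is bounded, its
    coordinates have speed at most [C * beta], so that at time [T] it is still
    strictly inside the ball; continuous induction shows that it never leaves. *)
Lemma left_curve_bound : exists r C, [/\ 0 < r, 0 < C &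
  forall (h : R -> G) (u : R -> 'rV[R]_n) (T beta rho0 : R), 0 <= T -> 0 <= beta ->
    (forall t, 0 <= t <= T -> lvel h t (u t)) ->
    (forall t, 0 <= t <= T -> `|u t| <= beta) ->
    cdom (chart_at o) (h 0) -> `|chart_at o (h 0) - ko| <= rho0 ->
    rho0 + C * beta * T < r ->
    forall t, 0 <= t <= T -> cdom (chart_at o) (h t) /\
      `|chart_at o (h t) - ko| <= rho0 + C * beta * T].
Proof.
have [r [C0 [r0 C00 good]]] := lframe_bounds.
exists r, (1 + n%:R * C0); split => //; first by rewrite ltr_pwDl // mulr_ge0 // ltW.
set C := 1 + _; have C1 : 0 < C by rewrite ltr_pwDl // mulr_ge0 // ltW.
move=> h u T beta rho0 T0 b0 vh ub d0 k0 small; set rho := rho0 + _ in small *.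
have CbT : 0 <= C * beta * T by rewrite !mulr_ge0 // ltW.
pose A : set 'rV[R]_n := [set q | `|q - ko| <= rho].
have cA : compact A.
  apply: bounded_closed_compact.
    exists (`|ko| + rho); split; first exact: num_real.
    move=> x hx q /= hq; apply: ltW; apply: le_lt_trans hx.
    by rewrite -[q](subrK ko) addrC (le_trans (ler_normD _ _)) // lerD2l.
  apply: (@closed_comp _ _ (fun q : 'rV[R]_n => `|q - ko|) [set y | y <= rho]); last exact: closed_le.
  by move=> q _; exact: dist_continuous.
have Ai q : A q -> cimg o q.
  by move=> hq; have [] := good q (le_trans hq (ltW small)).
pose B : set G := cinv (chart_at o) @` A.
have BP x : B x <-> cdom (chart_at o) x /\ `|chart_at o x - ko| <= rho.
  split=> [[q hq <-]|[d hx]].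
    by have [e d] := cinvK_at (Ai q hq); rewrite e.
  by exists (chart_at o x) => //; exact: cmapK_at.
(* The ball is compact, hence closed in the group: if the curve is outside it
   at some time, it was already outside just before. *)
have clB : closed B.
  apply: compact_closed; first exact: manifold_hausdorff.
  apply: continuous_compact => //; apply: continuous_in_subspaceT => q; rewrite inE => /Ai.
  exact: cinv_cvg.
have ch t : 0 <= t <= T -> {for t, continuous h} by move=> /vh/lvel_vel[].
pose P t := forall s, 0 <= s <= t -> B (h s).
(* A curve that stays in the large ball ends in the small one. *)
have key t : 0 <= t <= T -> (forall s, 0 <= s <= t -> cdom (chart_at o) (h s) /\ `|chart_at o (h s) - ko| <= r) ->
    B (h t).
  move=> /andP[t0 tT] hr; apply/BP; split; first by apply: (hr t _).1; rewrite t0 lexx.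
  have : `|chart_at o (h t) - chart_at o (h 0)| <= C * beta * (t - 0).
    apply: (mvt_mx (f := chart_at o \o h) (df := fun s => u s *m lframe o (chart_at o (h s)))) => //.
    - by rewrite mulr_ge0 // ltW.
    - move=> s st; apply: lvel_chart; last exact: (hr s st).1.
      by apply: vh; case/andP: st => -> /le_trans -> .
    - move=> s st; have [_ l1 _ _] := good _ (hr s st).2.
      have us : `|u s| <= beta by apply: ub; case/andP: st => -> /le_trans -> .
      rewrite (le_trans (mx_norm_mul _ _)) //.
      have -> : C * beta = beta + n%:R * beta * C0 by rewrite /C; ring.
      rewrite ler_wpDl // -!mulrA ler_wpM2l // ler_pM //.
  rewrite subr0 => ht.
  have -> : chart_at o (h t) - ko = (chart_at o (h t) - chart_at o (h 0)) + (chart_at o (h 0) - ko).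
    by rewrite subrKA.
  rewrite (le_trans (ler_normD _ _)) // addrC lerD // (le_trans ht) // ler_wpM2l //.
  by rewrite mulr_ge0 // ltW.
suff PT : P T by move=> t /PT/BP.
apply: (@real_induction _ P 0 T) => //.
  move=> s; rewrite -eq_le => /eqP <-; apply/BP; split => //.
  by rewrite (le_trans k0) // lerDl.
move=> t tT; have [Bt|nBt] := pselect (B (h t)).
  have [dt kt] := (BP _).1 Bt.
  have n1 : \forall s \near t, cdom (chart_at o) (h s).
    exact: near_comp (ch t tT) (cdom_nbhs dt).
  have n2 : \forall s \near t, `|chart_at o (h s) - ko| < r.
    have cc : {for t, continuous (chart_at o \o h)}.
      by apply: continuous_comp; [exact: ch|exact: chart_cvg].
    pose O : set 'rV[R]_n := fun q => `|q - ko| < r.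
    suff np : nbhs ((chart_at o \o h) t) O by exact: (near_comp cc np).
    apply/nbhs_ballP; exists (r - `|chart_at o (h t) - ko|).
      by rewrite /= subr_gt0; exact: le_lt_trans kt small.
    move=> q; rewrite -ball_normE /= ltrBrDr => hq; apply: le_lt_trans hq.
    by rewrite (distrC _ q) -[q - ko](subrKA (chart_at o (h t))) ler_normD.
  have [d dpos Hd] := nearR (filterI n1 n2).
  exists d => // t' t'' h0 h1 h2 d' d'' Pt' s /andP[s0 s1].
  apply: key; first by rewrite s0 (le_trans s1).
  move=> x /andP[x0 x1]; have [xt|xt] := leP x t'.
    have /BP[e1 e2] : B (h x) by apply: Pt'; rewrite x0.
    by split => //; apply: ltW; exact: le_lt_trans e2 small.
  have [|e1 e2] := Hd x; last by split => //; exact: ltW.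
  have x2 : x <= t'' by exact: le_trans s1.
  by move: d' d''; rewrite !ltr_norml => /andP[? ?] /andP[? ?]; apply/andP; split; lra.
have nB : \forall s \near t, ~ B (h s).
  have np : nbhs (h t) (~` B) by apply: open_nbhs_nbhs; split => //; exact: closed_openC.
  exact: (near_comp (ch t tT) np).
have [d dpos Hd] := nearR nB.
exists d => // t' t'' h0 h1 h2 d' d'' Pt'; exfalso; apply: (Hd t' d').
by apply: Pt'; rewrite h0 lexx.
Qed.

End LeftCurves.

(** * Polynomial separation of trajectories *)

Section ConjugationLipschitz.
Context {R : realType}.

Lemma diff_lipschitz_at (V W : normedModType R) (f : V -> W) x : differentiable f x ->
  exists2 C, 0 < C & \forall y \near x, `|f y - f x| <= C * `|y - x|.
Proof.
move=> df.
have /linear_bounded_continuous/linear_boundedP := diff_continuous df.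
move=> [K [_ hK']].
have hK : forall x0, `|'d f x x0| <= (`|K| + 1) * `|x0|.
  by apply: hK'; rewrite (le_lt_trans (ler_norm _)) // ltrDl.
exists (`|K| + 1 + 1); first by rewrite addr_gt0 // ltr_wpDl.
have := diff_elim df ltr01.
rewrite [X in _ -> X](near_shift 0); apply: filterS => h /= e.
rewrite subr0 addrK [x in `|x|](_ : _ = (f (h + x) - f x - 'd f x h) + 'd f x h); last by rewrite subrK.
rewrite (le_trans (ler_normD _ _)) // [leRHS]mulrDl addrC lerD //.
Qed.

Context {n : nat} (G : lieGroupType R n).
Let domx (x : G) := @chart_at_dom R n G x.
Let o : G := 1%g.
Let ko := chart_at o o.

(** [nconj] vanishes at the identity and is differentiable there, as the
    adjoint action is the quotient of the two frames. *)
Lemma nconj_lipschitz : exists r C, [/\ 0 < r, 0 < C &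
  forall q, `|q - ko| <= r -> `|nconj (cinv (chart_at o) q)| <= C * `|q - ko|].
Proof.
pose F q : 'M[R]_n := rframe G q *m invmx (lframe o q).
have u0 : lframe o ko \in unitmx by rewrite lframe_o unitmx1.
have dF : differentiable F ko.
  apply: differentiable_mulmx; first exact: rframe_diff.
  apply: (differentiable_comp (f := lframe o) (g := invmx)); first exact: lframe_diff.
  exact: differentiable_invmx.
have F1 : F ko = 1%:M.
  have e := rframeE G ko; rewrite (cmapK_at (domx o)) conjt1 mul1mx in e.
  exact: (etrans (congr1 (mulmxr _) e) (mulmxV u0)).
have [C C0 near1] := diff_lipschitz_at dF.
have c2 : {for ko, continuous (lframe o)} by exact/differentiable_continuous/lframe_diff.
have near2 : \forall q \near ko, lframe o q \in unitmx by exact: near_comp c2 (unitmx_near u0).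
have [r r0 H] := ball_nbhs (filterI near1 near2).
exists r, C; split; [exact: r0|exact: C0|] => q /H[h uq].
have e : conjt (cinv (chart_at o) q) = F q.
  exact: (esym (etrans (congr1 (mulmxr _) (rframeE G q)) (mulmxK uq _))).
by rewrite F1 -e in h; exact: h.
Qed.

End ConjugationLipschitz.

Section Shadowing.
Context {R : realType} {n : nat} (G : lieGroupType R n) (Gam : set G)
  (M : manifoldType R n) (p : G -> M).
Hypothesis quot : left_quotient Gam p.
Variables (g sigma : M -> 'M[R]_n).
Hypothesis g_metric : riemannian_metric g.
Hypothesis g_inv : left_invariant (pullback p g).
Hypothesis s_mag : magnetic_field sigma.
Hypothesis s_inv : left_invariant (pullback p sigma).
Hypothesis G2 : two_step_nilpotent G.
Hypothesis s_derived : forall X D : 'rV[R]_n, derived_algebra G D ->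
  bil (pullback p sigma (1%g : G)) X D = 0.
Local Notation mom := (mom quot).
Local Notation velocity := (velocity p g).
Local Notation energy := (energy p g).
Local Notation traj c := (magnetic_trajectory g sigma c).
Let o : G := 1%g.
Let ko := chart_at o o.

(** Nearness of cotangent vectors, measured after lifting the base points to
    the group: some lifts differ by right multiplication by an element near
    the identity, and the momenta are close. Right multiplication is the one
    that commutes with the projection. *)
Definition close_to (eps : R) (z z' : cotangent M) := exists (a : G) (l : 'rV[R]_n),
  [/\ cimg o l, p a = base z, p (a * cinv (chart_at o) l)%g = base z',
      `|l - ko| <= eps & `|mom z' - mom z| <= eps].

(** Lifts start at a prescribed point because the subgroup acts transitively
    on the fibres. *)
Lemma traj_lift c (a0 : G) T : traj c -> p a0 = base (c 0) -> 0 <= T ->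
  exists a : R -> G, a 0 = a0 /\ forall t, 0 <= t <= T ->
    p (a t) = base (c t) /\ lvel a t (velocity (mom (c t))).
Proof.
move=> tc pa0 T0; have [_ _ orb] := quot.
(* Lift on a larger interval, so that the endpoints of the original one are
   interior and two-sided derivatives make sense there. *)
have [||a [_ pa ca]] := path_lifting quot (base_traj_continuous tc) (s0 := -1) (s1 := T + 1)
  (a0 := lift quot (base (c (-1)))).
- by rewrite (le_trans (y := 0)) // ?oppr_le0 // addr_ge0.
- exact: liftK.
have [gm Ggm e] : exists2 gm, Gam gm & a0 = (gm * a 0)%g.
  by apply/orb; rewrite pa0 pa // oppr_le0 ler01 addr_ge0.
exists (fun t => gm * a t)%g; split; first by [].
move=> t /andP[t0 tT].
have tI : -1 < t < T + 1 by apply/andP; split; lra.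
have ptI : p (a t) = base (c t) by apply: pa; case/andP: tI => h1 h2; rewrite !ltW.
have pg (x : G) : p (gm * x)%g = p x by apply/esym/orb; exists gm.
split; first by rewrite pg.
apply: lvel_lmul.
have ct := cont_on_interior ca tI.
have pn : \forall r \near t, p (a r) = base (c r).
  apply: (@nearR_in _ _ 1) => // x; rewrite ltr_norml => /andP[h1 h2].
  by apply: pa; apply/andP; split; lra.
have [hv _] := trajectory_eqs quot g_metric g_inv s_inv tc t.
exact: (lift_lvel ct pn hv).
Qed.

(** Rows [y *m nconj h] are tangent to the centre. *)
Lemma adrB_nconj (x y : 'rV[R]_n) (h : G) : adr G (x - y *m nconj h) = adr G x.
Proof.
have key (u z : 'rV[R]_n) : lie_bracket G u z = 0 -> lie_bracket G u (x - z) = lie_bracket G u x.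
  move=> e; have e' : z *m adr G u = 0 by rewrite -bracketE bracketC e oppr0.
  by rewrite bracketC bracketE mulmxBl e' subr0 -bracketE -bracketC.
apply: mulmx_ext => u; have e := key u _ (bracket_nconj G2 u y h).
exact: (etrans (esym (bracketE _ _ _)) (etrans e (bracketE _ _ _))).
Qed.

(** Let [h] be the quotient of lifts of the two trajectories, with velocities
    [v] and [w]. The difference [w - v] grows linearly by [momentum_growth].
    The derivative of [nconj (h t)] is the bracket with [w - v], since the
    remaining part of the left velocity of [h] is central; hence [nconj (h t)]
    grows quadratically. So does the left velocity [w - v - v *m nconj (h t)]
    of [h], and [h] moves away from the identity at most cubically in time. *)
Lemma shadowing : exists C r, [/\ 0 < C, 0 < r & forall c c' eta T, traj c -> traj c' ->
  energy (mom (c 0)) = 1 -> 0 <= eta -> 0 <= T -> close_to eta (c 0) (c' 0) ->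
  C * (1 + T) ^+ 3 * eta < r ->
  forall t, 0 <= t <= T -> close_to (C * (1 + T) ^+ 3 * eta) (c t) (c' t)].
Proof.
have [B B0 hB] := adr_bound G.
have [K K0 hK] := velocity_bound quot g_metric g_inv.
have [Cm Cm0 grow] := momentum_growth quot g_metric g_inv s_mag s_inv G2 s_derived.
have [rN [CN [rN0 CN0 hN]]] := nconj_lipschitz G.
have [r1 [C1 [r10 C10 hL]]] := left_curve_bound G.
pose Kv := n%:R * `|invmx (metric0 p g)|.
have Kv0 : 0 <= Kv by rewrite mulr_ge0.
pose V0 := Num.sqrt K.
have V00 : 0 <= V0 by exact: sqrtr_ge0.
(* [Kv * Cm] bounds the difference of the velocities, the second summand the
   contribution of [nconj]; every other power of the time is absorbed in that
   of [X = 1 + T]. *)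
pose E := Kv * Cm + n%:R * V0 * (CN + B * (Kv * Cm)).
have KC0 : 0 <= Kv * Cm by rewrite mulr_ge0 // ltW.
have nV : 0 <= n%:R * V0 by rewrite mulr_ge0.
have BK : 0 <= B * (Kv * Cm) by rewrite mulr_ge0.
have E0 : 0 <= E by rewrite addr_ge0 // mulr_ge0 // addr_ge0 // ltW.
have CE0 : 0 <= C1 * E by rewrite mulr_ge0 // ltW.
exists (1 + Cm + C1 * E), (Num.min rN r1); split.
- by rewrite -addrA ltr_pwDl // addr_ge0 // ltW.
- by rewrite lt_min rN0.
move=> c c' eta T tc tc' e1 eta0 T0 [a0 [l [hl pa0 pb0 lk mk]]].
set X := 1 + T; set C := 1 + Cm + C1 * E.
have X1 : 1 <= X by rewrite lerDl.
have X0 : 0 <= X by exact: le_trans X1.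
rewrite lt_min => /andP[smallN smallL].
have X3 : 1 <= X ^+ 3 by rewrite exprn_ege1.
have X2 : 1 <= X ^+ 2 by rewrite exprn_ege1.
have eta_le : eta <= C * X ^+ 3 * eta.
  rewrite ler_peMl //; apply: (le_trans X3); rewrite ler_peMl //; first exact: le_trans X3.
  by rewrite /C -addrA lerDl addr_ge0 // ltW.
have [a [a00 ha]] := traj_lift tc pa0 T0.
have [b [b00 hb]] := traj_lift tc' pb0 T0.
pose v t := velocity (mom (c t)); pose w t := velocity (mom (c' t)).
pose h t := ((a t)^-1 * b t)%g.
pose u t := w t - v t *m conjt (h t).
(* The two sources of separation: the difference of the velocities and the
   noncommutativity. *)
have uE t : u t = (w t - v t) - v t *m nconj (h t).
  by rewrite /u /nconj mulmxBr mulmx1 opprB addrA subrK.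
have vh t : 0 <= t <= T -> lvel h t (u t).
  by move=> tT; apply: lvel_quotient; [exact: (ha t tT).2|exact: (hb t tT).2].
have h0 : h 0 = cinv (chart_at o) l by rewrite /h a00 b00 mulKg.
have dm t : 0 <= t <= T -> `|mom (c' t) - mom (c t)| <= Cm * X * eta.
  move=> /andP[t0 tT]; apply: (le_trans (grow c c' tc tc' e1 t t0)).
  apply: ler_pM => //; first by rewrite mulr_ge0 ?addr_ge0 // ltW.
  by apply: ler_wpM2l; [exact: ltW|rewrite lerD2l].
have dv t : 0 <= t <= T -> `|w t - v t| <= Kv * Cm * X * eta.
  move=> tT; rewrite /w /v -velocityB (le_trans (velocity_le_mom _ _ _)) //.
  rewrite -[leRHS]mulrA -[leRHS]mulrA ler_wpM2l // mulrA; exact: dm.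
have v_le t : `|v t| <= V0.
  have := ler_wsqrtr (hK (mom (c t))).
  by rewrite (energy_cst quot g_metric g_inv s_mag s_inv t tc) e1 mulr1 sqrtr_sqr normr_id.
have N0 : `|nconj (h 0)| <= CN * eta.
  rewrite h0 (le_trans (hN l _)) //; last by rewrite ler_wpM2l // ltW.
  by apply: (le_trans lk); apply: (le_trans eta_le); exact: ltW.
(* The bracket sees only [w - v], so no Gronwall inequality, and no
   exponential, is needed. *)
have Nt t : 0 <= t <= T -> `|nconj (h t)| <= CN * eta + B * (Kv * Cm * X * eta) * T.
  move=> /andP[t0 tT].
  have KB : 0 <= B * (Kv * Cm * X * eta) by rewrite mulr_ge0 // mulr_ge0 // mulr_ge0.
  have mv : `|nconj (h t) - nconj (h 0)| <= B * (Kv * Cm * X * eta) * (t - 0).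
    apply: (mvt_mx (f := fun s => nconj (h s)) (df := fun s => adr G (u s))) => // s /andP[s0 st].
      by apply: nconj_lvel => //; apply: vh; rewrite s0 (le_trans st).
    rewrite uE adrB_nconj (le_trans (hB _)) // ler_wpM2l // dv //.
    by rewrite s0 (le_trans st).
  rewrite -[nconj (h t)](subrK (nconj (h 0))) addrC (le_trans (ler_normD _ _)) // lerD //.
  by apply: (le_trans mv); rewrite subr0 ler_wpM2l.
pose beta := E * X ^+ 2 * eta.
have TX : T <= X by rewrite lerDr.
have XX2 : X <= X ^+ 2 by rewrite expr2 ler_peMl.
have ub t : 0 <= t <= T -> `|u t| <= beta.
  move=> tT; rewrite uE (le_trans (ler_normB _ _)) //.
  have -> : beta = Kv * Cm * X ^+ 2 * eta + n%:R * V0 * (CN * X ^+ 2 * eta + B * (Kv * Cm) * X ^+ 2 * eta).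
    by rewrite /beta /E; ring.
  apply: lerD.
    apply: (le_trans (dv t tT)); apply: ler_wpM2r => //; exact: ler_wpM2l.
  apply: (le_trans (mx_norm_mul _ _)); apply: ler_pM => //.
    by rewrite ler_wpM2l.
  apply: (le_trans (Nt t tT)); apply: lerD.
    by apply: ler_wpM2r => //; rewrite ler_peMr // ltW.
  rewrite (_ : B * (Kv * Cm * X * eta) * T = B * (Kv * Cm) * (X * T) * eta); last by ring.
  by apply: ler_wpM2r => //; apply: ler_wpM2l => //; rewrite expr2 ler_wpM2l.
have beta0 : 0 <= beta by rewrite mulr_ge0 // mulr_ge0 // exprn_ge0.
have tot : eta + C1 * beta * T <= C * X ^+ 3 * eta.
  have -> : C * X ^+ 3 * eta = X ^+ 3 * eta + Cm * X ^+ 3 * eta + C1 * E * X ^+ 3 * eta.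
    by rewrite /C; ring.
  apply: lerD.
    apply: ler_wpDr; first by rewrite !mulr_ge0 // ltW.
    by rewrite ler_peMl.
  rewrite (_ : C1 * beta * T = C1 * E * (X ^+ 2 * T) * eta); last by rewrite /beta; ring.
  by apply: ler_wpM2r => //; apply: ler_wpM2l => //; rewrite (exprSr X 2) ler_wpM2l // exprn_ge0.
have d0 : cdom (chart_at o) (h 0) by rewrite h0; exact: (cinvK_at hl).2.
have k0 : `|chart_at o (h 0) - ko| <= eta by rewrite h0 (cinvK_at hl).1.
have fin := hL h u T beta eta T0 beta0 vh ub d0 k0 (le_lt_trans tot smallL).
move=> t tT; have [dt kt] := fin t tT.
exists (a t), (chart_at o (h t)); split.
- exact: cimg_chart.
- exact: (ha t tT).1.
- by rewrite (cmapK_at dt) /h mulVKg; exact: (hb t tT).1.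
- exact: le_trans kt tot.
- apply: (le_trans (dm t tT)); apply: ler_wpM2r => //.
  apply: ler_pM => //; first exact: ltW.
    by rewrite /C -addrA [1 + _]addrC -addrA lerDl addr_ge0.
  by rewrite (le_trans XX2) // (exprSr X 2) ler_peMr // exprn_ge0.
Qed.

End Shadowing.

(** * Uniqueness of trajectories and iterates of the flow *)

Section MatrixLimits.
Context {R : realType}.

Lemma mulmx_continuous m n k (A0 : 'M[R]_(m, n)) (B0 : 'M[R]_(n, k)) :
  {for (A0, B0), continuous (fun AB : 'M[R]_(m, n) * 'M[R]_(n, k) => AB.1 *m AB.2)}.
Proof.
apply/cvgrPdist_le => e e0.
pose c := n%:R * (`|A0| + `|B0| + 1) + 1.
have c0 : 0 < c by rewrite ltr_wpDl // mulr_ge0 // !addr_ge0.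
pose d := Num.min 1 (e / 2 / c).
have d0 : 0 < d by rewrite lt_min ltr01 !divr_gt0.
exists (ball A0 d, ball B0 d) => /=; first by split; apply: nbhsx_ballx.
move=> [A B] /= [hA hB]; rewrite -ball_normE /= in hA; rewrite -ball_normE /= in hB.
have B1 : `|B| <= `|B0| + 1.
  have -> : B = B0 - (B0 - B) by rewrite opprB addrC subrK.
  rewrite (le_trans (ler_normB _ _)) // lerD2l; apply: ltW; apply: (lt_le_trans hB).
  by rewrite ge_min lexx.
have -> : A0 *m B0 - A *m B = A0 *m (B0 - B) + (A0 - A) *m B.
  by rewrite mulmxBr mulmxBl addrA subrK.
rewrite (le_trans (ler_normD _ _)) // (splitr e).
have dc : c * d <= e / 2.
  by rewrite mulrC -ler_pdivlMr // ge_min lexx orbT.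
have half (x y : R) : 0 <= x -> x <= `|A0| + `|B0| + 1 -> 0 <= y -> y <= d -> n%:R * x * y <= e / 2.
  move=> x0 xc y0 yd; apply: le_trans dc; apply: ler_pM => //; first by rewrite mulr_ge0.
  by rewrite /c ler_wpDr // ler_wpM2l.
rewrite lerD // (le_trans (mx_norm_mul _ _)) //.
  by apply: half => //; [rewrite -addrA lerDl addr_ge0|exact: ltW].
rewrite -mulrA [`|_| * `|_|]mulrC mulrA.
by apply: half => //; [rewrite -addrA (le_trans B1) // lerDr|exact: ltW].
Qed.

End MatrixLimits.

Lemma comp_continuous_at (T U V : topologicalType) (f : T -> U) (g : U -> V) x :
  {for x, continuous f} -> {for f x, continuous g} -> {for x, continuous (fun y => g (f y))}.
Proof. by move=> cf cg; exact: (continuous_comp cf cg). Qed.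

Lemma pair_continuous_at (T U V : topologicalType) (f : T -> U) (g : T -> V) x :
  {for x, continuous f} -> {for x, continuous g} -> {for x, continuous (fun y => (f y, g y))}.
Proof. by move=> cf cg; exact: cvg_pair. Qed.

Lemma mulmx_invmx_mul (F : fieldType) n (E T : 'M[F]_n) :
  E \in unitmx -> T \in unitmx -> T *m invmx (E *m T) = invmx E.
Proof.
move=> uE uT; have uET : E *m T \in unitmx by rewrite unitmx_mul uE.
by rewrite -[LHS]mul1mx -(mulVmx uE) -!mulmxA (mulmxA E T) mulmxV // mulmx1.
Qed.

Section Flow.
Context {R : realType} {n : nat} (G : lieGroupType R n) (Gam : set G)
  (M : manifoldType R n) (p : G -> M).
Hypothesis quot : left_quotient Gam p.
Variables (g sigma : M -> 'M[R]_n).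
Hypothesis g_metric : riemannian_metric g.
Hypothesis g_inv : left_invariant (pullback p g).
Hypothesis s_mag : magnetic_field sigma.
Hypothesis s_inv : left_invariant (pullback p sigma).
Hypothesis G2 : two_step_nilpotent G.
Hypothesis s_derived : forall X D : 'rV[R]_n, derived_algebra G D ->
  bil (pullback p sigma (1%g : G)) X D = 0.
Variable phi : R -> cotangent M -> cotangent M.
Hypothesis phi_flow : magnetic_flow g sigma phi.
Local Notation mom := (mom quot).
Local Notation velocity := (velocity p g).
Local Notation energy := (energy p g).
Local Notation traj c := (magnetic_trajectory g sigma c).
Local Notation close_to := (close_to quot).
Let domM (x : M) := @chart_at_dom R n M x.
Let domG (x : G) := @chart_at_dom R n G x.
Let o : G := 1%g.
Let ko := chart_at o o.

Lemma unit_energy z : unit_cotangent g z <-> energy (mom z) = 1.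
Proof.
rewrite /unit_cotangent /= (conorm_energy quot g_metric g_inv); split=> [h|->].
  rewrite -[LHS]sqr_sqrtr ?h ?expr1n //; exact: (energy_ge0 quot g_metric g_inv).
exact: sqrtr1.
Qed.

Lemma cotangent_mom_inj z z' : base z = base z' -> mom z = mom z' -> z = z'.
Proof.
case: z z' => [x a] [x' a'] /= <-; rewrite /mom /= => h; congr Cotangent.
have u := frame_unit quot x.
by rewrite -[a](mulKmx u) h mulKmx.
Qed.

Lemma close_to0 z z' : close_to 0 z z' -> z = z'.
Proof.
move=> [a [l [hl pa pb]]]; rewrite !normr_le0 !subr_eq0 => /eqP lk /eqP e.
apply: cotangent_mom_inj => //.
by rewrite -pa -pb lk (cmapK_at (domG o)) mulg1.
Qed.

Lemma close_refl eps z : 0 <= eps -> close_to eps z z.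
Proof.
move=> e0; exists (lift quot (base z)), ko; split.
- exact: cimg_chart.
- exact: liftK.
- by rewrite (cmapK_at (domG o)) mulg1 liftK.
- by rewrite subrr normr0.
- by rewrite subrr normr0.
Qed.

(** Shadowing with [eta = 0]. *)
Lemma traj_unique c c' t : traj c -> traj c' -> c 0 = c' 0 ->
  energy (mom (c 0)) = 1 -> 0 <= t -> c t = c' t.
Proof.
move=> tc tc' e0 e1 t0.
have [C [r [C0 r0 H]]] := shadowing quot g_metric g_inv s_mag s_inv G2 s_derived.
apply: close_to0.
have := H c c' 0 t tc tc' e1 (lexx 0) t0.
rewrite mulr0 -e0 => /(_ (close_refl _ (lexx 0)) r0 t); apply.
by rewrite t0 lexx.
Qed.

Lemma is_derive_translate (V : normedModType R) (f : R -> V) (s t : R) d :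
  is_derive (t + s) 1 f d -> is_derive t 1 (fun x => f (x + s)) d.
Proof.
move=> /is_derive_curve h; apply/is_derive_curve; move: h; congr is_derive.
by apply/funext => x; rewrite addrA.
Qed.

Lemma traj_shift c s : traj c -> traj (fun t => c (t + s)).
Proof.
move=> [cc ct]; split.
  move=> t; apply: (@continuous_comp _ _ _ (fun t => t + s) c); last exact: cc.
  by apply: cvgD; [exact: cvg_id|exact: cvg_cst].
move=> t y dy; have [d1 d2] := ct (t + s) y dy.
have h := is_derive_translate (derivableP d1); split; first by case: h.
move=> W; case: h => _ h.
have e : 'D_1 (to_canonical y \o (fun t0 : R => c (t0 + s))) t = 'D_1 (to_canonical y \o c) (t + s).
  exact: h.
by rewrite e; exact: d2.
Qed.

Lemma flow_energy z t : unit_cotangent g z -> unit_cotangent g (phi t z).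
Proof.
move=> /unit_energy e1; have [p0 tz] := phi_flow z.
apply/unit_energy; rewrite (energy_cst quot g_metric g_inv s_mag s_inv t tz).
by rewrite p0.
Qed.

(** A flow is only given as a family of trajectories; its group property is a
    consequence of uniqueness. *)
Lemma flow_iter z i : unit_cotangent g z -> iter i (phi 1) z = phi i%:R z.
Proof.
move=> Kz; elim: i => [|i IH]; first by rewrite /= (phi_flow z).1.
rewrite iterS IH.
have [p0 tz] := phi_flow z; have [q0 tw] := phi_flow (phi i%:R z).
have := @traj_unique (fun t => phi t (phi i%:R z)) (fun t => phi (t + i%:R) z) 1 tw
  (traj_shift i%:R tz).
rewrite /= q0 add0r => /(_ erefl) -> //; first by rewrite mulrSr addrC.
by apply/unit_energy; exact: flow_energy.
Qed.

(** The trivialization of the cotangent bundle by the momentum; a point of the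
    bundle amounts to a base point and a column of numbers. *)
Definition of_mom (x : M) (m : 'cV[R]_n) : cotangent M := Cotangent x (invmx (frame quot x) *m m).

Lemma mom_of_mom x m : mom (of_mom x m) = m.
Proof. by rewrite /mom /of_mom /= mulKVmx // frame_unit. Qed.

Lemma of_momK z : of_mom (base z) (mom z) = z.
Proof. by apply: cotangent_mom_inj => //; rewrite mom_of_mom. Qed.

Lemma of_mom_canonical (y x : M) m : cdom (chart_at y) x ->
  of_mom x m = of_canonical y (chart_at y x, invmx (qframe quot y (chart_at y x)) *m m).
Proof.
move=> d; rewrite /of_canonical /= (cmapK_at d) (qframe_at quot d) /of_mom; congr Cotangent.
set E := frame quot x; set T := tchange x x y.
have uE : E \in unitmx := frame_unit quot x.
have e : T *m tchange x y x = 1%:M.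
  exact: (etrans (tchange_comp (domM x) d (domM x)) (tchange_id (domM x))).
have [uT _] := mulmx1_unit e.
by rewrite mulmxA (mulmx_invmx_mul uE uT).
Qed.

(** The trivialization is continuous: in canonical coordinates it is a matrix
    inversion followed by a product. *)
Lemma of_mom_open (A : set (cotangent M)) (x : M) m : open A -> A (of_mom x m) ->
  \forall xm \near (x, m), A (of_mom xm.1 xm.2).
Proof.
move=> oA Az; pose y := x.
pose O : set ('rV[R]_n * 'cV[R]_n) := [set qp | cimg y qp.1 /\ A (of_canonical y qp)].
have oO : open O by exact: oA.
pose F (xm : M * 'cV[R]_n) := (chart_at y xm.1, invmx (qframe quot y (chart_at y xm.1)) *m xm.2).
have dx : cdom (chart_at y) x by exact: domM.
have OF : O (F (x, m)).
  by split; [exact: cimg_chart | rewrite -of_mom_canonical].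
have cfst : {for (x, m), continuous (@fst M 'cV[R]_n)} by exact: cvg_fst.
have csnd : {for (x, m), continuous (@snd M 'cV[R]_n)} by exact: cvg_snd.
have c1 := comp_continuous_at cfst (chart_cvg dx).
have cq : {for chart_at y x, continuous (qframe quot y)}.
  exact/differentiable_continuous/qframe_diff.
have c2 := comp_continuous_at c1 cq.
have uQ : qframe quot y (chart_at y x) \in unitmx.
  rewrite (qframe_self quot x); exact: frame_unit.
have cI := differentiable_continuous (differentiable_invmx uQ).
have c3 := comp_continuous_at c2 cI.
have c4 := comp_continuous_at (pair_continuous_at c3 csnd) (@mulmx_continuous _ _ _ _ _ _).
have cF : {for (x, m), continuous F} := pair_continuous_at c1 c4.
have nO : \forall xm \near (x, m), O (F xm).
  have np : nbhs (F (x, m)) O by exact: open_nbhs_nbhs.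
  exact: (near_comp cF np).
have nd : \forall xm \near (x, m), cdom (chart_at y) xm.1.
  exact: (near_comp cfst (cdom_nbhs dx)).
by apply: filterS2 nO nd => -[x' m'] [_ /= h] d; rewrite (of_mom_canonical _ d).
Qed.

End Flow.

(** * Coverings of the unit cotangent bundle *)

Section QuotientLipschitz.
Context {R : realType} {n : nat} (G : lieGroupType R n).
Let domx (x : G) := @chart_at_dom R n G x.
Let o : G := 1%g.
Let ko := chart_at o o.

Lemma invmx_mul_cancel (F : fieldType) k (E T U : 'M[F]_k) :
  E \in unitmx -> T *m U = 1%:M -> invmx (E *m T) *m E = U.
Proof.
move=> uE TU; have [uT _] := mulmx1_unit TU.
have uET : E *m T \in unitmx by rewrite unitmx_mul uE.
by rewrite -[LHS]mulmx1 -TU !mulmxA -(mulmxA _ E T) mulVmx // mul1mx.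
Qed.

(** Along a segment in the chart at the identity, the left velocity is bounded
    by the length of the segment, and [left_curve_bound] applies to the curve
    starting at one end, translated back to the identity. *)
Lemma quotient_lipschitz : exists r C, [/\ 0 < r, 0 < C &
  forall q q', `|q - ko| <= r -> `|q' - ko| <= r ->
    let h := ((cinv (chart_at o) q)^-1 * cinv (chart_at o) q')%g in
    cdom (chart_at o) h /\ `|chart_at o h - ko| <= C * `|q' - q|].
Proof.
have [rg [Cg [rg0 Cg0 good]]] := lframe_bounds G.
have [r1 [C1 [r10 C10 bound]]] := left_curve_bound G.
pose K := C1 * (n%:R + 1) * Cg.
have n1 : 0 < (n%:R + 1 : R) by rewrite ltr_wpDl.
have K0 : 0 < K by rewrite !mulr_gt0.
pose r := Num.min rg (r1 / (4 * K)).
have r0 : 0 < r by rewrite lt_min rg0 divr_gt0 // mulr_gt0.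
exists r, K; split => // q q' hq hq'.
pose e := q' - q; pose line (s : R) := q + s *: e.
have e_le : `|e| <= 2 * r.
  have -> : e = (q' - ko) - (q - ko) by rewrite /e opprB addrA subrK.
  by rewrite (le_trans (ler_normB _ _)) // mulr_natl mulr2n lerD.
have hl s : 0 <= s <= 1 -> `|line s - ko| <= rg.
  move=> /andP[s0 s1]; have rr : r <= rg by rewrite ge_min lexx.
  have -> : line s - ko = (1 - s) *: (q - ko) + s *: (q' - ko).
    by apply/rowP => i; rewrite !mxE; ring.
  rewrite (le_trans (ler_normD _ _)) // !normrZ (ger0_norm s0) ger0_norm ?subr_ge0 //.
  have -> : rg = (1 - s) * rg + s * rg by ring.
  by apply: lerD; apply: ler_wpM2l; rewrite ?subr_ge0 // (le_trans _ rr).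
pose k s := cinv (chart_at o) (line s).
pose u s := e *m invmx (lframe o (line s)).
have lk s : 0 <= s <= 1 -> lvel k s (u s).
  move=> /hl/good[ci _ ul _].
  have v := vel_line ci; apply: vel_lvel; rewrite /=.
  have [el dl] := cinvK_at ci.
  have E := lframeE o (line s).
  have TU : tchange (k s) (k s) o *m tchange (k s) o (k s) = 1%:M.
    exact: (etrans (tchange_comp (domx _) dl (domx _)) (tchange_id (domx _))).
  have c := invmx_mul_cancel (ltrans_unit (k s)) TU.
  have -> : u s *m ltrans (k s) = e *m tchange (k s) o (k s).
    rewrite /u -mulmxA; congr (e *m _).
    exact: (etrans (congr1 (fun X => invmx X *m ltrans (k s)) E) c).
  exact: v.
pose h s := ((k 0)^-1 * k s)%g.
have l0 : line 0 = q by rewrite /line scale0r addr0.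
have l1 : line 1 = q' by rewrite /line scale1r /e addrC subrK.
have h0 : h 0 = 1%g by rewrite /h mulVg.
pose beta := (n%:R + 1) * Cg * `|e|.
have b0 : 0 <= beta by rewrite mulr_ge0 // mulr_ge0 // ltW.
have ub s : 0 <= s <= 1 -> `|u s| <= beta.
  move=> /hl/good[_ _ _ il]; rewrite (le_trans (mx_norm_mul _ _)) //.
  have -> : beta = (n%:R + 1) * `|e| * Cg by rewrite /beta; ring.
  by apply: ler_pM => //; apply: ler_wpM2r => //; rewrite lerDl.
have small : 0 + C1 * beta * 1 < r1.
  rewrite add0r mulr1 (_ : C1 * beta = K * `|e|); last by rewrite /K /beta; ring.
  apply: (@le_lt_trans _ _ (K * (2 * (r1 / (4 * K))))).
    apply: ler_wpM2l; first exact: ltW.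
    by apply: (le_trans e_le); apply: ler_wpM2l => //; rewrite ge_min lexx orbT.
  have -> : K * (2 * (r1 / (4 * K))) = r1 / 2 by field; rewrite gt_eqF.
  by rewrite ltr_pdivrMr // ltr_pMr // ltr1n.
have d0 : cdom (chart_at o) (h 0) by rewrite h0; exact: domx.
have k0 : `|chart_at o (h 0) - ko| <= 0 by rewrite h0 subrr normr0.
have i1 : 0 <= (1 : R) <= 1 by rewrite ler01 lexx.
have := bound h u 1 beta 0 ler01 b0 (fun s hs => lvel_lmul _ (lk s hs)) ub d0 k0 small 1 i1.
rewrite /h /k l0 l1 add0r mulr1 => -[d hh]; split => //.
by apply: (le_trans hh); rewrite /K /beta /e !mulrA.
Qed.

End QuotientLipschitz.

(** Cells of the cubic grid of mesh [eta] in a cube, labelled by the integer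
    parts of the coordinates. *)
Lemma grid (R : realType) m (R0 eta : R) : 0 < R0 -> 0 < eta ->
  exists c : 'rV[R]_m -> {ffun 'I_m -> 'I_(Num.truncn (2 * R0 / eta)).+1},
  forall v v', `|v| <= R0 -> `|v'| <= R0 -> c v = c v' -> `|v' - v| <= eta.
Proof.
move=> R00 eta0.
pose k (x : R) := Num.truncn ((x + R0) / eta).
exists (fun v => [ffun j => inord (k (v 0 j))]) => v v' hv hv' e.
apply: mx_norm_le => [|i j]; first exact: ltW.
 rewrite !ord1 {i} !mxE.
(* The label is in range, so [inord] loses nothing. *)
have kP (w : 'rV[R]_m) : `|w| <= R0 ->
    (k (w ord0 j) < (Num.truncn (2 * R0 / eta)).+1)%N /\ 0 <= (w 0 j + R0) / eta.
  move=> hw; have := le_trans (mx_entry_le w 0 j) hw; rewrite ler_norml => /andP[h1 h2].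
  have h0 : 0 <= (w 0 j + R0) / eta by rewrite divr_ge0 ?(ltW eta0) // -lerBlDr sub0r.
  split => //; rewrite ltnS; apply: le_truncn; rewrite ler_pM2r ?invr_gt0 //.
  by rewrite mulr_natl mulr2n lerD2r.
have [l1 p1] := kP _ hv; have [l2 p2] := kP _ hv'.
have ek : k (v 0 j) = k (v' 0 j).
  by move/ffunP/(_ j): (e); rewrite !ffunE => /(congr1 (@nat_of_ord _)); rewrite !inordK.
have /andP[a1 b1] := truncn_itv p1; have /andP[a2 b2] := truncn_itv p2.
rewrite -/(k _) -ek in a2 b2; rewrite -/(k _) in a1 b1.
have -> : v' 0 j - v 0 j = ((v' 0 j + R0) / eta - (v 0 j + R0) / eta) * eta.
  by field; rewrite gt_eqF.
rewrite normrM (gtr0_norm eta0) -[leRHS]mul1r ler_pM2r //.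
rewrite ler_norml; rewrite -natr1 in b1 b2.
by apply/andP; split; lra.
Qed.

Section Coverings.
Context {R : realType} {n : nat} (G : lieGroupType R n) (Gam : set G)
  (M : manifoldType R n) (p : G -> M).
Hypothesis quot : left_quotient Gam p.
Variables (g sigma : M -> 'M[R]_n).
Hypothesis g_metric : riemannian_metric g.
Hypothesis g_inv : left_invariant (pullback p g).
Hypothesis cptM : compact [set: M].
Local Notation mom := (mom quot).
Local Notation velocity := (velocity p g).
Local Notation energy := (energy p g).
Local Notation close_to := (close_to quot).
Local Notation of_mom := (of_mom quot).
Let domM (x : M) := @chart_at_dom R n M x.
Let domG (x : G) := @chart_at_dom R n G x.
Let o : G := 1%g.
Let ko := chart_at o o.

(** By compactness, finitely many translates of a small ball around the
    identity cover the quotient. The filter [Fs] formalizes the choice of a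
    large enough finite list. *)
Lemma finite_translates (r : R) : 0 < r -> exists J : seq G, forall x : M,
  exists2 a, a \in J & exists2 l, `|l - ko| <= r & p (a * cinv (chart_at o) l)%g = x.
Proof.
move=> r0.
(* The filter generated by the sets of lists that contain a given list. *)
pose Fs : set_system (seq G) := [set P | exists s0 : seq G, forall s : seq G, {subset s0 <= s} -> P s].
have FF : Filter Fs.
  split.
  - by exists [::].
  - move=> P Q [s0 h0] [s1 h1]; exists (s0 ++ s1) => s hs; split.
      by apply: h0 => a ha; apply: hs; rewrite mem_cat ha.
    by apply: h1 => a ha; apply: hs; rewrite mem_cat ha orbT.
  - by move=> P Q PQ [s0 h0]; exists s0 => s /h0/PQ.
pose P (s : seq G) (x : M) := exists2 a, a \in s & exists2 l, `|l - ko| <= r &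
  p (a * cinv (chart_at o) l)%g = x.
suff : \near Fs, [set: M] `<=` P Fs.
  by move=> [s0 h]; exists s0 => x; exact: (h s0).
have /compact_near_coveringP cov := cptM; apply: cov => x _.
pose a := lift quot x; have pa : p a = x := liftK quot x.
have [U [s [oU Ua oV K ds]]] := quot_inverse quot a.
have sa : s x = a by rewrite -pa; apply: K; rewrite inE.
have cs : {for x, continuous s} by have := (ds a Ua).1; rewrite pa.
(* The displacement from [a] of the local lift; it is the identity at [x]. *)
pose w (x' : M) := (a^-1 * s x')%g.
have wx : w x = o by rewrite /w sa mulVg.
have cw : {for x, continuous w}.
  apply: (comp_continuous_at cs (g := fun k => a^-1 * k)%g); exact: (mdiff_lmul _ _).1.
have dw : cdom (chart_at o) (w x) by rewrite wx; exact: domG.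
have n1 : \forall x' \near x, (p @` U) x'.
  by apply: open_nbhs_nbhs; split => //; exists a.
have n2 : \forall x' \near x, cdom (chart_at o) (w x') by exact: (near_comp cw (cdom_nbhs dw)).
have n3 : \forall x' \near x, `|chart_at o (w x') - ko| <= r.
  have cc := comp_continuous_at cw (chart_cvg dw).
  have np : nbhs (chart_at o (w x)) [set q | `|q - ko| <= r].
    rewrite wx -/ko; apply/nbhs_ballP; exists r => // q.
    by rewrite -ball_normE /= distrC => /ltW.
  exact: (near_comp cc np).
exists ([set x' | (p @` U) x' /\ (cdom (chart_at o) (w x') /\ `|chart_at o (w x') - ko| <= r)],
   [set s : seq G | a \in s]) => /=.
  split; first by apply: filterI => //; exact: filterI.
  by exists [:: a] => t; apply; rewrite mem_seq1.
move=> [x' t] /= [[[k Uk <-] [dk hk]] at_].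
exists a => //; exists (chart_at o (w (p k))) => //.
by rewrite (cmapK_at dk) /w mulVKg K // inE.
Qed.

(** Unit covectors have bounded momenta because the energy is positive
    definite. *)
Lemma mom_bound : exists2 K, 0 < K & forall m, energy m = 1 -> `|m| <= K.
Proof.
have [K K0 hK] := velocity_bound quot g_metric g_inv.
exists (n%:R * `|metric0 p g| * Num.sqrt K + 1).
  by rewrite ltr_wpDl // !mulr_ge0 // sqrtr_ge0.
move=> m e1; have := ler_wsqrtr (hK m); rewrite e1 mulr1 sqrtr_sqr normr_id => h.
rewrite (le_trans (mom_le_velocity quot g_metric g_inv m)) // ler_wpDr //.
by rewrite ler_wpM2l // mulr_ge0.
Qed.

Lemma energy_sphere_compact : compact [set v : 'rV[R]_n | energy v^T = 1].
Proof.
have [K K0 hK] := mom_bound.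
apply: bounded_closed_compact.
  exists K; split; first exact: num_real.
  move=> x hx v /= /hK h; apply: ltW; apply: le_lt_trans hx; apply: le_trans h.
  by rewrite -{1}[v]trmxK mx_norm_tr_le.
have -> : [set v : 'rV[R]_n | energy v^T = 1] = (fun v => bil (invmx (metric0 p g)) v v) @^-1` [set 1].
  by apply/seteqP; split => v; rewrite /= /energy /bil trmxK.
apply: closed_comp; last exact: closed_eq.
by move=> v _; exact: bil_continuous.
Qed.

(** Compactness of the product of the quotient with the sphere of momenta.
    Near a given point, nearness in the sense of [close_to] implies nearness
    in the trivialization, because multiplication in the group and the
    projection are continuous. *)
Lemma lebesgue_number (U : set (set (cotangent M))) :
  open_cover (unit_cotangent g) U ->
  exists2 eps, 0 < eps & forall z, unit_cotangent g z ->
    exists2 A, U A & forall z', close_to eps z z' -> A z'.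
Proof.
move=> [oU cU].
pose P (eps : R) (xv : M * 'rV[R]_n) := exists2 A, U A &
  forall z', close_to eps (of_mom xv.1 xv.2^T) z' -> A z'.
pose Q : set (M * 'rV[R]_n) := [set: M] `*` [set v : 'rV[R]_n | energy v^T = 1].
have cQ : compact Q by apply: compact_setX => //; exact: energy_sphere_compact.
pose F0 : set_system R := (0:R)^'+.
suff h : \near F0, Q `<=` P F0.
  have [eps [e0 he]] : exists eps : R, 0 < eps /\ Q `<=` P eps.
    have h' : \forall e \near (0:R)^'+, 0 < e /\ Q `<=` P e.
      by apply: filterI; [exact: nbhs_right_gt | exact: h].
    by have [e he] := filter_ex h'; exists e.
  exists eps => // z /(unit_energy quot g_metric g_inv) e1.
  have [] := he (base z, (mom z)^T); first by split => //=; rewrite trmxK.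
  by move=> A UA hA; exists A => // z' hz; apply: hA; rewrite /= trmxK of_momK.
have FF : Filter F0 by rewrite /F0; typeclasses eauto.
move/compact_near_coveringP/near_covering_withinP : cQ; apply => -[x v] [_ /= ev].
have [A UA Az] : (\bigcup_(A in U) A) (of_mom x v^T).
  by apply: cU; apply/(unit_energy quot g_metric g_inv); rewrite mom_of_mom.
have [[V W] /= [nV nW] VW] := of_mom_open (oU A UA) Az.
have [d d0 Hd] := ball_nbhs nW.
pose a := lift quot x; have pa : p a = x := liftK quot x.
have [U0 [s [oU0 Ua oV K ds]]] := quot_inverse quot a.
have sa : s x = a by rewrite -pa; apply: K; rewrite inE.
have cs : {for x, continuous s} by have := (ds a Ua).1; rewrite pa.
have cfst : {for (x, ko), continuous (@fst M 'rV[R]_n)} by exact: cvg_fst.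
have csnd : {for (x, ko), continuous (@snd M 'rV[R]_n)} by exact: cvg_snd.
have c1 := comp_continuous_at cfst cs.
have c2 := comp_continuous_at csnd (cinv_cvg (cimg_chart (domG o))).
have c3 := comp_continuous_at (pair_continuous_at c1 c2) (@lie_mul_continuous _ _ G _).
have c4 := comp_continuous_at c3 (quot_mdiff quot _).1.
have np : nbhs (p (s x * cinv (chart_at o) ko)%g) V.
  by rewrite sa (cmapK_at (domG o)) mulg1 pa.
have [[V1 W1] /= [nV1 nW1] VW1] := near_comp c4 np.
have [r1 r10 Hr1] := ball_nbhs nW1.
have nV2 : \forall x' \near x, (p @` U0) x'.
  by apply: open_nbhs_nbhs; split => //; exists a.
pose e1 := Num.min r1 (d / 2).
have d2 : 0 < d / 2 by rewrite divr_gt0.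
exists ([set xv | (V1 xv.1 /\ (p @` U0) xv.1) /\ `|xv.2 - v| <= d / 2], [set e | e < e1]).
  split => /=; last by apply: nbhs_right_lt; rewrite lt_min r10.
  exists ([set x' | V1 x' /\ (p @` U0) x'], [set v' | `|v' - v| <= d / 2]) => /=; last by case.
  split; first exact: filterI.
  apply/nbhs_ballP; exists (d / 2) => // v'; rewrite -ball_normE /= distrC; exact: ltW.
move=> [[x' v'] e] /= [[[V1x [k Uk kx]] hv] he] _.
move: he; rewrite lt_min => /andP[er1 ed2].
exists A => // z' [b [l [hl pb bl lk mk]]].
rewrite mom_of_mom /= in mk pb.
rewrite -(of_momK quot z'); apply: (VW (base z', mom z')); split => /=.
  have psx : p (s x') = x' by rewrite -kx K // inE.
  rewrite -bl (quot_lmul quot (b := s x')) ?pb ?psx //.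
  apply: (VW1 (x', l)); split => //=; apply: Hr1; apply: (le_trans lk); exact: ltW.
apply: Hd.
have -> : mom z' - v^T = (mom z' - v'^T) + (v' - v)^T by rewrite linearB /= addrA subrK.
rewrite (le_trans (ler_normD _ _)) // [d]splitr lerD //.
  by apply: (le_trans mk); exact: ltW.
by apply: le_trans hv; exact: mx_norm_tr_le.
Qed.

(** A cotangent vector is labelled by one of finitely many balls that contains
    its base point, the cell of the position in this ball, and the cell of its
    momentum. The number of cells is of order [eta^-1 ^+ n] for positions as
    for momenta. *)
Lemma polynomial_partition : exists C A, [/\ 0 < C, 0 < A &
  forall eta : R, 0 < eta -> eta <= 1 -> exists (I : finType) (cl : cotangent M -> I),
    #|I|%:R <= A * (eta^-1) ^+ (2 * n) /\
    forall z z', unit_cotangent g z -> unit_cotangent g z' -> cl z = cl z' ->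
      close_to (C * eta) z z'].
Proof.
have [r [C [r0 C0 lip]]] := quotient_lipschitz G.
have [K K0 hK] := mom_bound.
have [J hJ] := finite_translates r0.
pose R0 := Num.max r K.
have R00 : 0 < R0 by rewrite lt_max r0.
have /choice[cov hcov] : forall x : M, exists al : G * 'rV[R]_n,
    [/\ al.1 \in J, `|al.2 - ko| <= r & p (al.1 * cinv (chart_at o) al.2)%g = x].
  by move=> x; have [a aJ [l hl e]] := hJ x; exists (a, l).
exists (C + 1), ((size J).+1%:R * (2 * R0 + 1) ^+ (2 * n)); split.
- by rewrite addr_gt0.
- by rewrite mulr_gt0 // exprn_gt0 // addr_gt0 // mulr_gt0.
move=> eta eta0 eta1.
have [c hc] := grid n R00 eta0.
exists ('I_(size J).+1 * ({ffun 'I_n -> 'I_(Num.truncn (2 * R0 / eta)).+1} *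
  {ffun 'I_n -> 'I_(Num.truncn (2 * R0 / eta)).+1}))%type.
exists (fun z => (inord (index (cov (base z)).1 J), (c ((cov (base z)).2 - ko), c (mom z)^T))).
split.
  rewrite !card_prod !card_ffun !card_ord -expnD addnn -mul2n natrM natrX -[leRHS]mulrA.
  rewrite ler_pM2l ?ltr0n // -exprMn lerXn2r ?nnegrE //.
    by rewrite mulr_ge0 ?invr_ge0 ?(ltW eta0) // addr_ge0 // mulr_ge0 // ltW.
  have h0 : 0 <= 2 * R0 / eta by rewrite divr_ge0 ?(ltW eta0) // mulr_ge0 // ltW.
  have /andP[h1 _] := truncn_itv h0.
  by rewrite -[in leLHS]natr1 [leRHS]mulrDl lerD // mul1r invf_ge1.
move=> z z' /(unit_energy quot g_metric g_inv) ez /(unit_energy quot g_metric g_inv) ez'.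
have [aJ hl e] := hcov (base z); have [aJ' hl' e'] := hcov (base z').
case=> /(congr1 (@nat_of_ord _)); rewrite !inordK ?ltnS ?index_size // => /(congr1 (nth o J)).
rewrite !nth_index // => ea el em.
set q := (cov (base z)).2 in hl e el; set q' := (cov (base z')).2 in hl' e' el.
have rR : r <= R0 by rewrite le_max lexx.
have KR : K <= R0 by rewrite le_max lexx orbT.
have dq : `|q' - q| <= eta.
  have := hc _ _ (le_trans hl rR) (le_trans hl' rR) el.
  by rewrite opprB addrA subrK.
have dm : `|mom z' - mom z| <= eta.
  have bm w : energy (mom w) = 1 -> `|(mom w)^T| <= R0.
    by move=> /hK h; apply: (le_trans (mx_norm_tr_le _)); exact: (le_trans h).
  have h := hc _ _ (bm _ ez) (bm _ ez') em.
  have -> : mom z' - mom z = ((mom z')^T - (mom z)^T)^T by rewrite linearB /= !trmxK.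
  by apply: (le_trans (mx_norm_tr_le _)).
have [dh hh] := lip q q' hl hl'.
set h := (_ * _)%g in dh hh.
exists ((cov (base z)).1 * cinv (chart_at o) q)%g, (chart_at o h); split => //.
- exact: cimg_chart.
- by rewrite (cmapK_at dh) /h -mulgA mulKVg ea.
- by apply: (le_trans hh); apply: ler_pM => //; [exact: ltW | rewrite lerDl].
- by apply: (le_trans dm); rewrite ler_peMl ?(ltW eta0) // lerDr ltW.
Qed.

End Coverings.

(** * Topological entropy *)

(** A sublinear bound on the logarithm, obtained from [ln y < y] at the square
    root. *)
Lemma ln_le_sqrt (R : realType) (x : R) : 1 <= x -> ln x <= 2 * Num.sqrt x.
Proof.
move=> x1; have s0 : 0 < Num.sqrt x by rewrite sqrtr_gt0 (lt_le_trans ltr01).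
have -> : ln x = 2 * ln (Num.sqrt x).
  by rewrite -{1}(sqr_sqrtr (le_trans ler01 x1)) lnXn // mulr_natl.
by rewrite ler_pM2l // ltW // ln_sublinear.
Qed.

Section Entropy.
Context {R : realType} {T : topologicalType} (K : set T) (f : T -> T).

(** The infimum of a set of natural numbers is either zero or at least one, so
    its logarithm is nonnegative. *)
Lemma min_subcover_bounds (V : set (set T)) m (s : 'I_m -> set T) (B : R) :
  (forall i, V (s i)) -> K `<=` \bigcup_i s i -> m%:R <= B -> 1 <= B ->
  0 <= ln (min_subcover R K V) <= ln B.
Proof.
move=> Vs cov mB B1; rewrite /min_subcover.
set N := (X in inf X).
have Nm : N m%:R by exists m => //; exists s.
have lb0 : lbound N 0 by move=> _ [k _ <-]; exact: ler0n.
have le : inf N <= B by apply: le_trans mB; apply: ge_inf => //; exists 0.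
have B0 : 0 < B := lt_le_trans ltr01 B1.
(* No sets at all are needed when [K] is empty; then the infimum is zero, and
   [ln 0 = 0]. *)
have [N0 | N0] := pselect (N 0).
  have -> : inf N = 0.
    apply/eqP; rewrite eq_le (ge_inf _ N0) /=; last by exists 0.
    by apply: lb_le_inf lb0; exists 0.
  by rewrite ln0 // lexx ln_ge0.
have i1 : 1 <= inf N.
  apply: lb_le_inf; first by exists m%:R.
  move=> _ [k hk <-]; rewrite ler1n lt0n; apply/eqP => k0.
  by apply: N0; exists k => //; rewrite k0.
by rewrite ln_ge0 // ler_ln // posrE // (lt_le_trans ltr01).
Qed.

(** Polynomial growth of cardinals gives logarithmic growth, hence no
    exponential growth rate. *)
Lemma polynomial_cvg0 (a : nat -> R) (C : R) D : 1 <= C ->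
  (forall k, 0 <= a k <= ln (C * (1 + k%:R) ^+ D)) ->
  (fun k => a k / k%:R) @ \oo --> (0 : R).
Proof.
move=> C1 ha; pose B := ln C + 2 * D%:R.
have B0 : 0 <= B by rewrite addr_ge0 ?ln_ge0 // mulr_ge0.
have bnd k : (0 < k)%N -> a k / k%:R <= 2 * B / Num.sqrt (1 + k%:R).
  move=> k0; set x : R := 1 + k%:R.
  have kR : 0 < k%:R :> R by rewrite ltr0n.
  have x1 : 1 <= x by rewrite lerDl.
  have x0 : 0 < x := lt_le_trans ltr01 x1.
  have s1 : 1 <= Num.sqrt x by have := ler_wsqrtr x1; rewrite sqrtr1.
  have s0 : 0 < Num.sqrt x := lt_le_trans ltr01 s1.
  have h1 : a k <= B * Num.sqrt x.
    have /andP[_ h] := ha k; apply: (le_trans h).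
    rewrite lnM ?posrE ?exprn_gt0 ?(lt_le_trans ltr01) // lnXn // mulrDl lerD //.
      by rewrite ler_peMr ?ln_ge0.
    rewrite -[leLHS]mulr_natl -mulrA mulrCA ler_wpM2l //.
    exact: ln_le_sqrt.
  rewrite ler_pdivrMr // (le_trans h1) //.
  have -> : 2 * B / Num.sqrt x * k%:R = B * (2 * k%:R / Num.sqrt x) by ring.
  rewrite ler_wpM2l // ler_pdivlMr // -expr2 sqr_sqrtr; last exact: ltW.
  by rewrite /x mulr_natl mulr2n lerD2r ler1n.
apply/cvgrPdist_le => e e0; rewrite /=.
have near1 : \forall k \near \oo, (2 * B / e) ^+ 2 <= k%:R :> R by exact: nbhs_infty_ger.
have near2 : \forall k \near \oo, (0 < k)%N by exact: nbhs_infty_gt.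
apply: filterS (filterI near1 near2) => k [h k0].
have a0 : 0 <= a k / k%:R by rewrite divr_ge0 //; have /andP[] := ha k.
rewrite sub0r normrN (ger0_norm a0) (le_trans (bnd k k0)) //.
have s0 : 0 < Num.sqrt (1 + k%:R) :> R by rewrite sqrtr_gt0 ltr_wpDr.
have Be : 0 <= 2 * B / e by rewrite divr_ge0 ?(ltW e0) // mulr_ge0.
rewrite ler_pdivrMr // -ler_pdivrMl // mulrC -(ger0_norm Be) -sqrtr_sqr ler_wsqrtr //.
by apply: (le_trans h); rewrite lerDr.
Qed.

(** The supremum that defines the entropy is over a nonempty family, which
    contains the trivial cover. *)
Lemma polynomial_covers_entropy0 :
  (forall U, open_cover K U -> exists (C : R) D, 1 <= C /\ forall k, exists m (s : 'I_m -> set T),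
    [/\ m%:R <= C * (1 + k%:R) ^+ D, forall i, iterated_join f U k (s i) &
        K `<=` \bigcup_i s i]) ->
  topological_entropy R K f = 0%E.
Proof.
move=> H; rewrite /topological_entropy.
have lim0 U : open_cover K U ->
    limn_esup (fun k => (ln (min_subcover R K (iterated_join f U k)) / k%:R)%:E) = 0%E.
  move=> /H[C [D [C1 hU]]].
  have ha k : 0 <= ln (min_subcover R K (iterated_join f U k)) <= ln (C * (1 + k%:R) ^+ D).
    have [m [s [hm Us cov]]] := hU k; apply: min_subcover_bounds Us cov hm _.
    by rewrite -[leLHS]mulr1 ler_pM // exprn_ege1 // lerDl.
  have cv := polynomial_cvg0 C1 ha.
  have cvE : (fun k => (ln (min_subcover R K (iterated_join f U k)) / k%:R)%:E) @ \oo --> 0%:E.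
    by apply/fine_cvgP; split; [exact: nearW | exact: cv].
  rewrite is_cvg_limn_esupE; first exact: cvg_lim.
  by apply/cvg_ex; exists 0%:E.
have UT : open_cover K [set [set: T]].
  by split => [_ -> | x _]; [exact: openT | exists [set: T]].
rewrite (_ : image _ _ = [set 0%E]) ?ereal_sup1 //.
apply/seteqP; split => [_ [U oU <-] | _ ->] /=; first exact: lim0.
by exists [set [set: T]] => //; exact: lim0.
Qed.

End Entropy.

Section MagneticEntropy.
Context {R : realType} {n : nat} (G : lieGroupType R n) (Gam : set G)
  (M : manifoldType R n) (p : G -> M).
Hypothesis quot : left_quotient Gam p.
Variables (g sigma : M -> 'M[R]_n) (phi : R -> cotangent M -> cotangent M).
Hypothesis cptM : compact [set: M].
Hypothesis g_metric : riemannian_metric g.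
Hypothesis g_inv : left_invariant (pullback p g).
Hypothesis s_mag : magnetic_field sigma.
Hypothesis s_inv : left_invariant (pullback p sigma).
Hypothesis G2 : two_step_nilpotent G.
Hypothesis s_derived : forall X D : 'rV[R]_n, derived_algebra G D ->
     bil (pullback p sigma (1%g : G)) X D = 0.
Hypothesis phi_flow : magnetic_flow g sigma phi.
Local Notation close_to := (close_to quot).

Lemma close_to_le eps eps' z z' : eps <= eps' -> close_to eps z z' -> close_to eps' z z'.
Proof.
by move=> h [a [l [h1 h2 h3 h4 h5]]]; exists a, l; split => //; exact: le_trans h.
Qed.

(** Each nonempty cell of a partition adapted to the time [k] is represented
    by one of its points, whose orbit visits elements of [U] at the times
    below [k]; by shadowing the whole cell follows the same itinerary. *)
Lemma polynomial_covers U : open_cover (unit_cotangent g) U ->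
  exists (C : R) D, 1 <= C /\ forall k, exists m (s : 'I_m -> set (cotangent M)),
    [/\ m%:R <= C * (1 + k%:R) ^+ D, forall i, iterated_join (phi 1) U k (s i) &
        unit_cotangent g `<=` \bigcup_i s i].
Proof.
move=> oU; set K := unit_cotangent g.
have [eps e0 leb] := lebesgue_number quot g_metric g_inv cptM oU.
have [Cs [r [Cs0 r0 shadow]]] := shadowing quot g_metric g_inv s_mag s_inv G2 s_derived.
have [Cp [A [Cp0 A0 part]]] := polynomial_partition quot g_metric g_inv cptM.
have /choice[F hF] : forall z, exists B, K z -> U B /\ forall z', close_to eps z z' -> B z'.
  move=> z; have [/leb[B UB hB]|nK] := pselect (K z); first by exists B.
  by exists set0.
(* [c0] is chosen such that the separation [Cs * Cp * c0], which does not
   depend on [k], is both below the Lebesgue number and in the range of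
   shadowing. *)
pose d := Num.min eps (r / 2); pose c0 := Num.min 1 (d / (Cs * Cp)).
have d0 : 0 < d by rewrite lt_min e0 divr_gt0.
have CC0 : 0 < Cs * Cp by rewrite mulr_gt0.
have c00 : 0 < c0 by rewrite lt_min ltr01 divr_gt0.
have hc : Cs * Cp * c0 <= d by rewrite mulrC -ler_pdivlMr // ge_min lexx orbT.
have heps : Cs * Cp * c0 <= eps by rewrite (le_trans hc) // ge_min lexx.
have hr : Cs * Cp * c0 < r.
  by apply: (le_lt_trans hc); rewrite gt_min ltr_pdivrMr // ltr_pMr // ltr1n orbT.
pose A' := A * c0^-1 ^+ (2 * n).
exists (A' + 1), (3 * (2 * n))%N; split.
  by rewrite lerDr mulr_ge0 ?(ltW A0) // exprn_ge0 // invr_ge0 ltW.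
move=> k; pose x : R := 1 + k%:R; pose eta := c0 / x ^+ 3.
have x1 : 1 <= x by rewrite lerDl.
have x0 : 0 < x ^+ 3 by rewrite exprn_gt0 // (lt_le_trans ltr01).
have eta0 : 0 < eta by rewrite divr_gt0.
have eta1 : eta <= 1.
  rewrite ler_pdivrMr // mul1r (@le_trans _ _ 1) //; first by rewrite ge_min lexx.
  by rewrite exprn_ege1.
have [I [cl [cardI hcl]]] := part eta eta0 eta1.
(* Only the labels that occur are kept, since an empty cell has no itinerary
   and [U] may be empty. *)
pose P := [pred i : I | `[< exists z, K z /\ cl z = i >]].
have /choice[rep hrep] : forall i : 'I_#|P|, exists z, K z /\ cl z = enum_val i.
  by move=> i; have /asboolP := enum_valP i.
have scale : Cs * (1 + k%:R) ^+ 3 * (Cp * eta) = Cs * Cp * c0.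
  by rewrite /eta -/x; field; rewrite gt_eqF // (lt_le_trans ltr01).
exists #|P|, (fun i : 'I_#|P| => [set z | forall j : nat, (j < k)%N -> F (iter j (phi 1) (rep i)) (iter j (phi 1) z)]).
split.
- have h1 : #|P|%:R <= #|I|%:R :> R by rewrite ler_nat max_card.
  apply: (le_trans h1); apply: (le_trans cardI).
  rewrite /eta invf_div exprMn mulrCA -exprM [leRHS]mulrC ler_pM2l; last first.
    by rewrite exprn_gt0 // (lt_le_trans ltr01).
  by rewrite lerDl.
- move=> i; exists (fun j => F (iter j (phi 1) (rep i))) => // j jk.
  have [Kz _] := hrep i.
  have Kj : K (iter j (phi 1) (rep i)).
    rewrite (flow_iter quot g_metric g_inv s_mag s_inv G2 s_derived phi_flow j Kz).
    exact: (flow_energy quot g_metric g_inv s_mag s_inv phi_flow).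
  by have [] := hF _ Kj.
- move=> z Kz.
  have Pz : cl z \in P by apply/asboolP; exists z.
  exists (enum_rank_in Pz (cl z)) => // j jk.
  set i := enum_rank_in _ _; have [Ki ei] := hrep i.
  rewrite enum_rankK_in // in ei.
  have fi w := flow_iter quot g_metric g_inv s_mag s_inv G2 s_derived phi_flow j (z := w).
  rewrite (fi _ Ki) (fi _ Kz).
  have Kj : K (phi j%:R (rep i)) by exact: (flow_energy quot g_metric g_inv s_mag s_inv phi_flow).
  have [_ ] := hF _ Kj; apply.
  have [p0 tz] := phi_flow (rep i); have [q0 tw] := phi_flow z.
  have := shadow (fun t => phi t (rep i)) (fun t => phi t z) (Cp * eta) k%:R tz tw.
  rewrite /= p0 q0 scale => h.
  apply: (close_to_le heps); apply: h => //.
  + exact/(unit_energy quot g_metric g_inv).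
  + by rewrite mulr_ge0 // ltW.
  + exact: hcl.
  + by rewrite ler0n ler_nat ltnW.
Qed.

End MagneticEntropy.

Theorem theorem1p1 (R : realType) (n : nat) (G : lieGroupType R n)
    (Gam : set G) (M : manifoldType R n) (p : G -> M)
    (g sigma : M -> 'M[R]_n) (phi : R -> cotangent M -> cotangent M) :
  simply_connected R G ->
  two_step_nilpotent G ->
  discrete_subgroup Gam ->
  left_quotient Gam p ->
  compact [set: M] ->
  riemannian_metric g ->
  left_invariant (pullback p g) ->
  magnetic_field sigma ->
  left_invariant (pullback p sigma) ->
  (forall X D : 'rV[R]_n, derived_algebra G D ->
     bil (pullback p sigma (1%g : G)) X D = 0) ->
  rational_class sigma ->
  magnetic_flow g sigma phi ->
  topological_entropy R (unit_cotangent g) (phi 1) = 0%E.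
Proof.
move=> _ G2 _ quot cptM g_metric g_inv s_mag s_inv s_derived _ phi_flow.
apply: polynomial_covers_entropy0 => U oU.
exact: (polynomial_covers quot cptM g_metric g_inv s_mag s_inv G2 s_derived phi_flow).
Qed.
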